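(* Let $f_\sigma(x)=g_\sigma(x)/\mathcal M_\sigma$ be the Gaussian kernel function of width $\sigma$ on $(-\pi,\pi)$, and consider the Filtered Moment projection Phase Estimator $\tilde\phi$ assuming global depolarizing noise, with kernel $f_\sigma$, fidelity $F$ and ground state overlap $a_0$. Assume that $\mathcal D$ is a promise interval for $\phi_0$ with inner buffer $d_{\mathrm{in}}=|\mathcal D|/6$ and outer buffer $d_{\mathrm{out}}=d$. Then, for $$\sigma\le\frac{|\mathcal D|}{6}\min\left(1,\left[1.2+\log\left(1+0.7\,\frac{|\mathcal D|}{2\pi}\frac{1-F}{Fa_0}\right)\right]^{-1/2}\right),$$ the asymptotic bias and variance of the estimator satisfy $$|\phi_0-\phi_*|\le22\,\sigma^2g_\sigma(d)\,\frac{1-a_0}{a_0}\left(1+\frac{1-F}{Fa_0}\right)\frac{|\mathcal D|}{d}+O\big(g_\sigma(d)^2\big),$$ $$\lim_{M\to\infty}M\operatorname{Var}[\tilde\phi]\le11\,\sigma^2\left(1+\frac{1-F}{Fa_0}\right)\left(1+\frac1{2\pi}\frac{1-F}{Fa_0}\right)+O\big(g_\sigma(d)\big).$$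
   Context: Notation. $g_\sigma(x)=\frac1{\sqrt{2\pi}\sigma}e^{-x^2/2\sigma^2}$, $G_\sigma(\phi)=\int_{\mathcal D}g_\sigma(x-\phi)\,dx$, $\mathcal M_\sigma=\int_{-\pi}^\pi g_\sigma(x)\,dx$. Data. A unitary $U$ has eigenphases $\phi_j\in[0,2\pi)$, and a state $|\psi\rangle$ has overlaps $a_j=|\langle\phi_j|\psi\rangle|^2$, $\sum_ja_j=1$, $a_0>0$; $F\in(0,1)$ is the circuit fidelity. Under global depolarizing noise the samples (restricted to $\mathcal D$) are i.i.d. with density on $\mathcal D$ $$P(x)=\frac{F\sum_ja_jg_\sigma(x-\phi_j)+(1-F)\frac1{2\pi}\mathcal M_\sigma}{F\sum_ja_jG_\sigma(\phi_j)+(1-F)\frac{|\mathcal D|}{2\pi}\mathcal M_\sigma}.$$ Promise interval. $\mathcal D$ is an interval of length $|\mathcal D|$ centred at $\phi_{\mathrm{guess}}$, contained in $[d_{\mathrm{out}},2\pi-d_{\mathrm{out}})$, such that $|\phi_0-\phi_{\mathrm{guess}}|\le|\mathcal D|/2-d_{\mathrm{in}}$ (so $\le|\mathcal D|/3$ here) and for all $j\neq0$, $\phi_j\notin[\phi_{\mathrm{guess}}-|\mathcal D|/2-d_{\mathrm{out}},\,\phi_{\mathrm{guess}}+|\mathcal D|/2+d_{\mathrm{out}}]$. Estimator. $\tilde\phi=\operatorname{arg\,max}_\phi\frac1M\sum_{j=1}^M\log Q(x_j|\phi)$ for $M$ independent samples from $P$, with model $$Q(x|\phi)=\frac{Fa_0f_\sigma(x-\phi)+(1-F)\frac1{2\pi}}{Fa_0\int_{\mathcal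 D}f_\sigma(y-\phi)\,dy+(1-F)\frac{|\mathcal D|}{2\pi}},\qquad x\in\mathcal D .$$ $\phi_*=\lim_{M\to\infty}\mathbb E[\tilde\phi]=\operatorname{arg\,max}_\phi\int_{\mathcal D}P(x)\log Q(x|\phi)\,dx$. The $O(\cdot)$ terms are the remainders beyond leading order in the model error $P-Q(\cdot|\phi_0)$, as $g_\sigma(d)\to0$. *)

(* Defs.v *)
From HB Require Import structures.
From mathcomp Require Import all_boot all_order all_algebra.
From mathcomp Require Import all_classical all_reals all_analysis.

Set Implicit Arguments.
Unset Strict Implicit.
Unset Printing Implicit Defensive.

Import Order.TTheory GRing.Theory Num.Theory.
Import numFieldNormedType.Exports.

Local Open Scope classical_set_scope.
Local Open Scope ring_scope.

Section Estimator.
Context {R : realType}.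
Local Notation mu := (@lebesgue_measure R).

Definition argmax (A : set R) (h : R -> R) : set R :=
  [set x | A x /\ forall y, A y -> h y <= h x].

Definition gauss (sigma x : R) : R := normal_pdf 0 sigma x.

Definition gauss_mass (sigma : R) : R :=
  \int[mu]_(x in `]- pi, pi[) gauss sigma x.

(* Normalized on (-pi, pi), but not truncated or periodized: for a long
   interval D, x - phi may leave (-pi, pi) and the same formula is used. *)
Definition gauss_kernel (sigma x : R) : R := gauss sigma x / gauss_mass sigma.

Definition data_interval (guess w : R) : set R :=
  `[guess - w / 2, guess + w / 2].

(* Eigenphases of the unitary, and overlaps of the state with its
   eigenvectors; the index ord0 is the target (ground state). *)
Definition spectral_data (n : nat) (phi a : 'I_n.+1 -> R) : Prop :=
  [/\ forall j, 0 <= phi j < 2 * pi,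
      forall j, 0 <= a j,
      \sum_j a j = 1
    & 0 < a ord0].

Definition promise_interval (n : nat) (phi : 'I_n.+1 -> R)
    (guess w d_in d_out : R) : Prop :=
  [/\ 0 < w,
      data_interval guess w `<=` `[d_out, 2 * pi - d_out[,
      `|phi ord0 - guess| <= w / 2 - d_in
    & forall j, j != ord0 ->
        phi j \notin `[guess - w / 2 - d_out, guess + w / 2 + d_out]].

(* Density, on the data interval, of a sample under global depolarizing
   noise with circuit fidelity F. *)
Definition sample_density (F : R) (n : nat) (phi a : 'I_n.+1 -> R)
    (guess w sigma x : R) : R :=
  let D := data_interval guess w in
  (F * (\sum_j a j * gauss sigma (x - phi j))
     + (1 - F) * (1 / (2 * pi)) * gauss_mass sigma)
  / (F * (\sum_j a j * \int[mu]_(y in D) gauss sigma (y - phi j))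
     + (1 - F) * (w / (2 * pi)) * gauss_mass sigma).

Definition model (F a0 guess w sigma theta x : R) : R :=
  let D := data_interval guess w in
  (F * a0 * gauss_kernel sigma (x - theta) + (1 - F) * (1 / (2 * pi)))
  / (F * a0 * (\int[mu]_(y in D) gauss_kernel sigma (y - theta))
     + (1 - F) * (w / (2 * pi))).

Definition log_likelihood (F a0 guess w sigma : R) (M : nat) (x : nat -> R)
    (theta : R) : R :=
  M%:R^-1 * \sum_(i < M) ln (model F a0 guess w sigma theta (x i)).

Definition expected_log_likelihood (F : R) (n : nat) (phi a : 'I_n.+1 -> R)
    (guess w sigma theta : R) : R :=
  \int[mu]_(x in data_interval guess w)
    (sample_density F phi a guess w sigma x
     * ln (model F (a ord0) guess w sigma theta x)).

(* Independence of X_0, ..., X_(M-1) for every M; since some of the B i may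
   be taken equal to setT, this is the product rule for every finite
   subfamily. *)
Definition iid_with_density (dT : measure_display) (T : measurableType dT)
    (Pr : probability T R) (X : nat -> {RV Pr >-> R}) (D : set R)
    (p : R -> R) : Prop :=
  (forall i (B : set R), measurable B ->
     distribution Pr (X i) B = (\int[mu]_(x in B `&` D) (p x)%:E)%E) /\
  (forall (M : nat) (B : nat -> set R), (forall i, measurable (B i)) ->
     Pr (\bigcap_(i < M) (X i @^-1` B i)) =
     (\prod_(i < M) Pr (X i @^-1` B i))%E).

(* tphi M is a measurable choice of a maximizer, over theta in D, of the
   log-likelihood of the first M samples.  It is only constrained where these
   samples lie in D, which is almost everywhere when they have a density
   on D. *)
Definition is_estimator (F a0 guess w sigma : R) (dT : measure_display)
    (T : measurableType dT) (Pr : probability T R)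
    (X tphi : nat -> {RV Pr >-> R}) : Prop :=
  let D := data_interval guess w in
  forall (M : nat) (t : T), (forall i, (i < M)%N -> D (X i t)) ->
    argmax D (log_likelihood F a0 guess w sigma M (fun i => X i t))
      (tphi M t).

End Estimator.

(* Main.v *)
Require Import Defs.
From HB Require Import structures.
From mathcomp Require Import all_boot all_order all_algebra.
From mathcomp Require Import all_classical all_reals all_analysis.
From mathcomp Require Import measurable_realfun ring lra.

Set Implicit Arguments.
Unset Strict Implicit.
Unset Printing Implicit Defensive.

Import Order.TTheory GRing.Theory Num.Theory.
Import numFieldNormedType.Exports.

Local Open Scope classical_set_scope.
Local Open Scope ring_scope.

(* The data density and the model are a Gaussian spike plus a flat floor b; the
   density has in addition the far tails r of the other eigenphases, of total
   mass rho = O(sigma^2 g(d) / d).  For g(d) small the floor is small compared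
   with the peak of the spike and rho with the floor.  The expected
   log-likelihood then has a single maximizer: away from phi_0 it is smaller by
   a Hellinger distance, and near phi_0 its curvature is at least
   0.32 / sigma^2, because the sharp edges of the interval remove at most a
   bounded part of the Fisher information.  The slope at phi_0 is at most
   rho w / sigma^2, as only r contributes, which gives the bias.  The variance
   is the sandwich value J / H^2 of an M-estimator.  The slack in the constants
   22 and 11 absorbs all remainders, so C = 0 works.

   For the M-estimator, write tphi - phi_* = S / H + Rem / H with S the mean of
   the scores.  Outside an event of probability O(1 / M^2), Taylor expansion of
   the score bounds Rem by a small multiple of S, so M E[Rem^2] -> 0; with
   E[S^2] = J / M this gives both limits, without a central limit theorem. *)

(** * Independent samples *)

(** The threshold on [g(d)] may depend on [F] and [a0] only, while the width, the buffer, the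
    interval and the spectrum vary. The promise gives [d <= pi] and the width condition
    [sigma <= pi / 3], so [g(d)] can be small only because [sigma] is small, both absolutely and
    against [d]. This makes the floor-to-peak ratio, of order [sigma], small as well. The interval,
    however, is only known to be longer than 6.5 [sigma], so its edges are never remote. The nearer
    edge is at least 1.09 [sigma] away and costs at most 1/2 of the unit information; the farther
    one, beyond 3.2 [sigma], costs at most 0.035. The squared mean score costs 0.086 and all
    perturbations together 0.041, which leaves more than 0.32. Then [J / H^2] is at most
    [1.01 / 0.32^2 < 10] times [sigma^2] times the normalization. The Hellinger and curvature
    regimes meet at distance [sigma / 10^6] from [phi_0]: close enough for the curvature to change
    by little, and since this is a fixed multiple of [sigma], the Hellinger gap there is an absolute
    constant. *)

Section Transfer.
Import HBNNSimple.
Local Open Scope ereal_scope.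
Context d (T : measurableType d) (R : realType).
Variables (m : {measure set T -> \bar R}) (nu : {measure set R -> \bar R}).
Variables (X : T -> R) (h : T -> R).
Hypothesis mX : measurable_fun setT X.
Hypothesis mh : measurable_fun setT h.
Hypothesis h0 : forall x, (0 <= h x)%R.
Hypothesis hnu : forall B, measurable B ->
  \int[m]_(x in X @^-1` B) (h x)%:E = nu B.

(** Change of variables for the image under [X] of the measure with density [h], known only through
    its values on sets: linearity gives simple functions, monotone convergence the rest. It serves
    with [X] the identity and [h] a probability density, and with [h] the product of the other
    factors in the independence argument. *)
Lemma ge0_integral_transfer (f : R -> R) : measurable_fun setT f ->
  (forall x, 0 <= f x)%R ->
  \int[m]_x (f (X x) * h x)%:E = \int[nu]_x (f x)%:E.
Proof.
move=> mf f0.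
have mef : measurable_fun [set: R] (fun x : R => (f x)%:E : \bar R) by exact/measurable_EFinP.
pose g := nnsfun_approx measurableT mef.
have gX n : measurable_fun setT (fun x => g n (X x)).
  by apply: measurableT_comp => //; exact: measurable_funP.
have -> : \int[nu]_x (f x)%:E = lim (\int[nu]_x (g n x)%:E @[n --> \oo]).
  have fE x : (f x)%:E = lim ((g n x)%:E @[n --> \oo]).
    apply/esym/cvg_lim => //; apply: cvg_nnsfun_approx => // y _.
    by rewrite /= lee_fin.
  under eq_integral do rewrite fE.
  apply: monotone_convergence => //.
  - by move=> n; apply/measurable_EFinP; exact/measurable_funP.
  - by move=> n x _ /=; rewrite lee_fin.
  - by move=> x _ a b ab; rewrite lee_fin; exact/lefP/nd_nnsfun_approx.
have -> : \int[m]_x (f (X x) * h x)%:E =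
    lim (\int[m]_x (g n (X x) * h x)%:E @[n --> \oo]).
  have fE x : (f (X x) * h x)%:E = lim ((g n (X x) * h x)%:E @[n --> \oo]).
    apply/esym/cvg_lim => //.
    rewrite EFinM; under eq_fun do rewrite EFinM.
    apply: cvgeZr => //; apply: cvg_nnsfun_approx => // y _.
    by rewrite /= lee_fin.
  under eq_integral do rewrite fE.
  apply: monotone_convergence => //.
  - by move=> n; apply/measurable_EFinP; exact: measurable_funM.
  - by move=> n x _ /=; rewrite lee_fin mulr_ge0.
  - move=> x _ a b ab; rewrite lee_fin ler_wpM2r//.
    exact/lefP/nd_nnsfun_approx.
congr (lim (_ @ \oo)); apply/funext => n.
have mgy y : measurable (g n @^-1` [set y]) by [].
have mXy y : measurable_fun setT (fun x => (y * (\1_(g n @^-1` [set y]) (X x) * h x))%R).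
  apply: measurable_funM => //; apply: measurable_funM => //.
  by apply: measurableT_comp => //; exact: measurable_indic.
transitivity (\sum_(y \in range (g n)) y%:E * nu (g n @^-1` [set y])); last first.
  by rewrite integralT_nnsfun sintegralE.
transitivity (\int[m]_x
   (\sum_(y \in range (g n)) (y * (\1_(g n @^-1` [set y]) (X x) * h x))%:E)).
  apply: eq_integral => x _.
  rewrite fsumEFin// (fimfunE (g n) (X x)).
  rewrite !fsbig_finite//= mulr_suml; congr EFin.
  by apply: eq_bigr => y _; rewrite mulrA.
rewrite ge0_integral_fsum//; last 2 first.
- by move=> y; exact/measurable_EFinP.
- move=> y x _; rewrite lee_fin mulrA mulr_ge0//.
  exact: (nnfun_muleindic_ge0 (g n) y (X x)).
apply: eq_fsbigr => y; rewrite inE => -[z _ yz].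
have y0 : (0 <= y)%R by rewrite -yz.
under eq_integral do rewrite EFinM.
rewrite ge0_integralZl//.
- rewrite -(hnu (mgy y)) [in RHS]integral_mkcond; congr (_ * _).
  apply: eq_integral => x _.
  rewrite patchE; case: ifPn => xy.
    by rewrite indicE (_ : X x \in _ = true) ?mul1r//; rewrite !inE in xy *.
  rewrite indicE (_ : X x \in _ = false) ?mul0r//.
  by apply/negbTE; move: xy; apply: contraNN; rewrite !inE.
- apply/measurable_EFinP/measurable_funM => //.
  by apply: measurableT_comp => //; exact: measurable_indic.
- by move=> x _; rewrite lee_fin mulr_ge0// indicE.
Qed.
End Transfer.

(** * Bounded measurable functions and their expectations *)

Section BoundedMeasurable.
Context d (T : measurableType d) (R : realType).
Implicit Types f g : T -> R.

(** A class closed under the algebraic operations and integrable against every finite measure, so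
    that integrability needs no argument of its own. *)
Definition bmfun f := measurable_fun setT f /\ exists C : R, forall t, `|f t| <= C.

Lemma bmfun_cst c : bmfun (fun=> c).
Proof. by split => //; exists `|c|. Qed.

Lemma bmfunD f g : bmfun f -> bmfun g -> bmfun (fun t => f t + g t).
Proof.
move=> [mf [C fC]] [mg [K gK]]; split; first exact: measurable_funD.
by exists (C + K) => t; rewrite (le_trans (ler_normD _ _))// lerD.
Qed.

Lemma bmfunM f g : bmfun f -> bmfun g -> bmfun (fun t => f t * g t).
Proof.
move=> [mf [C fC]] [mg [K gK]]; split; first exact: measurable_funM.
by exists (C * K) => t; rewrite normrM ler_pM.
Qed.

Lemma bmfunZ c f : bmfun f -> bmfun (fun t => c * f t).
Proof. by move=> bf; apply: bmfunM => //; exact: bmfun_cst. Qed.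

Lemma bmfunN f : bmfun f -> bmfun (fun t => - f t).
Proof.
move=> [mf [C fC]]; split; first exact: measurableT_comp.
by exists C => t; rewrite normrN.
Qed.

Lemma bmfunB f g : bmfun f -> bmfun g -> bmfun (fun t => f t - g t).
Proof. by move=> bf bg; apply: bmfunD => //; exact: bmfunN. Qed.

Lemma bmfunX f n : bmfun f -> bmfun (fun t => f t ^+ n).
Proof.
move=> [mf [C fC]]; split; first exact: measurable_funX.
exists (C ^+ n) => t; rewrite normrX lerXn2r ?nnegrE//.
exact: le_trans (fC t).
Qed.

Lemma bmfun_norm f : bmfun f -> bmfun (fun t => `|f t|).
Proof.
move=> [mf [C fC]]; split; first exact: measurableT_comp.
by exists C => t; rewrite normr_id.
Qed.

Lemma bmfun_sum (I : Type) (s : seq I) (P : pred I) (F : I -> T -> R) :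
  (forall i, bmfun (F i)) -> bmfun (fun t => \sum_(i <- s | P i) F i t).
Proof.
move=> bF; elim: s => [|i s ih].
  by under eq_fun do rewrite big_nil; exact: bmfun_cst.
by under eq_fun do rewrite big_cons; case: (P i) => //; exact: bmfunD.
Qed.

Lemma bmfun_prod (I : Type) (s : seq I) (P : pred I) (F : I -> T -> R) :
  (forall i, bmfun (F i)) -> bmfun (fun t => \prod_(i <- s | P i) F i t).
Proof.
move=> bF; elim: s => [|i s ih].
  by under eq_fun do rewrite big_nil; exact: bmfun_cst.
by under eq_fun do rewrite big_cons; case: (P i) => //; exact: bmfunM.
Qed.

Lemma bmfun_indic (A : set T) : measurable A -> bmfun (\1_A : T -> R).
Proof.
move=> mA; split; first exact: measurable_indic.
by exists 1 => t; rewrite indicE; case: (_ \in _); rewrite ?normr1 ?normr0.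
Qed.

Lemma bmfun_integrable (m : {measure set T -> \bar R}) (A : set T) f :
  measurable A -> (m A < +oo)%E -> bmfun f -> m.-integrable A (EFin \o f).
Proof.
move=> mA Aoo [mf [C fC]]; apply: measurable_bounded_integrable => //.
  exact: measurable_funTS.
exists C; split; first exact: num_real.
by move=> x Cx t _; exact: le_trans (fC t) (ltW Cx).
Qed.

End BoundedMeasurable.

Lemma bmfun_comp d d' (T : measurableType d) (T' : measurableType d')
    (R : realType) (X : T -> T') (f : T' -> R) :
  measurable_fun setT X -> bmfun f -> bmfun (fun t => f (X t)).
Proof.
move=> mX [mf [C fC]]; split; first exact: measurableT_comp.
by exists C => t; exact: fC.
Qed.

Lemma bmfun_continuous (R : realType) (f : R -> R) (C : R) :
  continuous f -> (forall x, `|f x| <= C) -> bmfun f.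
Proof.
by move=> cf fC; split; [exact: continuous_measurable_fun|exists C].
Qed.

Section Expectation.
Context d (T : measurableType d) (R : realType).
Variable (Pr : probability T R).
Local Notation EE f := (Rintegral Pr setT f).
Implicit Types f g : T -> R.

Lemma bmfun_prob_integrable f : bmfun f -> Pr.-integrable setT (EFin \o f).
Proof.
move=> bf; apply: (bmfun_integrable measurableT _ bf).
by rewrite [X in (X < _)%E]probability_setT ltry.
Qed.

Lemma expect_EFin f : bmfun f -> (EE f)%:E = (\int[Pr]_t (f t)%:E)%E.
Proof.
move=> bf; rewrite /Rintegral fineK//.
exact: integrable_fin_num (bmfun_prob_integrable bf).
Qed.

Lemma expect_cst c : EE (fun=> c) = c.
Proof. by rewrite Rintegral_cst// [X in fine X]probability_setT mulr1. Qed.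

Lemma expectD f g : bmfun f -> bmfun g -> EE (fun t => f t + g t) = EE f + EE g.
Proof. by move=> bf bg; rewrite RintegralD//; exact: bmfun_prob_integrable. Qed.

Lemma expectB f g : bmfun f -> bmfun g -> EE (fun t => f t - g t) = EE f - EE g.
Proof. by move=> bf bg; rewrite RintegralB//; exact: bmfun_prob_integrable. Qed.

Lemma expectZ c f : bmfun f -> EE (fun t => c * f t) = c * EE f.
Proof. by move=> bf; rewrite RintegralZl//; exact: bmfun_prob_integrable. Qed.

Lemma expect_sum (I : Type) (s : seq I) (P : pred I) (F : I -> T -> R) :
  (forall i, bmfun (F i)) ->
  EE (fun t => \sum_(i <- s | P i) F i t) = \sum_(i <- s | P i) EE (F i).
Proof.
move=> bF; elim: s => [|i s ih].
  by under eq_Rintegral do rewrite big_nil; rewrite expect_cst big_nil.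
under eq_Rintegral do rewrite big_cons; rewrite big_cons.
case: (P i) => //; rewrite expectD ?ih//; exact: bmfun_sum.
Qed.

Lemma le_expect f g : bmfun f -> bmfun g -> (forall t, f t <= g t) ->
  EE f <= EE g.
Proof. by move=> bf bg fg; apply: le_Rintegral => //; exact: bmfun_prob_integrable. Qed.

Lemma expect_ge0 f : (forall t, 0 <= f t) -> 0 <= EE f.
Proof. by move=> f0; exact: Rintegral_ge0. Qed.

Lemma expect_indic (A : set T) : measurable A -> EE \1_A = fine (Pr A).
Proof. by move=> mA; rewrite /Rintegral integral_indic// setIT. Qed.

End Expectation.

Section Independence.
Context d (T : measurableType d) (R : realType).
Variables (Pr : probability T R) (X : nat -> {RV Pr >-> R}).
Hypothesis indep : forall (M : nat) (B : nat -> set R),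
  (forall i, measurable (B i)) ->
  Pr (\bigcap_(i < M) (X i @^-1` B i)) =
  (\prod_(i < M) Pr (X i @^-1` B i))%E.
Local Notation EE f := (Rintegral Pr setT f).

Let mX i : measurable_fun setT (X i).
Proof. exact: measurable_funP. Qed.

Let EE_prod_indic (M : nat) (B : nat -> set R) :
  (forall i, measurable (B i)) ->
  EE (fun t => \prod_(i < M) \1_(B i) (X i t)) =
  \prod_(i < M) EE (fun t => \1_(B i) (X i t)).
Proof.
move=> mB.
have mXB i : measurable (X i @^-1` B i).
  by rewrite -[X in measurable X]setTI; exact: mX.
have EX i : EE (fun t => \1_(B i) (X i t)) = fine (Pr (X i @^-1` B i)).
  by rewrite -expect_indic.
under eq_bigr do rewrite EX.
transitivity (fine (Pr (\bigcap_(i < M) (X i @^-1` B i)))).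
  rewrite -expect_indic//; last by exact: bigcap_measurableType.
  apply: eq_Rintegral => t _.
  case: (pselect (forall i, (i < M)%N -> B i (X i t))) => h.
    rewrite (_ : t \in _ = true); last exact/mem_set.
    by rewrite big1// => i _; rewrite ?indicE (mem_set (h _ _)).
  move/existsNP : h => [i /not_implyP[iM nB]].
  rewrite (_ : t \in _ = false); last by apply/memNset => /(_ i iM).
  rewrite (bigD1 (Ordinal iM))//= ?indicE (memNset nB) mul0r//.
rewrite indep//.
have -> : (\prod_(i < M) Pr (X i @^-1` B i))%E =
   (\prod_(i < M) fine (Pr (X i @^-1` B i)))%:E.
  elim: M => [|M ih]; first by rewrite !big_ord0.
  rewrite !big_ord_recr/= ih EFinM; congr (_ * _)%E.
  by rewrite fineK// fin_num_measure.
by [].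
Qed.

(** With all factors but the [j]-th frozen, both sides are measures in the set [B] that stands in
    for [f j]; equality on sets extends to [f j] by the transfer lemma. This trades one indicator
    for a general function. *)
Let EE_prod_step (M j : nat) (f : nat -> R -> R) :
  (forall i, bmfun (f i)) -> (forall i x, 0 <= f i x) ->
  (forall B, measurable B -> let g i := if i == j then \1_B else f i in
    EE (fun t => \prod_(i < M) g i (X i t)) =
    \prod_(i < M) EE (fun t => g i (X i t))) ->
  EE (fun t => \prod_(i < M) f i (X i t)) =
  \prod_(i < M) EE (fun t => f i (X i t)).
Proof.
move=> bf f0 H.
have [Mj|jM] := leqP M j.
  (* For [j] outside the product, replacing the factor changes nothing and any [B] will do. *)
  have gf i : (i < M)%N -> (if i == j then \1_setT else f i) = f i.
    by move=> iM; rewrite ltn_eqF// (leq_trans iM).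
  have := H _ measurableT => /=.
  under eq_bigr do rewrite gf//.
  by under eq_Rintegral do under eq_bigr do rewrite gf//.
pose j' := Ordinal jM.
pose Y t := \prod_(i < M | i != j') f i (X i t).
pose c := \prod_(i < M | i != j') EE (fun t => f i (X i t)).
have c0 : 0 <= c by apply: prodr_ge0 => i _; exact: expect_ge0.
have Y0 t : 0 <= Y t by apply: prodr_ge0.
have bfX i k : bmfun (fun t => f i (X k t)) by exact: (bmfun_comp (mX k)).
have bY : bmfun Y by apply: bmfun_prod => i; exact: bfX.
have HB B : measurable B ->
    EE (fun t => \1_B (X j t) * Y t) = EE (fun t => \1_B (X j t)) * c.
  move=> /H /=; under eq_Rintegral do rewrite (bigD1 j')//= eqxx.
  rewrite (bigD1 j')//= eqxx => E.
  transitivity (EE (fun t => \1_B (X j t) *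
      \prod_(i < M | i != j') (if i == j :> nat then \1_B else f i) (X i t))).
    apply: eq_Rintegral => t _; congr (_ * _); apply: eq_bigr => i ij.
    by rewrite ifN.
  rewrite E; congr (_ * _); apply: eq_bigr => i ij.
  by rewrite ifN.
under eq_Rintegral do rewrite (bigD1 j')//=.
rewrite (bigD1 j')//= -/c.
apply: EFin_inj; rewrite EFinM !expect_EFin//; last by exact: bmfunM.
(* [Y] plays the density, and the image measure is [c] times the law of [X j]. *)
have /= -> := @ge0_integral_transfer _ T R Pr
  (mscale (NngNum c0) (distribution Pr (X j))) (X j) Y (mX j) bY.1 Y0 _
  (f j) (bf j).1 (f0 j).
  rewrite ge0_integral_mscale//; last 2 first.
  - by apply/measurable_EFinP; exact: (bf j).1.
  - by move=> x _; rewrite lee_fin.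
  rewrite /= muleC ge0_integral_distribution//; last first.
  - by move=> x; rewrite lee_fin.
  - by apply/measurable_EFinP; exact: (bf j).1.
move=> B mB; rewrite /mscale/= /distribution/= /pushforward.
have mXB : measurable (X j @^-1` B).
  by rewrite -[X in measurable X]setTI; exact: mX.
have bB : bmfun (fun t => \1_B (X j t) : R).
  by apply: (bmfun_comp (mX j)); exact: bmfun_indic.
have := congr1 (@EFin R) (HB _ mB).
rewrite EFinM !expect_EFin//; last exact: bmfunM.
rewrite muleC => E; rewrite integral_mkcond.
transitivity (\int[Pr]_t (\1_B (X j t) * Y t)%:E)%E.
  apply: eq_integral => t _; rewrite patchE ?indicE.
  case: ifPn => h; last first.
    by have -> : (X j t \in B) = false := negbTE h; rewrite mul0r.
  by have -> : (X j t \in B) = true := h; rewrite mul1r.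
rewrite E; congr (_ * _)%E.
transitivity (\int[Pr]_t (\1_(X j @^-1` B) t)%:E)%E.
  by [].
by rewrite integral_indic// setIT.
Qed.

(** Induction on the number [j] of leading factors allowed to be general, the others being
    indicators; [j = 0] is the independence of events. *)
Lemma expect_prod (M : nat) (f : nat -> R -> R) :
  (forall i, bmfun (f i)) -> (forall i x, 0 <= f i x) ->
  EE (fun t => \prod_(i < M) f i (X i t)) =
  \prod_(i < M) EE (fun t => f i (X i t)).
Proof.
move=> bf f0.
suff H j : forall f : nat -> R -> R, (forall i, bmfun (f i)) ->
    (forall i x, 0 <= f i x) ->
    (forall i, (j <= i)%N -> exists2 B, measurable B & f i = \1_B) ->
  EE (fun t => \prod_(i < M) f i (X i t)) =
  \prod_(i < M) EE (fun t => f i (X i t)).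
  (* Factors beyond [M] do not enter the product, so they may be taken to be an indicator, and the
     case [j = M] suffices. *)
  pose g i := if (i < M)%N then f i else \1_setT.
  have gf i : (i < M)%N -> g i = f i by rewrite /g => ->.
  transitivity (EE (fun t => \prod_(i < M) g i (X i t))).
    by apply: eq_Rintegral => t _; apply: eq_bigr => i _; rewrite gf.
  rewrite (H M).
  - by apply: eq_bigr => i _; rewrite gf.
  - by move=> i; rewrite /g; case: ifP => // _; exact: bmfun_indic.
  - by move=> i x; rewrite /g; case: ifP => // _; rewrite ?indicE.
  - by move=> i Mi; exists setT => //; rewrite /g ltnNge Mi.
elim: j => [|j ih] {bf f0}f bf f0 fj.
  have /choice[B HB] : forall i, exists B, measurable B /\ f i = \1_B.
    by move=> i; have [//|B mB ->] := fj i; exists B.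
  under eq_bigr do rewrite (HB _).2.
  rewrite -EE_prod_indic//; last by move=> i; exact: (HB i).1.
  by apply: eq_Rintegral => t _; apply: eq_bigr => i _; rewrite (HB i).2.
apply: (@EE_prod_step M j) => // B mB g.
apply: ih => [i|i x|i ji]; rewrite /g.
- by case: ifP => // _; exact: bmfun_indic.
- by case: ifP => // _; rewrite ?indicE.
- case: ifPn => [_|ij]; first by exists B.
  by apply: fj; rewrite ltn_neqAle eq_sym ij.
Qed.

End Independence.

(** * M-estimation *)

(** [1 - y <= expR (- y)] gives [expR y <= 1 / (1 - y)], and [(1 - y) (1 + y + 2 y^2) = 1 + y^2 (1 -
    2 y) >= 1]. *)
Lemma expR_le_quadratic (R : realType) (y : R) :
  `|y| <= 1 / 2 -> expR y <= 1 + y + 2 * y ^+ 2.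
Proof.
move=> /ler_normlP [y1 y2].
have e1 : 1 - y <= expR (- y) by exact: expR_ge1Dx.
have y0 : 0 < 1 - y by lra.
have e2 : (1 - y) * expR y <= 1.
  have E : expR (- y) * expR y = 1 by rewrite -expRD addNr expR0.
  by rewrite -[leRHS]E ler_wpM2r// expR_ge0.
rewrite -(ler_pM2l y0); apply: (le_trans e2).
nra.
Qed.

Lemma expR_sqr_le (R : realType) (x : R) : 0 <= x -> x ^+ 2 / 4 <= expR x.
Proof.
move=> x0; have -> : x = x / 2 + x / 2 by lra.
rewrite expRD; have := expR_ge1Dx (x / 2); nra.
Qed.

(** * Moments and concentration of sample means *)

Section SampleMean.
Context d (T : measurableType d) (R : realType).
Variables (Pr : probability T R) (X : nat -> {RV Pr >-> R}).
Hypothesis indep : forall (M : nat) (B : nat -> set R),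
  (forall i, measurable (B i)) ->
  Pr (\bigcap_(i < M) (X i @^-1` B i)) =
  (\prod_(i < M) Pr (X i @^-1` B i))%E.
Local Notation EE f := (Rintegral Pr setT f).

Lemma bmfunX_RV (f : R -> R) i : bmfun f -> bmfun (fun t => f (X i t)).
Proof. by apply: bmfun_comp; exact: measurable_funP. Qed.

Let EE_mul_ge0 (f g : R -> R) i j : i != j -> bmfun f -> bmfun g ->
  (forall x, 0 <= f x) -> (forall x, 0 <= g x) ->
  EE (fun t => f (X i t) * g (X j t)) =
  EE (fun t => f (X i t)) * EE (fun t => g (X j t)).
Proof.
move=> ij bf bg f0 g0.
pose h k := if k == i then f else if k == j then g else fun=> 1.
pose M := (maxn i j).+1.
have iM : (i < M)%N by rewrite ltnS leq_maxl.
have jM : (j < M)%N by rewrite ltnS leq_maxr.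
have prodE (z : nat -> (R -> R) -> R) : (forall k, z k (fun=> 1) = 1) ->
    \prod_(k < M) z k (h k) = z i f * z j g.
  move=> z1; rewrite (bigD1 (Ordinal iM))//= (bigD1 (Ordinal jM))/=; last first.
    by rewrite -val_eqE /= eq_sym.
  rewrite big1 ?mulr1 /h ?eqxx; last first.
    move=> k /andP[]; rewrite -!val_eqE/= => ki kj.
    by rewrite (negbTE ki) (negbTE kj) z1.
  by rewrite eq_sym (negbTE ij).
rewrite -(prodE (fun k f => EE (fun t => f (X k t)))); last first.
  by move=> k; rewrite expect_cst.
rewrite -expect_prod//.
- by apply: eq_Rintegral => t _; rewrite (prodE (fun k f => f (X k t))).
- by move=> k; rewrite /h; do 2 case: ifP => // _; exact: bmfun_cst.
- by move=> k x; rewrite /h; do 2 case: ifP => // _.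
Qed.

(** Adding their bounds makes both functions nonnegative; in the product rule for the shifted
    functions all other terms are fixed by linearity. *)
Lemma expect_mul_indep (f g : R -> R) i j : i != j -> bmfun f -> bmfun g ->
  EE (fun t => f (X i t) * g (X j t)) =
  EE (fun t => f (X i t)) * EE (fun t => g (X j t)).
Proof.
move=> ij bf bg.
have [_ [C fC]] := bf; have [_ [K gK]] := bg.
pose f1 x := f x + C; pose g1 x := g x + K.
have bf1 : bmfun f1 by apply: bmfunD => //; exact: bmfun_cst.
have bg1 : bmfun g1 by apply: bmfunD => //; exact: bmfun_cst.
have f10 x : 0 <= f1 x by have /ler_normlP[] := fC x; rewrite /f1; lra.
have g10 x : 0 <= g1 x by have /ler_normlP[] := gK x; rewrite /g1; lra.
have := EE_mul_ge0 ij bf1 bg1 f10 g10.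
have fX := bmfunX_RV i bf; have gX := bmfunX_RV j bg.
rewrite /f1 /g1 !expectD ?expect_cst//; try exact: bmfun_cst.
under eq_Rintegral => t _.
  rewrite (_ : _ * _ = f (X i t) * g (X j t) +
    (K * f (X i t) + (C * g (X j t) + C * K))); last by ring.
  over.
rewrite expectD ?expectD ?expectZ ?expect_cst//; do ?[by apply: bmfunM|by apply: bmfunZ|
  exact: bmfun_cst|apply: bmfunD].
lra.
Qed.

Definition smean (k : R -> R) M t := M%:R^-1 * \sum_(i < M) k (X i t).

Lemma bmfun_smean k M : bmfun k -> bmfun (smean k M).
Proof.
by move=> bk; apply: bmfunZ; apply: bmfun_sum => i; exact: bmfunX_RV.
Qed.

Lemma expect_smean k m M : bmfun k -> (forall i, EE (fun t => k (X i t)) = m) ->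
  EE (smean k M.+1) = m.
Proof.
move=> bk km; rewrite expectZ; last first.
  by apply: bmfun_sum => i; exact: bmfunX_RV.
rewrite expect_sum; last by move=> i; exact: bmfunX_RV.
under eq_bigr do rewrite km.
by rewrite sumr_const card_ord -[X in _ * X]mulr_natr mulrC mulfK// pnatr_eq0.
Qed.

Lemma expect_smean_sqr k J M : bmfun k -> (forall i, EE (fun t => k (X i t)) = 0) ->
  (forall i, EE (fun t => k (X i t) ^+ 2) = J) ->
  EE (fun t => smean k M t ^+ 2) = J / M%:R.
Proof.
move=> bk k0 kJ.
have bS : bmfun (fun t => \sum_(i < M) k (X i t)).
  by apply: bmfun_sum => i; exact: bmfunX_RV.
under eq_Rintegral do rewrite exprMn.
rewrite expectZ; last exact: bmfunX.
have [->|M0] := eqVneq M 0%N.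
  by rewrite invr0 expr0n /= mul0r mulr0.
have -> : EE (fun t => (\sum_(i < M) k (X i t)) ^+ 2) = M%:R * J; last first.
  by field; rewrite pnatr_eq0.
under eq_Rintegral => t _.
  rewrite expr2 mulr_suml.
  under eq_bigr do rewrite mulr_sumr.
  over.
rewrite expect_sum; last first.
  by move=> i; apply: bmfun_sum => j; apply: bmfunM; exact: bmfunX_RV.
rewrite mulr_natl -[X in _ *+ X]card_ord -sumr_const; apply: eq_bigr => i _.
rewrite expect_sum; last by move=> j; apply: bmfunM; exact: bmfunX_RV.
rewrite (bigD1 i)//= big1 ?addr0.
  by rewrite -(kJ i); apply: eq_Rintegral => t _; rewrite expr2.
move=> j ji; rewrite expect_mul_indep//; first by rewrite k0 mul0r.
by rewrite eq_sym.
Qed.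

(** Exponential Markov inequality, weakened to the rate [1 / M^2]. Chebyshev's [1 / M] would not do:
    the probability is later multiplied by [M] and must still tend to 0. *)
Let chernoff k (K de : R) : bmfun k -> 0 < K -> (forall x, `|k x| <= K) ->
  (forall i, EE (fun t => k (X i t)) = 0) -> 0 < de ->
  exists C, forall M,
    M%:R ^+ 2 * EE (\1_(smean k M @^-1` `[de, +oo[)) <= C.
Proof.
move=> bk K0 kK k0 de0.
(* The first bound on [la] keeps [la * k] in the range of the quadratic estimate of [expR]; the
   second makes the second-order term at most half of the gain [la * de]. *)
pose la := Num.min (1 / (2 * K)) (de / (4 * K ^+ 2)).
have la0 : 0 < la.
  by rewrite lt_min !divr_gt0// mulr_gt0// exprn_gt0.
have la1 : la * K <= 1 / 2.
  have : la <= 1 / (2 * K) by rewrite ge_min lexx.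
  by rewrite ler_pdivlMr; [lra|rewrite mulr_gt0].
have la2 : 2 * (la ^+ 2 * K ^+ 2) <= la * de / 2.
  have : la <= de / (4 * K ^+ 2) by rewrite ge_min lexx orbT.
  by rewrite ler_pdivlMr; [nra|rewrite mulr_gt0// exprn_gt0].
pose c := la * de / 2.
have c0 : 0 < c by rewrite divr_gt0// mulr_gt0.
(* From [x^2 / 4 <= expR x] at [x = M * c]. *)
exists (4 / c ^+ 2) => M.
have [->|M0] := eqVneq M 0%N.
  by rewrite expr0n mul0r divr_ge0// sqr_ge0.
have M1 : 0 < M%:R :> R by rewrite ltr0n lt0n.
have bexp : bmfun (fun x => expR (la * k x)).
  split; first by apply: measurableT_comp => //; exact: (bmfunZ la bk).1.
  exists (expR (1 / 2)) => x; rewrite ger0_norm ?expR_ge0// ler_expR.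
  apply: le_trans la1; rewrite ler_pM2l//.
  by have /ler_normlP[] := kK x.
have bA : measurable (smean k M @^-1` `[de, +oo[).
  rewrite -[X in measurable X]setTI.
  exact: (bmfun_smean M bk).1.
have step i : EE (fun t => expR (la * k (X i t))) <= expR (la * de / 2).
  apply: (@le_trans _ _ (EE (fun t => 1 + (la * k (X i t) + 2 * (la ^+ 2 * K ^+ 2))))).
    apply: le_expect; first exact: (bmfunX_RV i bexp).
      apply: bmfunD; first exact: bmfun_cst.
      apply: bmfunD; last exact: bmfun_cst.
      exact/bmfunZ/bmfunX_RV.
    move=> t; have kt : `|la * k (X i t)| <= la * K.
      by rewrite normrM (gtr0_norm la0) ler_pM2l.
    apply: (le_trans (expR_le_quadratic (le_trans kt la1))).
    rewrite -addrA lerD2l lerD2l ler_pM2l// -exprMn -real_normK ?num_real//.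
    by rewrite lerXn2r// nnegrE// mulr_ge0// ltW.
  rewrite expectD ?expectD ?expectZ ?expect_cst ?k0//; do ?[exact: bmfun_cst|
    exact/bmfunZ/bmfunX_RV|exact: bmfunX_RV|apply: bmfunD].
  rewrite mulr0 add0r; apply: le_trans (expR_ge1Dx _) _.
  by rewrite ler_expR.
have bound : EE (\1_(smean k M @^-1` `[de, +oo[)) <= expR (- (M%:R * c)).
  pose E t := expR (- (M%:R * (la * de))) * \prod_(i < M) expR (la * k (X i t)).
  have bP : bmfun (fun t => \prod_(i < M) expR (la * k (X i t))).
    apply: bmfun_prod => i; exact: (bmfunX_RV i bexp).
  apply: (@le_trans _ _ (EE E)).
    apply: le_expect; [exact: bmfun_indic|exact: bmfunZ|] => t.
    rewrite /E -expR_sum -expRD -mulr_sumr.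
    rewrite indicE; case: (boolP (t \in _)) => h; last by rewrite expR_ge0.
    rewrite -[leLHS]expR0 ler_expR.
    have : de <= smean k M t.
      by move: h; rewrite inE /= in_itv/= andbT.
    rewrite /smean ler_pdivlMl// => h1; have := ler_wpM2l (ltW la0) h1.
    by rewrite mulrCA addrC subr_ge0.
  rewrite /E expectZ// (@expect_prod _ _ _ _ _ indep M (fun=> fun x => expR (la * k x)))//.
  apply: (@le_trans _ _ (expR (- (M%:R * (la * de))) * expR (M%:R * (la * de / 2)))).
      rewrite ler_pM2l ?expR_gt0// expRM_natl -[X in _ ^+ X]card_ord -prodr_const.
      apply: ler_prod => i _; rewrite step andbT; apply: expect_ge0 => t.
      exact: expR_ge0.
    rewrite -expRD ler_expR /c; lra.
apply: (@le_trans _ _ (M%:R ^+ 2 * expR (- (M%:R * c)))).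
  by rewrite ler_wpM2l// sqr_ge0.
have Mc : 0 < M%:R * c by rewrite mulr_gt0.
have := expR_sqr_le (ltW Mc).
rewrite expRN ler_pdivrMr// => h.
rewrite ler_pdivrMr ?expR_gt0// mulrC mulrA ler_pdivlMr ?exprn_gt0//.
by rewrite -exprMn.
Qed.

Lemma smean_concentration k (m de : R) : bmfun k ->
  (forall i, EE (fun t => k (X i t)) = m) -> 0 < de ->
  exists C, forall M,
    M%:R ^+ 2 * EE (\1_[set t | de <= `|smean k M t - m|]) <= C.
Proof.
move=> bk km de0.
have [mk [K' kK']] := bk.
pose K := `|K'| + `|m| + 1.
have K0 : 0 < K by rewrite ltr_wpDl// addr_ge0.
pose k1 x := k x - m; pose k2 x := m - k x.
have bk1 : bmfun k1 by apply: bmfunB => //; exact: bmfun_cst.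
have bk2 : bmfun k2 by apply: bmfunB => //; exact: bmfun_cst.
have k1K x : `|k1 x| <= K.
  apply: (le_trans (ler_normB _ _)); have := kK' x; have := ler_norm K'.
  rewrite /K; lra.
have k2K x : `|k2 x| <= K by rewrite distrC; exact: k1K.
have k10 i : EE (fun t => k1 (X i t)) = 0.
  rewrite expectB ?expect_cst ?km ?subrr//; last exact: bmfun_cst.
  exact: bmfunX_RV.
have k20 i : EE (fun t => k2 (X i t)) = 0.
  rewrite expectB ?expect_cst ?km ?subrr//; first exact: bmfun_cst.
  exact: bmfunX_RV.
have [C1 HC1] := chernoff bk1 K0 k1K k10 de0.
have [C2 HC2] := chernoff bk2 K0 k2K k20 de0.
exists (C1 + C2) => M.
have [->|M0] := eqVneq M 0%N.
  by have := HC1 0%N; have := HC2 0%N; rewrite expr0n !mul0r => *; exact: addr_ge0.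
have M1 : M%:R != 0 :> R by rewrite pnatr_eq0.
have m1 t : smean k1 M t = smean k M t - m.
  rewrite /smean sumrB sumr_const card_ord -mulr_natr; field; exact: M1.
have m2 t : smean k2 M t = - (smean k M t - m).
  rewrite /smean sumrB sumr_const card_ord -mulr_natr; field; exact: M1.
have mS (k3 : R -> R) : bmfun k3 -> measurable (smean k3 M @^-1` `[de, +oo[).
  move=> b3; rewrite -[X in measurable X]setTI; exact: (bmfun_smean M b3).1.
apply: le_trans (lerD (HC1 M) (HC2 M)); rewrite -mulrDr ler_wpM2l ?sqr_ge0//.
have mA : measurable [set t | de <= `|smean k M t - m|].
  have -> : [set t | de <= `|smean k M t - m|] =
      smean k1 M @^-1` `[de, +oo[ `|` smean k2 M @^-1` `[de, +oo[.
    apply/seteqP; split => t /=; rewrite !in_itv/= !andbT m1 m2 ler_normr.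
      by move=> /orP.
    by move=> /orP.
  by apply: measurableU; exact: mS.
rewrite -expectD; do ?by apply: bmfun_indic; exact: mS.
apply: le_expect; first exact: bmfun_indic.
  by apply: bmfunD; apply: bmfun_indic; exact: mS.
move=> t; rewrite !indicE.
case: (boolP (t \in [set t | de <= _])) => [|_]; last by rewrite addr_ge0.
rewrite inE/= ler_normr -m2 -m1 => /orP[h|h].
  by rewrite (mem_set (_ : (smean k1 M @^-1` `[de, +oo[) t)) ?lerDl//= in_itv/= h.
by rewrite (mem_set (_ : (smean k2 M @^-1` `[de, +oo[) t)) ?lerDr//= in_itv/= h.
Qed.

End SampleMean.

Section MeanValue.
Context (R : realType).
Implicit Types f df : R -> R.

Lemma is_derive_continuous f df :
  (forall x : R, is_derive x 1 f (df x)) -> continuous f.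
Proof.
move=> Df x; apply: differentiable_continuous.
by apply/derivable1_diffP; have [] := Df x.
Qed.

Lemma mean_value f df (a b : R) : (forall x : R, is_derive x 1 f (df x)) ->
  exists xi : R, [/\ `|xi - a| <= `|b - a|, `|xi - b| <= `|b - a|
                   & f b - f a = df xi * (b - a)].
Proof.
move=> Df; have cf := is_derive_continuous Df.
wlog ab : a b / a <= b => [H|].
  have [|/ltW ba] := leP a b; first exact: H.
  have [xi [h1 h2 h3]] := H b a ba; exists xi.
  by rewrite (distrC b a); split => //; lra.
have [c] := MVT_segment ab (fun x _ => Df x) (continuous_subspaceT cf).
rewrite in_itv /= => /andP[ac cb] E; exists c; split => //.
  by rewrite !ger0_norm ?subr_ge0// lerD2r.
by rewrite distrC !ger0_norm ?subr_ge0// lerD2l lerN2.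
Qed.

Lemma lipschitz_of_derive f df B (a b : R) :
  (forall x : R, is_derive x 1 f (df x)) -> (forall x, `|df x| <= B) ->
  `|f a - f b| <= B * `|a - b|.
Proof.
move=> Df fB; have [xi [_ _ ->]] := mean_value b a Df.
by rewrite normrM ler_wpM2r.
Qed.

Lemma lipschitz_continuous f (B : R) :
  (forall a b, `|f a - f b| <= B * `|a - b|) -> continuous f.
Proof.
move=> fB x; apply/cvgrPdist_le => e e0; near=> y.
apply: (le_trans (fB _ _)).
have B1 : 0 < `|B| + 1 by rewrite ltr_wpDl.
apply: (@le_trans _ _ ((`|B| + 1) * `|x - y|)).
  by rewrite ler_wpM2r// (le_trans (ler_norm _))// lerDl.
rewrite -ler_pdivlMl//; near: y.
by apply: cvgr_dist_le; [exact: cvg_id|rewrite mulr_gt0// invr_gt0].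
Unshelve. all: by end_near. Qed.

End MeanValue.

Section AlmostSure.
Context d (T : measurableType d) (R : realType) (Pr : probability T R).
Local Notation EE f := (Rintegral Pr setT f).

(** The right side is raised by [C + K] off [G], which costs nothing in expectation and makes the
    inequality hold everywhere. *)
Lemma le_expect_ae (f g : T -> R) (G : set T) : bmfun f -> bmfun g ->
  measurable G -> Pr (~` G) = 0%E -> (forall t, G t -> f t <= g t) ->
  EE f <= EE g.
Proof.
move=> bf bg mG G0 fg.
have [_ [C fC]] := bf; have [_ [K gK]] := bg.
have mGc : measurable (~` G) by exact: measurableC.
have bG : bmfun (fun t => (C + K) * \1_(~` G) t : R).
  by apply: bmfunZ; exact: bmfun_indic.
have -> : EE g = EE (fun t => g t + (C + K) * \1_(~` G) t).
  by rewrite expectD// expectZ ?expect_indic ?G0 ?mulr0 ?addr0//; exact: bmfun_indic.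
apply: le_expect => //; first exact: bmfunD.
move=> t; have [Gt|nGt] := pselect (G t).
  rewrite (le_trans (fg t Gt))// lerDl indicE.
  by rewrite memNset ?mulr0//; apply.
rewrite indicE mem_set// mulr1.
have /ler_normlP[_ h1] := fC t; have /ler_normlP[h2 _] := gK t; lra.
Qed.

End AlmostSure.

(** * Limits of the mean and variance of a one-parameter M-estimator *)

Section MEstimation.
Context d (T : measurableType d) (R : realType).
Local Notation mu := (@lebesgue_measure R).
Variables (Pr : probability T R) (X tphi : nat -> {RV Pr >-> R}).
Variables (l rt : R) (p : R -> R).
Local Notation D := [set` `[l, rt]].
Hypothesis lrt : l < rt.
Hypothesis bp : bmfun p.
Hypothesis p0 : forall x, 0 <= p x.
Hypothesis iidX : iid_with_density X D p.
Variables (ell l1 l2 : R -> R -> R) (B : R).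
Hypothesis B0 : 0 < B.
Hypothesis bell : forall th, bmfun (ell th).
Hypothesis bl1 : forall th, bmfun (l1 th).
Hypothesis bl2 : forall th, bmfun (l2 th).
Hypothesis l1B : forall th x, `|l1 th x| <= B.
Hypothesis l2Lip : forall th th' x, `|l2 th x - l2 th' x| <= B * `|th - th'|.
Hypothesis Dell : forall x (th : R), is_derive th 1 (ell^~ x) (l1 th x).
Hypothesis Dl1 : forall x (th : R), is_derive th 1 (l1^~ x) (l2 th x).
Hypothesis tphiP : forall M t, (forall i, (i < M)%N -> D (X i t)) ->
  argmax D (fun th => smean X (ell th) M t) (tphi M t).
Local Notation EE f := (Rintegral Pr setT f).
Local Notation ED f := (\int[mu]_(x in D) (p x * f x)).
Variable phis : R.
Hypothesis phisl : l < phis.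
Hypothesis phisr : phis < rt.
Hypothesis phisP : forall th, D th -> th != phis -> ED (ell th) < ED (ell phis).
Hypothesis score0 : ED (l1 phis) = 0.
Local Notation H := (- ED (l2 phis)).
Local Notation J := (ED (fun x => l1 phis x ^+ 2)).
Hypothesis H0 : 0 < H.

Let indep := iidX.2.

Let mD : measurable D. Proof. exact: measurable_itv. Qed.

Let muD : (mu D < +oo)%E.
Proof. by rewrite lebesgue_measure_itv/= lte_fin lrt -EFinB ltry. Qed.

Let intD (f : R -> R) : bmfun f -> mu.-integrable D (EFin \o f).
Proof. by move=> bf; exact: bmfun_integrable. Qed.

Let intp : \int[mu]_(x in D) p x = 1.
Proof.
have := iidX.1 0%N setT measurableT.
rewrite setTI [X in X = _]probability_setT => h.
by rewrite /Rintegral -h.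
Qed.

Let EE_dist_ge0 (f : R -> R) i : bmfun f -> (forall x, 0 <= f x) ->
  EE (fun t => f (X i t)) = ED f.
Proof.
move=> bf f0; rewrite /Rintegral; congr fine.
transitivity (\int[distribution Pr (X i)]_x (f x)%:E)%E.
  rewrite ge0_integral_distribution//; apply/measurable_EFinP; exact: bf.1.
have bh : bmfun (fun x => p x * \1_D x) by apply: bmfunM => //; exact: bmfun_indic.
rewrite -(@ge0_integral_transfer _ (measurableTypeR R) R mu (distribution Pr (X i)) id
  (fun x => p x * \1_D x))//.
- rewrite [RHS]integral_mkcond; apply: eq_integral => x _.
  rewrite patchE indicE; case: ifPn => xD; last by rewrite mulr0 mulr0.
  by rewrite mulr1 mulrC.
- exact: bh.1.
- by move=> x; rewrite mulr_ge0// indicE.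
- move=> A mA; rewrite [RHS](iidX.1 i A mA) preimage_id integral_mkcondr.
  apply: eq_integral => x _; rewrite patchE indicE.
  by case: ifPn => xD; rewrite ?mulr1 ?mulr0.
- exact: bf.1.
Qed.

Let EE_dist (f : R -> R) i : bmfun f -> EE (fun t => f (X i t)) = ED f.
Proof.
move=> bf; have [_ [C fC]] := bf.
have bC : bmfun (fun _ : R => C) by exact: bmfun_cst.
have E1 : EE (fun t => f (X i t) + C) = EE (fun t => f (X i t)) + C.
  by rewrite expectD ?expect_cst//; [exact: (bmfunX_RV X i bf)|exact: bmfun_cst].
have E2 : ED (fun x => f x + C) = ED f + C.
  under eq_Rintegral do rewrite mulrDr.
  rewrite RintegralD//; [|exact/intD/bmfunM|exact/intD/bmfunM].
  by rewrite RintegralZr ?intp ?mul1r//; exact: intD.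
apply: (addIr C); rewrite -E1 -E2; apply: EE_dist_ge0; first exact: bmfunD.
by move=> x; have /ler_normlP[h1 _] := fC x; lra.
Qed.

(** The estimator is constrained on this event. Its complement is null, being a countable union of
    the events that one sample misses [D]. *)
Let G := \bigcap_i (X i @^-1` D).

Let mG : measurable G.
Proof.
apply: bigcapT_measurable => i; rewrite -[X in measurable X]setTI.
exact: measurable_funP.
Qed.

Let Gc0 : Pr (~` G) = 0%E.
Proof.
apply/eqP; rewrite eq_le measure_ge0 andbT /G setC_bigcap.
have mXc i : measurable (~` (X i @^-1` D)).
  apply: measurableC; rewrite -[X in measurable X]setTI.
  exact: measurable_funP.
have Xc0 i : Pr (~` (X i @^-1` D)) = 0%E.
  rewrite probability_setC; last first.
    by rewrite -[X in measurable X]setTI; exact: measurable_funP.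
  have := iidX.1 i D mD; rewrite setIid /distribution/= /pushforward => ->.
  have := intp; rewrite /Rintegral; case: (integral _ _ _) => [r /= ->||].
  - by rewrite subee.
  - by move=> /= /esym/eqP; rewrite oner_eq0.
  - by move=> /= /esym/eqP; rewrite oner_eq0.
suff -> : Pr (\bigcup_i ~` (X i @^-1` D)) = 0%E by [].
apply: measure_negligible; first exact: bigcupT_measurable.
apply: negligible_bigcup => i.
by exists (~` (X i @^-1` D)); split; [exact: mXc|exact: Xc0|].
Qed.

Let ellLip th th' x : `|ell th x - ell th' x| <= B * `|th - th'|.
Proof. exact: (@lipschitz_of_derive _ (ell^~ x) (l1^~ x)). Qed.

Let EDLip th th' : `|ED (ell th) - ED (ell th')| <= B * `|th - th'|.
Proof.
rewrite -!(EE_dist 0)// -expectB; do ?exact: (bmfunX_RV X 0 (bell _)).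
have b2 : bmfun (fun t => ell th (X 0%N t) - ell th' (X 0%N t)).
  by apply: bmfunB; exact: (bmfunX_RV X 0 (bell _)).
apply: (le_trans (le_normr_Rintegral _ (bmfun_prob_integrable Pr b2))) => //.
rewrite -[leRHS](expect_cst Pr); apply: le_expect => //; last exact: bmfun_cst.
exact: bmfun_norm.
Qed.

Let smeanLip th th' M t :
  `|smean X (ell th) M t - smean X (ell th') M t| <= B * `|th - th'|.
Proof.
rewrite /smean -mulrBr -sumrB normrM ger0_norm ?invr_ge0//.
have [->|M0] := eqVneq M 0%N; first by rewrite invr0 mul0r mulr_ge0// ltW.
rewrite ler_pdivrMl ?ltr0n ?lt0n//; apply: (le_trans (ler_norm_sum _ _ _)).
rewrite mulr_natl -[X in _ *+ X]card_ord -sumr_const.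
by apply: ler_sum => i _; exact: ellLip.
Qed.

Let smean_der (f g : R -> R -> R) (M : nat) t (th : R) :
  (forall x th : R, is_derive th 1 (f^~ x) (g th x)) ->
  is_derive th 1 (fun th => smean X (f th) M t) (smean X (g th) M t).
Proof.
move=> fg; rewrite /smean.
have E : is_derive th 1 (\sum_(i < M) (fun th => f th (X i t)))
    (\sum_(i < M) g th (X i t)) by exact: is_derive_sum.
have -> : (fun th => M%:R^-1 * \sum_(i < M) f th (X i t)) =
    M%:R^-1 \*: (\sum_(i < M) (fun th => f th (X i t))).
  by apply/funext => y; rewrite /= fct_sumE.
exact: is_deriveZ.
Qed.

(** Compactness: on each of [[l, phis - e]] and [[phis + e, rt]] the expected log-likelihood attains
    its maximum, which is below the value at [phis]. *)
Let gap e : 0 < e -> e < phis - l -> e < rt - phis ->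
  exists2 de : R, 0 < de & forall th, D th -> e <= `|th - phis| ->
    ED (ell th) <= ED (ell phis) - de.
Proof.
move=> e0 el er.
have cED : continuous (fun th => ED (ell th)).
  exact: lipschitz_continuous EDLip.
have l1e : l <= phis - e by lra.
have r1e : phis + e <= rt by lra.
have [c1 c1P H1] := EVT_max l1e (continuous_subspaceT cED).
have [c2 c2P H2] := EVT_max r1e (continuous_subspaceT cED).
move: c1P c2P; rewrite !in_itv/= => /andP[c11 c12] /andP[c21 c22].
have h1 : ED (ell c1) < ED (ell phis).
  apply: phisP; first by rewrite /= in_itv/= c11; lra.
  by apply/eqP; lra.
have h2 : ED (ell c2) < ED (ell phis).
  apply: phisP; first by rewrite /= in_itv/= c22 andbT; lra.
  by apply/eqP; lra.
pose g1 := ED (ell phis) - ED (ell c1); pose g2 := ED (ell phis) - ED (ell c2).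
exists (Num.min g1 g2); first by rewrite lt_min !subr_gt0 h1.
move=> th; rewrite /= in_itv/= => /andP[lth thr].
rewrite ler_normr => /orP[h|h]; rewrite lerBrDr.
  have := H2 th; rewrite in_itv/= thr => /(_ ltac:(lra)) hh.
  apply: (le_trans (lerD hh (_ : _ <= g2))); last by rewrite /g2 addrC subrK.
  by rewrite ge_min lexx orbT.
have := H1 th; rewrite in_itv/= lth => /(_ ltac:(lra)) hh.
apply: (le_trans (lerD hh (_ : _ <= g1))); last by rewrite /g1 addrC subrK.
by rewrite ge_min lexx.
Qed.



(** Off [G] nothing bounds [tphi]; the clamped version agrees with it almost surely and is a bounded
    function. *)
Let tcl M t := Num.max l (Num.min rt (tphi M t)).

Let S M t := smean X (l1 phis) M t.

Let Rem M t := H * (tcl M t - phis) - S M t.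

Let tcl_itv M t : l <= tcl M t <= rt.
Proof. by rewrite /tcl le_max lexx/= ge_max (ltW lrt)/= ge_min lexx. Qed.

Let tclE M t : G t -> tcl M t = tphi M t.
Proof.
move=> Gt; have [] := @tphiP M t (fun i _ => Gt i I).
rewrite /= in_itv/= => /andP[h1 h2] _.
by rewrite /tcl (min_idPr h2) (max_idPr h1).
Qed.

Let btcl M : bmfun (tcl M).
Proof.
split.
  apply: measurable_maxr => //; apply: measurable_minr => //.
exists (`|l| + `|rt|) => t; have /andP[h1 h2] := tcl_itv M t.
have := ler_norm rt; have := ler_norm (- l); rewrite normrN => h3 h4.
have := normr_ge0 l; have := normr_ge0 rt => h5 h6.
by rewrite ler_norml; apply/andP; split; lra.
Qed.

Let bS M : bmfun (S M). Proof. exact: (bmfun_smean X M (bl1 phis)). Qed.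

Let bRem M : bmfun (Rem M).
Proof.
apply: bmfunB => //; apply: bmfunZ; apply: bmfunB => //; exact: bmfun_cst.
Qed.

Let EES M : EE (S M.+1) = 0.
Proof. by apply: (expect_smean (k := l1 phis)) => // i; rewrite EE_dist. Qed.

Let EES2 M : EE (fun t => S M t ^+ 2) = J / M%:R.
Proof.
apply: (expect_smean_sqr indep M (k := l1 phis)) => // i; first by rewrite EE_dist.
by rewrite (EE_dist i (f := fun x => l1 phis x ^+ 2))//; exact: bmfunX.
Qed.

Let J0 : 0 <= J.
Proof. by apply: Rintegral_ge0 => x _; rewrite mulr_ge0// sqr_ge0. Qed.

Let SB M t : `|S M t| <= B.
Proof.
rewrite /S /smean normrM ger0_norm ?invr_ge0//.
have [->|M0] := eqVneq M 0%N; first by rewrite invr0 mul0r ltW.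
rewrite ler_pdivrMl ?ltr0n ?lt0n//; apply: (le_trans (ler_norm_sum _ _ _)).
rewrite mulr_natl -[X in _ *+ X]card_ord -sumr_const.
by apply: ler_sum.
Qed.

Let Rem_bound M t : Rem M t ^+ 2 <= (H * (rt - l) + B) ^+ 2.
Proof.
rewrite -[leLHS]real_normK ?num_real// lerXn2r ?nnegrE//.
  by rewrite addr_ge0 ?mulr_ge0 ?subr_ge0 ?ltW.
apply: (le_trans (ler_normB _ _)); rewrite lerD// normrM (gtr0_norm H0).
rewrite ler_pM2l//; have /andP[h1 h2] := tcl_itv M t.
have := phisl; have := phisr => h3 h4.
by rewrite ler_norml; apply/andP; split; lra.
Qed.

(* A grid of N + 1 points of mesh h reduces uniform closeness of the sample
   log-likelihood to finitely many events. *)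
Let good_event (e de om : R) (N : nat) (h : R) M t :
  0 < e -> e < phis - l -> e < rt - phis -> 0 < de ->
  (forall th, D th -> e <= `|th - phis| -> ED (ell th) <= ED (ell phis) - 4 * de) ->
  0 < h -> B * h <= de -> (rt - l) / h < N.+1%:R ->
  B * e <= om / 2 -> om <= H / 2 ->
  G t ->
  (forall j, (j <= N)%N -> `|smean X (ell (l + j%:R * h)) M t
       - ED (ell (l + j%:R * h))| < de) ->
  `|smean X (ell phis) M t - ED (ell phis)| < de ->
  `|smean X (l2 phis) M t - ED (l2 phis)| < om / 2 ->
  `|Rem M t| <= 2 * om / H * `|S M t|.
Proof.
move=> e0 el er de0 gapP h0 hB hN eB omH Gt netP phisE l2E.
set th := tphi M t.
have [Dth thmax] : argmax D (fun th => smean X (ell th) M t) th.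
  by apply: tphiP => i _; exact: Gt.
have := Dth; rewrite /= in_itv/= => /andP[lth thr].
have near_phis : `|th - phis| < e.
  rewrite ltNge; apply/negP => far.
  (* The grid point below [th]. Moving there in the sample and back in the expected log-likelihood
     costs at most [de] each; the deviations at the grid point and at [phis] cost less than [de]
     each. The total stays below the gap [4 * de], so [phis] would beat [th]. *)
  pose j := Num.trunc ((th - l) / h).
  have q0 : 0 <= (th - l) / h by rewrite divr_ge0 ?subr_ge0// ltW.
  have /andP[j1 j2] := truncn_itv q0.
  rewrite -/j in j1 j2.
  have jN : (j <= N)%N.
    rewrite -ltnS -(ltr_nat R); apply: (le_lt_trans j1).
    by apply: le_lt_trans hN; rewrite ler_pM2r ?invr_gt0// lerD2r.
  have dist : `|th - (l + j%:R * h)| <= h.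
    move: j1 j2; rewrite ler_pdivlMr// ltr_pdivrMr// -natr1 mulrDl mul1r => j1 j2.
    by rewrite ler_norml; apply/andP; split; lra.
  have := thmax phis; rewrite /= in_itv/= (ltW phisl) (ltW phisr) => /(_ isT).
  have := netP j jN; set a := smean _ _ _ _; set b := ED _.
  have := smeanLip th (l + j%:R * h) M t; have := EDLip th (l + j%:R * h).
  rewrite -/a -/b; have := gapP _ Dth far.
  have : B * `|th - (l + j%:R * h)| <= de.
    by apply: le_trans hB; rewrite ler_pM2l.
  move: phisE.
  set c := smean _ _ _ _; set c' := ED _; set u := smean _ _ _ _; set u' := ED _.
  move=> /ltr_normlP[q1 q2] q3 q4 /ler_normlP[q5 q6] /ler_normlP[q7 q8]
    /ltr_normlP[q9 q10] q11.
  lra.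
have Lder (y : R) : is_derive y 1 (fun z => smean X (ell z) M t)
    (smean X (l1 y) M t) by exact: smean_der.
have L1der (y : R) : is_derive y 1 (fun z => smean X (l1 z) M t)
    (smean X (l2 y) M t) by exact: smean_der.
(* [e] is below the distance from [phis] to either end, so the maximizer is interior and its mean
   score vanishes. *)
have crit : smean X (l1 th) M t = 0.
  have thI : th \in `]l, rt[.
    by move: near_phis => /ltr_normlP[n1 n2]; rewrite in_itv/=; apply/andP; split; lra.
  have := @derive1_at_max _ _ _ _ _ (ltW lrt)
    (fun x _ => @ex_derive _ _ _ _ _ _ _ (Lder x)) thI _.
  move=> /(_ _)[]; last by move=> _; rewrite (@derive_val _ _ _ _ _ _ _ (Lder th)).
  move=> x; rewrite in_itv/= => /andP[lx xr]; apply: thmax.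
  by rewrite /= in_itv/= !ltW.
have [xi [xi1 _ xiE]] := mean_value phis th L1der.
rewrite crit sub0r in xiE.
(* The vanishing score at [th] expresses [S] as minus the second derivative at [xi] times
   [th - phis]; the remainder is thus the error of that second derivative times [th - phis]. *)
have RE : Rem M t = (H + smean X (l2 xi) M t) * (th - phis).
  by rewrite /Rem tclE// mulrDl -xiE /S -/th.
have cH : `|H + smean X (l2 xi) M t| <= om.
  have -> : H + smean X (l2 xi) M t =
      (smean X (l2 xi) M t - smean X (l2 phis) M t) +
      (smean X (l2 phis) M t - ED (l2 phis)) by ring.
  apply: (le_trans (ler_normD _ _)).
  have : `|smean X (l2 xi) M t - smean X (l2 phis) M t| <= B * `|xi - phis|.
    rewrite /smean -mulrBr -sumrB normrM ger0_norm ?invr_ge0//.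
    have [->|M0] := eqVneq M 0%N; first by rewrite invr0 mul0r mulr_ge0// ltW.
    rewrite ler_pdivrMl ?ltr0n ?lt0n//; apply: (le_trans (ler_norm_sum _ _ _)).
    rewrite mulr_natl -[X in _ *+ X]card_ord -sumr_const.
    by apply: ler_sum => i _; exact: l2Lip.
  have : B * `|xi - phis| <= B * e.
    by rewrite ler_pM2l//; apply: le_trans xi1 _; exact: ltW.
  lra.
have Rle : `|Rem M t| <= om * `|th - phis|.
  by rewrite RE normrM ler_wpM2r.
have SE : S M t = H * (th - phis) - Rem M t by rewrite /Rem tclE// -/th; ring.
(* The remainder takes at most half of [H * (th - phis)], so [S] controls the other half, and
   [th - phis] can be replaced by [2 / H] times [S]. *)
have Sge : H / 2 * `|th - phis| <= `|S M t|.
  have h1 : H * `|th - phis| <= `|S M t| + `|Rem M t|.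
    rewrite -[X in X * _](gtr0_norm H0) -normrM.
    have -> : H * (th - phis) = S M t + Rem M t by rewrite SE subrK.
    exact: ler_normD.
  have : om * `|th - phis| <= H / 2 * `|th - phis| by rewrite ler_wpM2r.
  have := mulrDl (H / 2) (H / 2) `|th - phis|.
  rewrite -splitr; lra.
apply: (le_trans Rle).
have om0 : 0 <= om by apply: le_trans cH.
have -> : 2 * om / H * `|S M t| = om * (2 / H * `|S M t|) by ring.
rewrite ler_wpM2l// -ler_pdivrMl ?divr_gt0//.
by rewrite invf_div.
Qed.

Let measurable_dev (k : R -> R) m de M : bmfun k ->
  measurable [set t | de <= `|smean X k M t - m|].
Proof.
move=> bk.
have bd : bmfun (fun t => `|smean X k M t - m|).
  apply/bmfun_norm/bmfunB; [exact: bmfun_smean|exact: bmfun_cst].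
have -> : [set t | de <= `|smean X k M t - m|] =
    (fun t => `|smean X k M t - m|) @^-1` `[de, +oo[.
  by apply/seteqP; split => t /=; rewrite in_itv/= andbT.
by rewrite -[X in measurable X]setTI; exact: bd.1.
Qed.

(** Pointwise, [Rem^2] is at most [tau * S^2] on good outcomes and at most a constant [K] on the
    others. After scaling by [M], the first contributes [tau * J] and the second
    [M * O(1 / M^2)]. *)
Let EE_Rem2 tau : 0 < tau -> exists C : R, forall M,
  M%:R * EE (fun t => Rem M t ^+ 2) <= tau * J + C / M%:R.
Proof.
move=> tau0.
(* With [om = (H / 2) * a] the good-event bound reads [|Rem| <= a * |S|], and [a <= 1] together with
   [a <= tau] gives [a^2 <= tau]. *)
pose a := Num.min 1 tau.
have a0 : 0 < a by rewrite lt_min ltr01.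
have a1 : a <= 1 by rewrite ge_min lexx.
have at1 : a <= tau by rewrite ge_min lexx orbT.
pose om := H / 2 * a.
have om0 : 0 < om by rewrite mulr_gt0// divr_gt0.
have omH : om <= H / 2 by rewrite ger_pMr// divr_gt0.
pose e := Num.min (om / (2 * B)) (Num.min ((phis - l) / 2) ((rt - phis) / 2)).
have e0 : 0 < e by rewrite !lt_min !divr_gt0 ?subr_gt0// mulr_gt0.
have el : e < phis - l.
  apply: (@le_lt_trans _ _ ((phis - l) / 2)).
    by rewrite /e !ge_min lexx !orbT.
  by have := phisl; lra.
have er : e < rt - phis.
  apply: (@le_lt_trans _ _ ((rt - phis) / 2)).
    by rewrite /e !ge_min lexx !orbT.
  by have := phisr; lra.
have eB : B * e <= om / 2.
  rewrite -ler_pdivlMl// /e ge_min; apply/orP; left.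
  by rewrite le_eqVlt; apply/orP; left; apply/eqP; field; rewrite gt_eqF.
have [de4 de40 gapP] := gap e0 el er.
pose de := de4 / 4.
have de0 : 0 < de by rewrite divr_gt0.
have gapP' th : D th -> e <= `|th - phis| ->
    ED (ell th) <= ED (ell phis) - 4 * de.
  by move=> Dth eth; have := gapP th Dth eth; rewrite /de mulrC divfK.
pose h := de / B.
have h0 : 0 < h by rewrite divr_gt0.
have hB : B * h <= de by rewrite /h mulrC divfK// gt_eqF.
pose N := Num.trunc ((rt - l) / h).
have hN : (rt - l) / h < N.+1%:R.
  have /truncn_itv/andP[] // : 0 <= (rt - l) / h.
  by rewrite divr_ge0 ?subr_ge0 ?ltW.
pose A1 (j M : nat) := [set t | de <= `|smean X (ell (l + j%:R * h)) M t -
       ED (ell (l + j%:R * h))|].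
pose A2 M := [set t | de <= `|smean X (ell phis) M t - ED (ell phis)|].
pose A3 M := [set t | om / 2 <= `|smean X (l2 phis) M t - ED (l2 phis)|].
have mA1 j M : measurable (A1 j M) by exact: measurable_dev.
have mA2 M : measurable (A2 M) by exact: measurable_dev.
have mA3 M : measurable (A3 M) by exact: measurable_dev.
have /choice[C1 HC1] : forall j, exists C : R, forall M,
    M%:R ^+ 2 * EE (\1_(A1 j M)) <= C.
  by move=> j; apply: smean_concentration => // i; rewrite EE_dist.
have [C2 HC2] : exists C : R, forall M, M%:R ^+ 2 * EE (\1_(A2 M)) <= C.
  by apply: smean_concentration => // i; rewrite EE_dist.
have [C3 HC3] : exists C : R, forall M, M%:R ^+ 2 * EE (\1_(A3 M)) <= C.
  apply: smean_concentration => //; first by move=> i; rewrite EE_dist.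
  by rewrite divr_gt0.
have [K K0 RK] : exists2 K : R, 0 <= K & forall M t, Rem M t ^+ 2 <= K.
  by exists ((H * (rt - l) + B) ^+ 2); [exact: sqr_ge0|exact: Rem_bound].
(* A sum of indicators instead of the indicator of the union: it is at least 1 on every bad outcome,
   and its expectation is a finite sum. *)
pose bad M t : R := \sum_(j < N.+1) \1_(A1 j M) t + (\1_(A2 M) t + \1_(A3 M) t).
have bbad M : bmfun (bad M).
  apply: bmfunD; first by apply: bmfun_sum => j; exact: bmfun_indic.
  by apply: bmfunD; exact: bmfun_indic.
pose C := \sum_(j < N.+1) C1 j + (C2 + C3).
have EEbad M : M%:R ^+ 2 * EE (bad M) <= C.
  rewrite /bad expectD; last 2 first.
  - by apply: bmfun_sum => j; exact: bmfun_indic.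
  - by apply: bmfunD; exact: bmfun_indic.
  rewrite expect_sum; last by move=> j; exact: bmfun_indic.
  rewrite expectD; [|exact: bmfun_indic|exact: bmfun_indic].
  have h1 j := HC1 j M; have h2 := HC2 M; have h3 := HC3 M.
  move: h1 h2 h3; move: (M%:R ^+ 2) => w h1 h2 h3.
  rewrite mulrDr mulr_sumr; apply: lerD; first exact: ler_sum.
  by rewrite mulrDr; exact: lerD.
exists (K * C) => M.
have [->|M0] := eqVneq M 0%N.
  by rewrite mul0r invr0 mulr0 addr0 mulr_ge0// ltW.
have M1 : 0 < M%:R :> R by rewrite ltr0n lt0n.
have step : EE (fun t => Rem M t ^+ 2) <=
    EE (fun t => tau * S M t ^+ 2 + K * bad M t).
  apply: (le_expect_ae _ _ mG Gc0).
  - exact: bmfunX.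
  - by apply: bmfunD; [exact/bmfunZ/bmfunX|exact: bmfunZ].
  move=> t Gt.
  have bad0 : 0 <= bad M t.
    by rewrite !addr_ge0// ?sumr_ge0// => *; rewrite indicE.
  have [good|notgood] := pselect ((forall j, (j <= N)%N -> ~ A1 j M t) /\
     (~ A2 M t /\ ~ A3 M t)).
    have : `|Rem M t| <= 2 * om / H * `|S M t|.
      apply: (@good_event e de om N h M t) => //.
      - by move=> j jN; rewrite ltNge; apply/negP; exact: good.1 j jN.
      - by rewrite ltNge; apply/negP; exact: good.2.1.
      - by rewrite ltNge; apply/negP; exact: good.2.2.
    have aux (x y : R) : 0 < x -> 2 * (x / 2 * y) / x = y.
      by move=> x0; field; rewrite gt_eqF.
    rewrite /om aux//.
    move=> RS; apply: (@le_trans _ _ (tau * S M t ^+ 2)); last first.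
      by rewrite lerDl mulr_ge0.
    rewrite -(real_normK (num_real (Rem M t))) -(real_normK (num_real (S M t))).
    apply: (@le_trans _ _ ((a * `|S M t|) ^+ 2)).
      by rewrite lerXn2r// nnegrE mulr_ge0// ltW.
    rewrite exprMn ler_wpM2r ?sqr_ge0// expr2.
    by apply: le_trans at1; rewrite ger_pMl.
  have bad1 : 1 <= bad M t.
    move/not_andP : notgood => [/existsNP[j /not_implyP[jN /contrapT Aj]]|].
      rewrite /bad (bigD1 (inord j))//= inordK// [X in X + _ + _]indicE mem_set//.
      by rewrite -addrA lerDl !addr_ge0// ?sumr_ge0// => *; rewrite indicE.
    move/not_andP => [/contrapT A2t|/contrapT A3t].
      rewrite /bad [X in _ + (X + _)]indicE mem_set// addrCA lerDl.
      by rewrite !addr_ge0// ?sumr_ge0// => *; rewrite indicE.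
    rewrite /bad [X in _ + (_ + X)]indicE mem_set// addrA lerDr.
    by rewrite !addr_ge0// ?sumr_ge0// => *; rewrite indicE.
  apply: (le_trans (RK M t)).
  apply: (@le_trans _ _ (K * bad M t)); first by rewrite ler_peMr.
  by rewrite lerDr mulr_ge0 ?sqr_ge0// ltW.
move: step; rewrite expectD; [|exact/bmfunZ/bmfunX|exact: bmfunZ].
rewrite !expectZ//; last exact: bmfunX.
rewrite EES2 -(ler_pM2l M1) => /le_trans; apply.
rewrite mulrDr; apply: lerD.
  by rewrite le_eqVlt; apply/orP; left; apply/eqP; field; rewrite gt_eqF.
rewrite mulrCA -[leRHS]mulrA ler_wpM2l// ler_pdivlMr//.
by have := EEbad M; rewrite expr2 -mulrA mulrC.
Qed.

Let cvg_M_Rem2 : (fun M => M%:R * EE (fun t => Rem M t ^+ 2)) @ \oo --> (0 : R).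
Proof.
apply/cvgrPdist_le => e e0.
pose tau := e / 2 / (J + 1).
have J1 : 0 < J + 1 by rewrite ltr_wpDl.
have tau0 : 0 < tau by rewrite !divr_gt0.
have [C HC] := EE_Rem2 tau0.
near=> M.
have M0 : 0 < M%:R :> R by near: M; exact: nbhs_infty_gtr.
rewrite sub0r normrN ger0_norm; last first.
  by rewrite mulr_ge0//; apply: expect_ge0 => t; exact: sqr_ge0.
apply: (le_trans (HC M)).
have h1 : tau * J <= e / 2.
  rewrite /tau mulrAC ler_pdivrMr// ler_pM2l ?divr_gt0//.
  by rewrite lerDl.
have h2 : C / M%:R <= e / 2.
  rewrite ler_pdivrMr// -ler_pdivrMl ?divr_gt0//.
  by near: M; exact: nbhs_infty_ger.
lra.
Unshelve. all: by end_near. Qed.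

Let ae_tcl M : ae_eq Pr setT (tphi M) (tcl M).
Proof.
exists (~` G); split; [exact: measurableC|exact: Gc0|].
by move=> t /= h Gt; apply: h => _; rewrite tclE.
Qed.

Let expectation_tphi M : ('E_Pr[tphi M] = (EE (tcl M))%:E)%E.
Proof.
rewrite unlock expect_EFin//; apply: ae_eq_integral => //.
- by apply/measurable_EFinP; exact: measurable_funP.
- by apply/measurable_EFinP; exact: (btcl M).1.
- by apply: filterS (ae_tcl M) => t h Dt; rewrite h.
Qed.

Let variance_tphi M :
  ('V_Pr[tphi M] = (EE (fun t => (tcl M t - EE (tcl M)) ^+ 2))%:E)%E.
Proof.
have bc : bmfun (fun t => (tcl M t - EE (tcl M)) ^+ 2).
  by apply/bmfunX/bmfunB => //; exact: bmfun_cst.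
rewrite /variance unlock expectation_tphi/= unlock expect_EFin//.
apply: ae_eq_integral => //.
- apply/measurable_EFinP; apply: measurable_funM; apply: measurable_funB => //;
    exact: measurable_funP.
- by apply/measurable_EFinP; exact: bc.1.
- by apply: filterS (ae_tcl M) => t h Dt; rewrite expr2 -(h Dt).
Qed.

Let EE_tcl M : EE (tcl M.+1) = phis + EE (Rem M.+1) / H.
Proof.
have bd : bmfun (fun t => tcl M.+1 t - phis).
  by apply: bmfunB => //; exact: bmfun_cst.
have -> : EE (Rem M.+1) = H * (EE (tcl M.+1) - phis).
  rewrite /Rem expectB//; last exact: bmfunZ.
  by rewrite EES subr0 expectZ// expectB ?expect_cst//; exact: bmfun_cst.
by rewrite mulrC mulKf ?gt_eqF// addrC subrK.
Qed.

Let EE_Rem_sqr M : EE (Rem M) ^+ 2 <= EE (fun t => Rem M t ^+ 2).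
Proof.
pose c := EE (Rem M).
have : 0 <= EE (fun t => (Rem M t - c) ^+ 2) by apply: expect_ge0 => t; exact: sqr_ge0.
under eq_Rintegral => t _.
  rewrite (_ : _ ^+ 2 = Rem M t ^+ 2 - (2 * c * Rem M t - c ^+ 2)); last by ring.
  over.
have b1 : bmfun (fun t => 2 * c * Rem M t) by exact: bmfunZ.
have b2 : bmfun (fun _ : T => c ^+ 2) by exact: bmfun_cst.
rewrite expectB; [|exact: bmfunX|exact: bmfunB].
rewrite expectB// expectZ// expect_cst -/c; lra.
Qed.

Let cvg_Rem2 : (fun M => EE (fun t => Rem M t ^+ 2)) @ \oo --> (0 : R).
Proof.
apply/cvgrPdist_le => e e0.
have /cvgrPdist_le/(_ e e0) h := cvg_M_Rem2.
near=> M.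
have M1 : 1 <= M%:R :> R by near: M; exact: nbhs_infty_ger.
have : `|0 - M%:R * EE (fun t => Rem M t ^+ 2)| <= e by near: M.
rewrite !sub0r !normrN; apply: le_trans.
by rewrite normrM ler_peMl// ger0_norm// (le_trans _ M1).
Unshelve. all: by end_near. Qed.

Lemma cvg_expectation : ('E_Pr[tphi M] @[M --> \oo] --> phis%:E)%E.
Proof.
under eq_fun do rewrite expectation_tphi.
apply: cvg_EFin; first by apply: nearW.
apply/cvgrPdist_le => e e0.
have He : 0 < (e * H) ^+ 2 by rewrite exprn_gt0// mulr_gt0.
have /cvgrPdist_le/(_ _ He) h := cvg_Rem2.
near=> M.
have M0 : (0 < M)%N by near: M; exact: nbhs_infty_gt.
have hM : `|0 - EE (fun t => Rem M t ^+ 2)| <= (e * H) ^+ 2 by near: M.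
rewrite /= -(prednK M0) EE_tcl (prednK M0) opprD addNKr normrN.
rewrite normrM normfV (gtr0_norm H0) ler_pdivrMr//.
rewrite -(@ler_pXn2r _ 2)// ?nnegrE//; last by rewrite mulr_ge0 ?ltW.
rewrite real_normK ?num_real//; apply: (le_trans (EE_Rem_sqr M)).
apply: le_trans hM; rewrite sub0r normrN; exact: ler_norm.
Unshelve. all: by end_near. Qed.

(** Centred, [H * tcl] is [S + Rem - c] because [S] has mean zero, and [M] times the second moment
    of [S] is exactly [J]. What is left is the cross term and the variance of [Rem]. *)
Let variance_decomp M : (0 < M)%N ->
  `|M%:R * EE (fun t => (tcl M t - EE (tcl M)) ^+ 2) * H ^+ 2 - J| <=
  M%:R * (2 * `|EE (fun t => S M t * Rem M t)| + EE (fun t => Rem M t ^+ 2)).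
Proof.
move=> M0; have M1 : 0 < M%:R :> R by rewrite ltr0n.
pose c := EE (Rem M).
have E : EE (tcl M) = phis + c / H by rewrite /c -(prednK M0) EE_tcl.
have Hn : H != 0 by rewrite gt_eqF.
have -> : EE (fun t => (tcl M t - EE (tcl M)) ^+ 2) =
    (EE (fun t => (S M t + Rem M t - c) ^+ 2)) / H ^+ 2.
  rewrite mulrC -expectZ; last first.
    by apply/bmfunX/bmfunB; [exact: bmfunD|exact: bmfun_cst].
  apply: eq_Rintegral => t _.
  have -> : S M t + Rem M t - c = H * (tcl M t - phis) - c.
    by congr (_ - _); rewrite /Rem addrC subrK.
  have aux (x y z u : R) : x != 0 ->
      (y - (z + u / x)) ^+ 2 = x ^- 2 * (x * (y - z) - u) ^+ 2.
    by move=> xn; field.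
  by rewrite E; exact: aux.
rewrite mulrA divfK ?expf_neq0//.
have b1 : bmfun (fun t => S M t ^+ 2) by exact: bmfunX.
have b2 : bmfun (fun t => 2 * (S M t * Rem M t)) by apply/bmfunZ/bmfunM.
have b2' : bmfun (fun t => S M t * Rem M t) by apply/bmfunM.
have b3 : bmfun (fun t => Rem M t ^+ 2) by exact: bmfunX.
have b4 : bmfun (fun t => 2 * c * (S M t + Rem M t)) by apply/bmfunZ/bmfunD.
have b5 : bmfun (fun _ : T => c ^+ 2) by exact: bmfun_cst.
under eq_Rintegral => t _.
  rewrite (_ : _ ^+ 2 = S M t ^+ 2 + (2 * (S M t * Rem M t) +
    (Rem M t ^+ 2 - (2 * c * (S M t + Rem M t) - c ^+ 2)))); last by ring.
  over.
have bb := bmfunB b3 (bmfunB b4 b5).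
rewrite (expectD Pr b1 (bmfunD b2 bb)) (expectD Pr b2 bb) (expectB Pr b3 (bmfunB b4 b5)).
rewrite (expectB Pr b4 b5) expect_cst expectZ// expectZ; last exact: bmfunD.
have ESM : EE (S M) = 0 by rewrite -(prednK M0) EES.
rewrite (expectD Pr (bS M) (bRem M)) ESM -/c add0r EES2.
have := EE_Rem_sqr M; rewrite -/c.
set x := EE _ => cx.
set y := EE _.
have -> : M%:R * (J / M%:R + (2 * y + (x - (2 * c * c - c ^+ 2)))) - J =
   M%:R * (2 * y + (x - c ^+ 2)).
  by field; rewrite gt_eqF.
rewrite normrM (gtr0_norm M1) ler_pM2l//.
apply: (le_trans (ler_normD _ _)); rewrite normrM ger0_norm// lerD2l.
by rewrite ger0_norm ?subr_ge0// lerBlDr lerDl sqr_ge0.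
Qed.

Lemma cvg_variance :
  (M%:R%:E * 'V_Pr[tphi M] @[M --> \oo] --> (J / H ^+ 2)%:E)%E.
Proof.
under eq_fun do rewrite variance_tphi -EFinM.
apply: cvg_EFin; first by apply: nearW.
apply/cvgrPdist_le => e0' e00'.
pose e := e0' * H ^+ 2.
have H2 : 0 < H ^+ 2 by rewrite exprn_gt0.
have e0 : 0 < e by rewrite mulr_gt0.
(* Weight in [2 |x y| <= al x^2 + y^2 / al] for the cross term: [al] makes the [S] part at most
   [e / 2], and for this fixed [al] the [Rem] part tends to 0. *)
pose al := e / 2 / (J + 1).
have J1 : 0 < J + 1 by rewrite ltr_wpDl.
have al0 : 0 < al by rewrite !divr_gt0.
pose q := al^-1 + 1.
have q0 : 0 < q by rewrite ltr_wpDl// invr_ge0 ltW.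
have eq0 : 0 < e / 2 / q by rewrite !divr_gt0.
have /cvgrPdist_le/(_ _ eq0) h := cvg_M_Rem2.
near=> M.
have M0 : (0 < M)%N by near: M; exact: nbhs_infty_gt.
have M1 : 0 < M%:R :> R by rewrite ltr0n.
have hM : `|0 - M%:R * EE (fun t => Rem M t ^+ 2)| <= e / 2 / q by near: M.
rewrite /= -[leLHS](mulfK (lt0r_neq0 H2)) ler_pdivrMr// -/e.
rewrite -[X in _ * X](gtr0_norm H2) -normrM mulrBl divfK ?gt_eqF// distrC.
apply: (le_trans (variance_decomp M0)).
have bS2 : bmfun (fun t => S M t ^+ 2) by exact: bmfunX.
have bR2 : bmfun (fun t => Rem M t ^+ 2) by exact: bmfunX.
have bSR : bmfun (fun t => S M t * Rem M t) by exact: bmfunM.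
have cs : 2 * `|EE (fun t => S M t * Rem M t)| <=
    al * (J / M%:R) + al^-1 * EE (fun t => Rem M t ^+ 2).
  apply: (@le_trans _ _ (2 * EE (fun t => `|S M t * Rem M t|))).
    rewrite ler_pM2l//; apply: le_normr_Rintegral => //.
    exact: bmfun_prob_integrable.
  rewrite -EES2 -!expectZ//; last exact: bmfun_norm.
  rewrite -expectD; [|exact: bmfunZ|exact: bmfunZ].
  apply: le_expect; [exact/bmfunZ/bmfun_norm|by apply: bmfunD; exact: bmfunZ|] => t.
  rewrite normrM -(real_normK (num_real (S M t))) -(real_normK (num_real (Rem M t))).
  move: `|S M t| `|Rem M t| => x y.
  rewrite -subr_ge0.
  have -> : al * x ^+ 2 + al^-1 * y ^+ 2 - 2 * (x * y) =
      al * (x - al^-1 * y) ^+ 2 by field; rewrite gt_eqF.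
  by rewrite mulr_ge0 ?sqr_ge0// ltW.
apply: (@le_trans _ _ (al * J + q * (M%:R * EE (fun t => Rem M t ^+ 2)))).
  have -> : al * J + q * (M%:R * EE (fun t => Rem M t ^+ 2)) =
    M%:R * (al * (J / M%:R) + al^-1 * EE (fun t => Rem M t ^+ 2) +
      EE (fun t => Rem M t ^+ 2)).
    by rewrite /q; field; rewrite !gt_eqF.
  by rewrite ler_pM2l// lerD2r.
have h1 : al * J <= e / 2.
  rewrite /al mulrAC ler_pdivrMr// ler_pM2l ?divr_gt0//.
  by rewrite lerDl.
have h2 : q * (M%:R * EE (fun t => Rem M t ^+ 2)) <= e / 2.
  rewrite -ler_pdivlMl// [leRHS]mulrC; apply: le_trans hM.
  by rewrite sub0r normrN; exact: ler_norm.
by rewrite [leRHS]splitr; exact: lerD.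
Unshelve. all: by end_near. Qed.

End MEstimation.

(** * Integrals over an interval and their parameter derivatives *)

Section BoundedContinuous.
Context (R : realType).
Implicit Types f g : R -> R.

(** Continuity is required on the whole line, so that the closure lemmas and the fundamental theorem
    of calculus apply without boundary cases. *)
Definition bcfun f := continuous f /\ exists C : R, forall x, `|f x| <= C.

Lemma bcfun_bmfun f : bcfun f -> bmfun f.
Proof. by move=> [cf [C fC]]; exact: bmfun_continuous fC. Qed.

Lemma bcfun_cst c : bcfun (fun=> c).
Proof. by split; [move=> x; exact: cvg_cst|exists `|c|]. Qed.

Lemma bcfunD f g : bcfun f -> bcfun g -> bcfun (fun x => f x + g x).
Proof.
move=> [cf [C fC]] [cg [K gK]]; split.
  by move=> x; apply: continuousD; [exact: cf|exact: cg].
by exists (C + K) => t; rewrite (le_trans (ler_normD _ _))// lerD.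
Qed.

Lemma bcfunM f g : bcfun f -> bcfun g -> bcfun (fun x => f x * g x).
Proof.
move=> [cf [C fC]] [cg [K gK]]; split.
  by move=> x; apply: continuousM; [exact: cf|exact: cg].
by exists (C * K) => t; rewrite normrM ler_pM.
Qed.

Lemma bcfunZ c f : bcfun f -> bcfun (fun t => c * f t).
Proof. by move=> bf; apply: bcfunM => //; exact: bcfun_cst. Qed.

Lemma bcfunN f : bcfun f -> bcfun (fun t => - f t).
Proof.
move=> [cf [C fC]]; split.
  by move=> x; apply: continuousN; exact: cf.
by exists C => t; rewrite normrN.
Qed.

Lemma bcfunB f g : bcfun f -> bcfun g -> bcfun (fun t => f t - g t).
Proof. by move=> bf bg; apply: bcfunD => //; exact: bcfunN. Qed.

Lemma bcfunX f n : bcfun f -> bcfun (fun t => f t ^+ n).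
Proof.
move=> bf; elim: n => [|n ih]; first exact: bcfun_cst.
by under eq_fun do rewrite exprS; exact: bcfunM.
Qed.

Lemma bcfunV f (c : R) : 0 < c -> (forall x, c <= f x) -> bcfun f ->
  bcfun (fun t => (f t)^-1).
Proof.
move=> c0 cf [f_ct _]; split.
  move=> x; apply: continuousV; last exact: f_ct.
  by rewrite gt_eqF// (lt_le_trans c0).
exists c^-1 => x; have f0 := lt_le_trans c0 (cf x).
rewrite gtr0_norm ?invr_gt0//.
by rewrite lef_pV2// posrE.
Qed.

Lemma bcfun_norm f : bcfun f -> bcfun (fun t => `|f t|).
Proof.
move=> [cf [C fC]]; split.
  by move=> x; apply: continuous_comp; [exact: cf|exact: norm_continuous].
by exists C => t; rewrite normr_id.
Qed.

Lemma bcfun_sqrt f : bcfun f -> bcfun (fun t => Num.sqrt (f t)).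
Proof.
move=> [cf [C fC]]; split.
  by move=> x; apply: continuous_comp; [exact: cf|exact: sqrt_continuous].
exists (Num.sqrt C) => t; rewrite ger0_norm ?sqrtr_ge0// ler_wsqrtr//.
exact: le_trans (ler_norm _) (fC t).
Qed.

End BoundedContinuous.

Lemma itv_integrable (R : realType) (l rt : R) (f : R -> R) : l < rt ->
  bcfun f -> (@lebesgue_measure R).-integrable [set` `[l, rt]] (EFin \o f).
Proof.
move=> lrt.
have Doo : (@lebesgue_measure R [set` `[l, rt]] < +oo)%E.
  by rewrite lebesgue_measure_itv/= lte_fin lrt -EFinB ltry.
move=> /bcfun_bmfun bf.
exact: (@bmfun_integrable _ (measurableTypeR R)).
Qed.

Section IntervalIntegral.
Context (R : realType).
Local Notation mu := (@lebesgue_measure R).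
Variables (l rt : R).
Hypothesis lrt : l < rt.
Local Notation I f := (Rintegral mu [set` `[l, rt]] f).
Implicit Types f g : R -> R.

Lemma itvintD f g : bcfun f -> bcfun g -> I (fun x => f x + g x) = I f + I g.
Proof. by move=> bf bg; rewrite RintegralD//; exact: itv_integrable. Qed.

Lemma itvintB f g : bcfun f -> bcfun g -> I (fun x => f x - g x) = I f - I g.
Proof. by move=> bf bg; rewrite RintegralB//; exact: itv_integrable. Qed.

Lemma itvintZ c f : bcfun f -> I (fun x => c * f x) = c * I f.
Proof. by move=> bf; rewrite RintegralZl//; exact: itv_integrable. Qed.

Lemma itvint_cst c : I (fun=> c) = c * (rt - l).
Proof.
have E : mu [set` `[l, rt]] = (rt - l)%:E.
  by rewrite lebesgue_measure_itv/= lte_fin lrt -EFinB.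
by rewrite (@Rintegral_cst _ (measurableTypeR R))// [X in fine X]E.
Qed.

Lemma itvint_le f g : bcfun f -> bcfun g ->
  (forall x, l <= x <= rt -> f x <= g x) -> I f <= I g.
Proof.
by move=> bf bg fg; apply: le_Rintegral => //; do ?exact: itv_integrable.
Qed.

Lemma itvint_ge0 f : (forall x, l <= x <= rt -> 0 <= f x) -> 0 <= I f.
Proof.
by move=> f0; apply: Rintegral_ge0 => x; rewrite /= in_itv/=; exact: f0.
Qed.

Lemma itvint_eq f g : (forall x, l <= x <= rt -> f x = g x) -> I f = I g.
Proof.
by move=> fg; apply: eq_Rintegral => x; rewrite inE/= in_itv/=; exact: fg.
Qed.

Lemma itvint_norm f : bcfun f -> `|I f| <= I (fun x => `|f x|).
Proof. by move=> bf; apply: le_normr_Rintegral => //; exact: itv_integrable. Qed.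

Lemma itvint_le_norm f g : bcfun f -> bcfun g ->
  (forall x, l <= x <= rt -> `|f x| <= g x) -> `|I f| <= I g.
Proof.
move=> bf bg fg; apply: (le_trans (itvint_norm bf)).
by apply: itvint_le => //; exact: bcfun_norm.
Qed.

Lemma itvint_ge_sub f (a b c : R) : bcfun f ->
  (forall x, l <= x <= rt -> 0 <= f x) -> l <= a -> a < b -> b <= rt ->
  (forall x, a <= x <= b -> c <= f x) -> c * (b - a) <= I f.
Proof.
move=> bf f0 la ab br cf.
have sub : `[a, b] `<=` `[l, rt].
  move=> x; rewrite /= !in_itv/= => /andP[ax xb].
  by rewrite (le_trans la ax) (le_trans xb br).
have iab : mu.-integrable [set` `[a, b]] (EFin \o f).
  exact: (itv_integrable ab bf).
have -> : c * (b - a) = \int[mu]_(x in [set` `[a, b]]) c.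
  have E : mu [set` `[a, b]] = (b - a)%:E.
    by rewrite lebesgue_measure_itv/= lte_fin ab -EFinB.
  by rewrite (@Rintegral_cst _ (measurableTypeR R))// [X in fine X]E.
apply: (@le_trans _ _ (\int[mu]_(x in [set` `[a, b]]) f x)).
  apply: le_Rintegral => //.
  exact: (itv_integrable ab (bcfun_cst c)).
rewrite /Rintegral fine_le//.
- exact: integrable_fin_num iab.
- exact: integrable_fin_num (itv_integrable lrt bf).
apply: ge0_subset_integral => //.
- apply/measurable_EFinP/measurable_funTS; exact: (bcfun_bmfun bf).1.
Qed.

Lemma itvint_ftc F f : (forall x : R, is_derive x 1 F (f x)) -> continuous f ->
  I f = F rt - F l.
Proof.
move=> dF cf; rewrite /Rintegral.
have cF := is_derive_continuous dF.
rewrite (@continuous_FTC2 _ f F l rt)//.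
- exact: continuous_subspaceT.
- split.
  + by move=> x _; have [] := dF x.
  + by apply: cvg_at_right_filter; exact: cF.
  + by apply: cvg_at_left_filter; exact: cF.
- by move=> x _; rewrite derive1E; exact: derive_val.
Qed.

End IntervalIntegral.

(** An error of order [h^2] for every [h] is more than a derivative needs, but it survives
    integration; this replaces dominated convergence. *)
Lemma is_derive_quadratic (R : realType) (f : R -> R) (a K x : R) :
  (forall h, `|f (x + h) - f x - a * h| <= K * h ^+ 2) -> is_derive x 1 f a.
Proof.
move=> fK.
have K0 : 0 <= K by have := fK 1; rewrite expr1n !mulr1 => /(le_trans (normr_ge0 _)).
have cv : h^-1 *: (f (h *: 1 + x) - f x) @[h --> 0^'] --> a.
  apply/cvgrPdist_le => e e0; near=> h.
  have h0 : h != 0 by near: h; exact: nbhs_dnbhs_neq.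
  have he : `|h| <= e / (K + 1).
    near: h; apply: dnbhs0_le; rewrite divr_gt0// ltr_wpDl//.
  have -> : a - h^-1 *: (f (h *: 1 + x) - f x) =
      - (h^-1 * (f (x + h) - f x - a * h)).
    by rewrite /GRing.scale/= mulr1 (addrC h x); field.
  rewrite normrN normrM normfV ler_pdivrMl ?normr_gt0//.
  apply: (le_trans (fK h)); rewrite -real_normK ?num_real// expr2 mulrCA.
  rewrite ler_wpM2l//; apply: (@le_trans _ _ ((K + 1) * `|h|)).
    by rewrite ler_wpM2r// lerDl.
  by rewrite -ler_pdivlMl ?ltr_wpDl// mulrC.
apply: DeriveDef; first by apply/cvg_ex; exists a.
exact: cvg_lim cv.
Unshelve. all: by end_near. Qed.

(** * Differentiation under the integral sign *)

Section BoundedLipschitz.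
Context (R : realType).
Implicit Types k : R -> R -> R.

(* Bounded, continuous in the sample, and Lipschitz in the parameter uniformly
   in the sample. *)
Definition blip k := (forall th, continuous (k th)) /\
  exists C : R, (forall th x, `|k th x| <= C) /\
    (forall th th' x, `|k th x - k th' x| <= C * `|th - th'|).

Lemma blip_bcfun k th : blip k -> bcfun (k th).
Proof. by move=> [ck [C [kC _]]]; split => //; exists C. Qed.

Lemma blip_cst c : blip (fun _ _ => c).
Proof.
split; first by move=> th x; exact: cvg_cst.
exists `|c|; split => // th th' x.
by rewrite subrr normr0 mulr_ge0.
Qed.

Lemma blipD k k' : blip k -> blip k' -> blip (fun th x => k th x + k' th x).
Proof.
move=> [ck [C [kC kL]]] [ck' [C' [kC' kL']]]; split.
  by move=> th x; apply: continuousD; [exact: ck|exact: ck'].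
exists (C + C'); split => [th x|th th' x].
  by rewrite (le_trans (ler_normD _ _))// lerD.
rewrite opprD addrACA mulrDl (le_trans (ler_normD _ _))//.
exact: lerD.
Qed.

Lemma blipM k k' : blip k -> blip k' -> blip (fun th x => k th x * k' th x).
Proof.
move=> [ck [C [kC kL]]] [ck' [C' [kC' kL']]]; split.
  by move=> th x; apply: continuousM; [exact: ck|exact: ck'].
have C0 : 0 <= C by exact: le_trans (kC 0 0).
have C'0 : 0 <= C' by exact: le_trans (kC' 0 0).
exists (C * C' + C * C'); split => [th x|th th' x].
  rewrite normrM; apply: (@le_trans _ _ (C * C')); first exact: ler_pM.
  by rewrite lerDl mulr_ge0.
have -> : k th x * k' th x - k th' x * k' th' x =
    (k th x - k th' x) * k' th x + k th' x * (k' th x - k' th' x) by ring.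
apply: (le_trans (ler_normD _ _)); rewrite [leRHS]mulrDl !normrM; apply: lerD.
  by rewrite mulrAC; exact: ler_pM.
by rewrite -mulrA; exact: ler_pM.
Qed.

Lemma blipZ c k : blip k -> blip (fun th x => c * k th x).
Proof. by move=> bk; apply: blipM => //; exact: blip_cst. Qed.

Lemma blipN k : blip k -> blip (fun th x => - k th x).
Proof.
by move=> bk; under eq_fun do under eq_fun do rewrite -mulN1r; exact: blipZ.
Qed.

Lemma blipB k k' : blip k -> blip k' -> blip (fun th x => k th x - k' th x).
Proof. by move=> bk bk'; apply: blipD => //; exact: blipN. Qed.

Lemma blipV k (c : R) : 0 < c -> (forall th x, c <= k th x) -> blip k ->
  blip (fun th x => (k th x)^-1).
Proof.
move=> c0 kc bk; have [ck [C [kC kL]]] := bk.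
have k0 th x : 0 < k th x by exact: lt_le_trans (kc th x).
have kV th x : `|(k th x)^-1| <= c^-1.
  by rewrite gtr0_norm ?invr_gt0// lef_pV2// posrE.
split; first by move=> th; have [] := bcfunV c0 (kc th) (blip_bcfun th bk).
have C0 : 0 <= C by exact: le_trans (kC 0 0).
have cV0 : 0 <= c^-1 by rewrite invr_ge0 ltW.
exists (c^-1 + c^-1 * c^-1 * C); split => [th x|th th' x].
  by rewrite (le_trans (kV th x))// lerDl !mulr_ge0.
have -> : (k th x)^-1 - (k th' x)^-1 =
    - ((k th x)^-1 * (k th' x)^-1 * (k th x - k th' x)).
  by field; rewrite !gt_eqF.
rewrite normrN !normrM; apply: (@le_trans _ _ (c^-1 * c^-1 * (C * `|th - th'|))).
  by apply: ler_pM => //; exact: ler_pM.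
by rewrite mulrA ler_wpM2r// lerDr.
Qed.

Lemma blip_derive k k1 (C C1 : R) :
  (forall x (th : R), is_derive th 1 (k^~ x) (k1 th x)) ->
  (forall th, continuous (k th)) -> (forall th x, `|k th x| <= C) ->
  (forall th x, `|k1 th x| <= C1) -> blip k.
Proof.
move=> dk ck kC kC1; split => //; exists (C + C1).
have C0 : 0 <= C by exact: le_trans (kC 0 0).
have C10 : 0 <= C1 by exact: le_trans (kC1 0 0).
split => [th x|th th' x]; first by rewrite (le_trans (kC th x))// lerDl.
have := @lipschitz_of_derive _ (k^~ x) (k1^~ x) C1 th th' (dk x) (kC1^~ x).
by move=> /le_trans; apply; rewrite ler_wpM2r// lerDr.
Qed.

Local Notation mu := (@lebesgue_measure R).
Variables (l rt : R).
Hypothesis lrt : l < rt.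
Local Notation I f := (Rintegral mu [set` `[l, rt]] f).

Lemma blip_itvint k : blip k -> blip (fun th _ => I (k th)).
Proof.
move=> bk; have [_ [C [kC kL]]] := bk.
have bkt th := blip_bcfun th bk.
split; first by move=> th x; exact: cvg_cst.
have w0 : 0 <= rt - l by rewrite subr_ge0 ltW.
exists (C * (rt - l)); split => [th _|th th' _].
  rewrite -(itvint_cst lrt); apply: itvint_le_norm => //; exact: bcfun_cst.
rewrite -(itvintB lrt)// mulrAC -(itvint_cst lrt); apply: itvint_le_norm => //.
- exact: bcfunB.
- exact: bcfun_cst.
Qed.

(** The mean value theorem at each [x] writes the first-order error as [(k1 xi x - k1 th x) * h], at
    most [C * h^2] by the Lipschitz bound uniform in [x]. How [xi] depends on [x] is irrelevant,
    since only the bound is integrated. *)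
Lemma derive_itvint k k1 (th : R) : blip k -> blip k1 ->
  (forall x (th : R), is_derive th 1 (k^~ x) (k1 th x)) ->
  is_derive th 1 (fun th => I (k th)) (I (k1 th)).
Proof.
move=> bk bk1 dk; have [_ [C [_ kL]]] := bk1.
have bkt th := blip_bcfun th bk.
have bk1t := blip_bcfun th bk1.
have C0 : 0 <= C.
  by have := kL 1 0 0; rewrite subr0 normr1 mulr1 => /(le_trans (normr_ge0 _)).
apply: (@is_derive_quadratic _ _ _ (C * (rt - l))) => h.
rewrite [X in _ - X]mulrC -(itvintZ lrt)// -(itvintB lrt)// -(itvintB lrt)//; last 2 first.
- exact: bcfunB.
- exact: bcfunZ.
rewrite mulrAC -(itvint_cst lrt); apply: itvint_le_norm => //.
- by apply: bcfunB; [exact: bcfunB|exact: bcfunZ].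
- exact: bcfun_cst.
move=> x _.
have [xi [xi1 _ ->]] := mean_value th (th + h) (dk x).
have hE : th + h - th = h by rewrite addrC addKr.
rewrite hE in xi1 *.
rewrite (mulrC h) -mulrBl normrM.
apply: (@le_trans _ _ (C * `|xi - th| * `|h|)).
  by rewrite ler_wpM2r.
by rewrite -mulrA -[h ^+ 2]real_normK ?num_real// expr2 ler_wpM2l// ler_wpM2r.
Qed.

End BoundedLipschitz.

(** * The Gaussian kernel *)

Section DerivationRules.
Context (R : realType).
Implicit Types (f g : R -> R) (x a b : R).

Lemma der_add f g x a b : is_derive x 1 f a -> is_derive x 1 g b ->
  is_derive x 1 (fun y => f y + g y) (a + b).
Proof. exact: is_deriveD. Qed.

Lemma der_sub f g x a b : is_derive x 1 f a -> is_derive x 1 g b ->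
  is_derive x 1 (fun y => f y - g y) (a - b).
Proof. exact: is_deriveB. Qed.

Lemma der_mul f g x a b : is_derive x 1 f a -> is_derive x 1 g b ->
  is_derive x 1 (fun y => f y * g y) (a * g x + f x * b).
Proof.
move=> fa gb; apply: (is_derive_eq (is_deriveM fa gb)).
by rewrite addrC /GRing.scale/= mulrC.
Qed.

Lemma der_div f g x a b : g x != 0 ->
  is_derive x 1 f a -> is_derive x 1 g b ->
  is_derive x 1 (fun y => f y / g y) (a / g x - f x / g x * (b / g x)).
Proof.
move=> gx fa gb; apply: (is_derive_eq (der_mul fa (is_deriveV gx gb))).
by rewrite /GRing.scale/=; field.
Qed.

Lemma der_ln f x a : 0 < f x -> is_derive x 1 f a ->
  is_derive x 1 (fun y => ln (f y)) (a / f x).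
Proof.
move=> fx fa; apply: (is_derive_eq (is_derive1_comp (is_derive1_ln fx) fa)).
by rewrite mulrC.
Qed.

Lemma der_expR f x a : is_derive x 1 f a ->
  is_derive x 1 (fun y => expR (f y)) (a * expR (f x)).
Proof.
move=> fa; apply: (is_derive_eq (is_derive1_comp (is_derive_expR _) fa)).
by rewrite mulrC.
Qed.

Lemma der_sqr_sub c x (u : R) :
  is_derive x 1 (fun y => c * (u - y) ^+ 2) (- (2 * c * (u - x))).
Proof.
apply: (@is_derive_quadratic _ _ _ `|c|) => h.
have -> : c * (u - (x + h)) ^+ 2 - c * (u - x) ^+ 2 - - (2 * c * (u - x)) * h =
  c * h ^+ 2 by ring.
by rewrite normrM [X in _ * X]ger0_norm// sqr_ge0.
Qed.

Lemma der_sub_id (u x : R) : is_derive x 1 (fun y => u - y) (-1).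
Proof.
apply: (@is_derive_quadratic _ _ _ 0) => h.
by rewrite mul0r (_ : _ - _ = 0) ?normr0//; ring.
Qed.

(* With x = sin (pi / 6), the triple angle formula reads
   (x + 1) (2 x - 1)^2 = 0, so x = 1 / 2, and x <= pi / 6. *)
Lemma pi_ge3 : 3 <= pi :> R.
Proof.
pose a : R := pi / 6; pose x := sin a.
have a0 : 0 < a by rewrite divr_gt0// pi_gt0.
have x0 : 0 < x.
  by apply: sin_gt0_pi; rewrite a0/= /a; have := pi_gt0 R; lra.
have E : sin (a + a + a) = 1.
  have -> : a + a + a = pi / 2 by rewrite /a; field.
  exact: sin_pihalf.
have E3 : 3 * x - 4 * x ^+ 3 = 1.
  rewrite -[RHS]E !sinD !cosD -/x; have := cos2Dsin2 a; rewrite -/x.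
  set c := cos a => cx; have h : c ^+ 2 = 1 - x ^+ 2 by rewrite -cx; ring.
  have -> : (x * c + c * x) * c + (c * c - x * x) * x = 3 * x * c ^+ 2 - x ^+ 3.
    by ring.
  by rewrite h; ring.
have xh : x = 1 / 2.
  have : (x + 1) * (2 * x - 1) ^+ 2 = 0.
    have -> : (x + 1) * (2 * x - 1) ^+ 2 = 4 * x ^+ 3 - 3 * x + 1 by ring.
    by lra.
  move/eqP; rewrite mulf_eq0 => /orP[/eqP|]; first lra.
  by rewrite expf_eq0/= => /eqP; lra.
have : x <= a.
  have [xi [_ _]] := @mean_value R sin cos 0 a (@is_derive_sin R).
  rewrite sin0 !subr0 -/x => ->; rewrite ger_pMl//; exact: cos_le1.
rewrite xh /a; lra.
Qed.

End DerivationRules.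

Section Gaussian.
Context (R : realType).
Variable s : R.
Hypothesis s0 : 0 < s.
Local Notation pk := (normal_peak s).

Let sn : s != 0. Proof. by rewrite gt_eqF. Qed.

Lemma peak_gt0 : 0 < pk. Proof. exact: normal_peak_gt0. Qed.

(** Peak times width is the universal constant [1 / sqrt (2 pi)], about 0.399; the bounds 1/3 and
    0.41 that follow come from [3 <= pi < 4]. *)
Lemma peak_sqr : (pk * s) ^+ 2 = (2 * pi)^-1.
Proof.
rewrite exprMn /normal_peak exprVn sqr_sqrtr; last first.
  by rewrite mulrn_wge0// mulr_ge0 ?sqr_ge0// pi_ge0.
have pn : pi != 0 :> R by rewrite gt_eqF// pi_gt0.
by move: (@pi R) pn => y pn; field; rewrite pn sn.
Qed.

Lemma peak_sqr_le : (pk * s) ^+ 2 <= 1 / 6.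
Proof.
rewrite peak_sqr div1r lef_pV2 ?posrE// ?mulr_gt0 ?pi_gt0//.
by have := pi_ge3 R; lra.
Qed.

Lemma peak_le : pk * s <= 41 / 100.
Proof.
rewrite -(@ler_pXn2r _ 2)// ?nnegrE//.
  by apply: (le_trans peak_sqr_le); lra.
by rewrite mulr_ge0// ltW// peak_gt0.
Qed.

Lemma peak_ge : 1 / 3 <= pk * s.
Proof.
rewrite -(@ler_pXn2r _ 2)// ?nnegrE//; last first.
  by rewrite mulr_ge0// ltW// peak_gt0.
rewrite peak_sqr expr_div_n expr1n div1r lef_pV2 ?posrE//; last first.
  by rewrite mulr_gt0// pi_gt0.
by have := pihalf_lt2 R; lra.
Qed.

Lemma gaussE y : gauss s y = pk * expR (- (y / s) ^+ 2 / 2).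
Proof.
rewrite /gauss normal_pdfE// /normal_fun subr0; congr (_ * expR _).
by rewrite -mulr_natr; field.
Qed.

Lemma gauss_gt0 y : 0 < gauss s y.
Proof. by rewrite gaussE mulr_gt0 ?peak_gt0// expR_gt0. Qed.

Lemma gaussN y : gauss s (- y) = gauss s y.
Proof. by rewrite !gaussE (mulNr y) sqrrN. Qed.

Lemma gauss_le_peak y : gauss s y <= pk.
Proof. by rewrite /gauss normal_pdf_ub. Qed.

(** [gk1], [gk2] and [gk3] are the successive derivatives of [gauss s (x - th)] in [th]; the third
    supplies the Lipschitz bound of the second. *)
Definition gk1 (th x : R) := (x - th) / s ^+ 2 * gauss s (x - th).

Definition gk2 (th x : R) :=
  ((x - th) ^+ 2 / s ^+ 4 - (s ^+ 2)^-1) * gauss s (x - th).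

Let gk3 (th x : R) :=
  ((x - th) ^+ 3 / s ^+ 6 - 3 * (x - th) / s ^+ 4) * gauss s (x - th).

Let gaussE_th x : (fun th : R => gauss s (x - th)) =
  (fun th => pk * expR (- (2 * s ^+ 2)^-1 * (x - th) ^+ 2)).
Proof.
apply/funext => th; rewrite gaussE; congr (_ * expR _); by field.
Qed.

Lemma der_gauss (x th : R) : is_derive th 1 (fun th => gauss s (x - th)) (gk1 th x).
Proof.
rewrite gaussE_th.
apply: (is_derive_eq (der_mul (is_derive_cst pk th 1)
  (der_expR (der_sqr_sub (- (2 * s ^+ 2)^-1) th x)))).
rewrite mul0r add0r /gk1 [gauss s (x - th)](congr1 (@^~ th) (gaussE_th x)) /cst.
by set E := expR _; field.
Qed.

Lemma der_gk1 (x th : R) : is_derive th 1 (gk1^~ x) (gk2 th x).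
Proof.
have d1 : is_derive th 1 (fun th => (x - th) / s ^+ 2) (- (s ^+ 2)^-1).
  apply: (is_derive_eq (der_mul (der_sub_id x th) (is_derive_cst (s ^+ 2)^-1 th 1))).
  by rewrite mulr0 addr0 mulN1r.
apply: (is_derive_eq (der_mul d1 (der_gauss x th))).
by rewrite /gk1 /gk2; field.
Qed.

Let der_gk2 (x th : R) : is_derive th 1 (gk2^~ x) (gk3 th x).
Proof.
have d1 : is_derive th 1 (fun th => (x - th) ^+ 2 / s ^+ 4 - (s ^+ 2)^-1)
    (- (2 * (s ^+ 4)^-1 * (x - th))).
  have -> : (fun th => (x - th) ^+ 2 / s ^+ 4 - (s ^+ 2)^-1) =
     (fun th => (s ^+ 4)^-1 * (x - th) ^+ 2 - (s ^+ 2)^-1).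
    by apply/funext => y; rewrite mulrC.
  apply: (is_derive_eq (der_sub (der_sqr_sub (s ^+ 4)^-1 th x)
    (is_derive_cst (s ^+ 2)^-1 th 1))).
  by rewrite subr0.
apply: (is_derive_eq (der_mul d1 (der_gauss x th))).
by rewrite /gk1 /gk3; field.
Qed.

Lemma quartic_gauss_le (v : R) : v ^+ 4 * expR (- v ^+ 2 / 2) <= 16.
Proof.
have h : 0 <= v ^+ 2 / 2 by rewrite divr_ge0// sqr_ge0.
have := expR_sqr_le h.
rewrite mulNr expRN [_ <= 16]ler_pdivrMr ?expR_gt0//.
set E := expR _; have -> : (v ^+ 2 / 2) ^+ 2 / 4 = v ^+ 4 / 16 by field.
lra.
Qed.

Lemma continuous_gauss : continuous (gauss s).
Proof. exact: continuous_normal_pdf. Qed.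

Let c_lin th : continuous (fun x : R => x - th).
Proof. by move=> x; apply: continuousB; [exact: cvg_id|exact: cvg_cst]. Qed.

Let c_gauss th : continuous (fun x => gauss s (x - th)).
Proof.
move=> x; apply: (@continuous_comp _ _ _ (fun x => x - th)); first exact: c_lin.
exact: continuous_gauss.
Qed.

Let abs_bound (v : R) (n : nat) : (n <= 4)%N -> `|v| ^+ n <= 1 + v ^+ 4.
Proof.
move=> n4; have [v1|v1] := leP `|v| 1.
  apply: (@le_trans _ _ 1); first exact: exprn_ile1.
  by rewrite lerDl exprn_even_ge0.
apply: (@le_trans _ _ (`|v| ^+ 4)); first by rewrite ler_weXn2l// ltW.
by rewrite -normrX ger0_norm ?exprn_even_ge0// lerDr.
Qed.

(** The derivatives in [th] are combinations of such terms. [|v|^n <= 1 + v^4], and the two parts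
    contribute 1 and 16. *)
Lemma gauss_moment_bound n th x : (n <= 4)%N ->
  `|((x - th) / s) ^+ n * gauss s (x - th)| <= 17 * pk.
Proof.
move=> n4; rewrite normrM normrX (gtr0_norm (gauss_gt0 _)).
apply: (@le_trans _ _ ((1 + ((x - th) / s) ^+ 4) * gauss s (x - th))).
  by rewrite ler_wpM2r ?abs_bound// ltW// gauss_gt0.
rewrite gaussE; set v := (x - th) / s.
have h1 := quartic_gauss_le v.
have h2 : expR (- v ^+ 2 / 2) <= 1.
  by rewrite -[leRHS]expR0 ler_expR mulNr oppr_le0 divr_ge0// sqr_ge0.
have p0 := peak_gt0.
rewrite mulrCA [leRHS]mulrC ler_pM2l// mulrDl mul1r.
have -> : 17 = 1 + 16 :> R by ring.
exact: lerD.
Qed.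

Let c_pow n th : continuous (fun x : R => (x - th) ^+ n).
Proof.
elim: n => [|n ih] x; first exact: cvg_cst.
under eq_fun do rewrite exprS.
by apply: cvgM; [exact: c_lin|exact: ih].
Qed.

Lemma blip_gauss : blip (fun th x => gauss s (x - th)).
Proof.
apply: (blip_derive der_gauss (C := pk) (C1 := 17 * pk / s)) => //.
  by move=> th x; rewrite ger0_norm ?gauss_le_peak// ltW// gauss_gt0.
move=> th x; have -> : gk1 th x = ((x - th) / s) ^+ 1 * gauss s (x - th) / s.
  by rewrite /gk1; field.
by rewrite normrM (gtr0_norm (x := s^-1)) ?invr_gt0// ler_pM2r ?invr_gt0// gauss_moment_bound.
Qed.

Lemma blip_gk1 : blip gk1.
Proof.
have g1E th x : gk1 th x = ((x - th) / s) ^+ 1 * gauss s (x - th) / s.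
  by rewrite /gk1; field.
have g2E th x : gk2 th x = (((x - th) / s) ^+ 2 * gauss s (x - th)
    - ((x - th) / s) ^+ 0 * gauss s (x - th)) / s ^+ 2.
  by rewrite /gk2; field.
apply: (blip_derive der_gk1 (C := 17 * pk / s) (C1 := (17 * pk + 17 * pk) / s ^+ 2)) => //.
- move=> th; rewrite /gk1 => x; apply: cvgM; last exact: c_gauss.
  by apply: cvgM; [exact: c_lin|exact: cvg_cst].
- move=> th x; rewrite g1E normrM (gtr0_norm (x := s^-1)) ?invr_gt0//.
  by rewrite ler_pM2r ?invr_gt0// gauss_moment_bound.
- move=> th x; have s2 : 0 < (s ^+ 2)^-1 by rewrite invr_gt0 exprn_gt0.
  rewrite g2E normrM (gtr0_norm s2) ler_pM2r//.
  by rewrite (le_trans (ler_normB _ _))// lerD// gauss_moment_bound.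
Qed.

Lemma blip_gk2 : blip gk2.
Proof.
have g3E th x : gk3 th x = (((x - th) / s) ^+ 3 * gauss s (x - th)
    - 3 * (((x - th) / s) ^+ 1 * gauss s (x - th))) / s ^+ 3.
  by rewrite /gk3; field.
have g2E th x : gk2 th x = (((x - th) / s) ^+ 2 * gauss s (x - th)
    - ((x - th) / s) ^+ 0 * gauss s (x - th)) / s ^+ 2.
  by rewrite /gk2; field.
apply: (blip_derive der_gk2 (C := (17 * pk + 17 * pk) / s ^+ 2)
  (C1 := (17 * pk + 3 * (17 * pk)) / s ^+ 3)) => //.
- move=> th; rewrite /gk2 => x; apply: cvgM; last exact: c_gauss.
  apply: cvgB; last exact: cvg_cst.
  by apply: cvgM; [exact: c_pow|exact: cvg_cst].
- move=> th x; have s2 : 0 < (s ^+ 2)^-1 by rewrite invr_gt0 exprn_gt0.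
  rewrite g2E normrM (gtr0_norm s2) ler_pM2r//.
  by rewrite (le_trans (ler_normB _ _))// lerD// gauss_moment_bound.
- move=> th x; have s2 : 0 < (s ^+ 3)^-1 by rewrite invr_gt0 exprn_gt0.
  rewrite g3E normrM (gtr0_norm s2) ler_pM2r//.
  rewrite (le_trans (ler_normB _ _))// lerD ?gauss_moment_bound//.
  by rewrite normrM ger0_norm// ler_pM2l// gauss_moment_bound.
Qed.

End Gaussian.

(** * Gaussian mass of an interval and a dominating envelope *)

Section GaussianMass.
Context (R : realType).
Local Notation mu := (@lebesgue_measure R).
Variable s : R.
Hypothesis s0 : 0 < s.
Local Notation pk := (normal_peak s).

Let sn : s != 0. Proof. by rewrite gt_eqF. Qed.

Lemma gauss_pdf th x : gauss s (x - th) = normal_pdf th s x.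
Proof. by rewrite /gauss !normal_pdfE// /normal_fun subr0. Qed.

Lemma itvint_pdf_le1 (l rt m t : R) : l < rt -> t != 0 ->
  Rintegral mu [set` `[l, rt]] (normal_pdf m t) <= 1.
Proof.
move=> lrt t0.
have bp : bcfun (normal_pdf m t).
  split; first exact: continuous_normal_pdf.
  exists (normal_peak t) => x; rewrite ger0_norm ?normal_pdf_ge0//.
  exact: normal_pdf_ub.
rewrite -lee_fin /Rintegral fineK; last exact: integrable_fin_num (itv_integrable lrt bp).
rewrite -(integral_normal_pdf m t); apply: ge0_subset_integral => //.
- by apply/measurable_EFinP; exact: measurable_normal_pdf.
- by move=> x _; rewrite lee_fin normal_pdf_ge0.
Qed.

Lemma cvg_gauss_pinfty th : gauss s (x - th) @[x --> +oo] --> 0.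
Proof.
apply/cvgrPdist_le => e e0.
have K0 : 0 < 17 * pk * s by rewrite !mulr_gt0// peak_gt0.
near=> x.
have hx : th + 17 * pk * s / e + 1 <= x by near: x; apply: nbhs_pinfty_ge; exact: num_real.
have Ke : 0 < 17 * pk * s / e by rewrite divr_gt0.
have v0 : 0 < x - th by lra.
rewrite sub0r normrN gtr0_norm ?gauss_gt0//.
have := @gauss_moment_bound _ s s0 1 th x isT; rewrite expr1.
rewrite gtr0_norm ?mulr_gt0 ?invr_gt0 ?gauss_gt0// => h.
have h2 : (x - th) * gauss s (x - th) <= 17 * pk * s.
  rewrite -ler_pdivrMr//; apply: le_trans h.
  by rewrite mulrAC.
have h3 : 17 * pk * s <= e * (x - th).
  rewrite -ler_pdivrMl// mulrC; lra.
rewrite -(ler_pM2l v0); apply: (le_trans h2).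
by rewrite [leRHS]mulrC.
Unshelve. all: by end_near. Qed.

Let continuous_gk1 th : continuous (gk1 s th).
Proof. by have [] := blip_bcfun th (blip_gk1 s0). Qed.

Lemma der_gauss_x th (x : R) :
  is_derive x 1 (fun x => gauss s (x - th)) (- gk1 s th x).
Proof.
have -> : (fun x => gauss s (x - th)) = (fun x => gauss s (th - x)).
  by apply/funext => y; rewrite -gaussN// opprB.
apply: (is_derive_eq (der_gauss s0 th x)).
by rewrite /gk1 -gaussN// opprB -mulNr -mulNr opprB.
Qed.

(** Mills ratio bound: beyond [a] the factor [(x - th) / a] is at least 1, and with it the Gaussian
    has an elementary primitive. *)
Let right_tail (th a : R) : 0 < a ->
  (\int[mu]_(x in `[(th + a)%R, +oo[) (normal_pdf th s x)%:E <=
   (s ^+ 2 / a * gauss s a)%:E)%E.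
Proof.
move=> a0.
have c0 : 0 < s ^+ 2 / a by rewrite divr_gt0// exprn_gt0.
pose F x := - (s ^+ 2 / a * gauss s (x - th)).
pose f x := s ^+ 2 / a * gk1 s th x.
have dF (x : R) : is_derive x 1 F (f x).
  have -> : F = (fun x => (fun=> - (s ^+ 2 / a)) x * gauss s (x - th)).
    by apply/funext => y; rewrite /F mulNr.
  apply: (is_derive_eq (der_mul (is_derive_cst (- (s ^+ 2 / a)) x 1) (der_gauss_x th x))).
  by rewrite mul0r add0r mulrNN.
have cf : continuous f.
  by have [] := bcfunZ (s ^+ 2 / a) (blip_bcfun th (blip_gk1 s0)).
have cF := is_derive_continuous dF.
have f0 x : th + a <= x -> 0 <= f x.
  move=> ax; rewrite mulr_ge0 ?(ltW c0)// mulr_ge0 ?(ltW (gauss_gt0 _ _))//.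
  by rewrite divr_ge0 ?sqr_ge0//; lra.
have -> : (s ^+ 2 / a * gauss s a)%:E = (0%:E - (F (th + a))%:E)%E.
  by rewrite -EFinB sub0r /F opprK addrC addKr.
rewrite -(@ge0_continuous_FTC2y _ f F)//.
- apply: ge0_le_integral => //.
  + by move=> x _; rewrite lee_fin normal_pdf_ge0.
  + by apply/measurable_EFinP/measurable_funTS; exact: measurable_normal_pdf.
  + by apply/measurable_EFinP/measurable_funTS; exact: continuous_measurable_fun.
  + move=> x; rewrite /= in_itv/= andbT => ax.
    rewrite lee_fin -gauss_pdf /f /gk1 mulrA.
    have -> : s ^+ 2 / a * ((x - th) / s ^+ 2) = (x - th) / a.
      by field; rewrite sn gt_eqF.
    by rewrite ler_peMl ?(ltW (gauss_gt0 _ _))// ler_pdivlMr// mul1r; lra.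
- exact: continuous_subspaceT.
- rewrite -oppr0; apply: cvgN; rewrite -(mulr0 (s ^+ 2 / a)).
  by apply: cvgMr; exact: cvg_gauss_pinfty.
- by apply: cvg_at_right_filter; exact: cF.
- by move=> x _; rewrite derive1E; exact: derive_val.
Qed.

Let left_tail (th a : R) : 0 < a ->
  (\int[mu]_(x in `]-oo, (th - a)%R]) (normal_pdf th s x)%:E <=
   (s ^+ 2 / a * gauss s a)%:E)%E.
Proof.
move=> a0.
have -> : th - a = - (- th + a) by ring.
rewrite ge0_integration_by_substitutionNy.
- apply: le_trans (right_tail (- th) a0).
  rewrite le_eqVlt; apply/orP; left; apply/eqP; apply: eq_integral => x _ /=.
  congr EFin; rewrite -!gauss_pdf -gaussN//; congr gauss; ring.
- by apply: continuous_subspaceT; exact: continuous_normal_pdf.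
- by move=> x _; exact: normal_pdf_ge0.
Qed.

Lemma gauss_mass_ge (l rt th : R) : l < th -> th < rt ->
  1 - s ^+ 2 / (th - l) * gauss s (th - l) - s ^+ 2 / (rt - th) * gauss s (rt - th)
  <= Rintegral mu [set` `[l, rt]] (fun x => gauss s (x - th)).
Proof.
move=> lth thr; have lrt := lt_trans lth thr.
have bp := blip_bcfun th (blip_gauss s0).
rewrite !lerBlDr -lee_fin !EFinD.
have -> : (Rintegral mu [set` `[l, rt]] (fun x => gauss s (x - th)))%:E =
    (\int[mu]_(x in `[l, rt]) (normal_pdf th s x)%:E)%E.
  rewrite /Rintegral fineK; last exact: integrable_fin_num (itv_integrable lrt bp).
  by under eq_integral do rewrite gauss_pdf.
have mp A : measurable_fun A (fun x => (normal_pdf th s x)%:E).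
  by apply/measurable_EFinP/measurable_funTS; exact: measurable_normal_pdf.
have p0 x : (0 <= (normal_pdf th s x)%:E)%E by rewrite lee_fin normal_pdf_ge0.
rewrite -(integral_normal_pdf th s).
have -> : [set: R] = `]-oo, l[ `|` (`[l, rt] `|` `]rt, +oo[).
  apply/seteqP; split => // x _ /=; rewrite !in_itv/= andbT.
  by have [xl|lx] := ltP x l; [left|right; have [xr|xr] := leP x rt; [left|right]].
have dj1 : [disjoint `]-oo, l[ & `[l, rt] `|` `]rt, +oo[].
  apply/disj_setPS => x [/=]; rewrite !in_itv/= andbT => xl.
  by move=> [/andP[lx _]|rx]; lra.
have dj2 : [disjoint `[l, rt] & `]rt, +oo[].
  apply/disj_setPS => x [/=]; rewrite !in_itv/= andbT => /andP[_ xr] rx; lra.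
have m2 : measurable (`[l, rt] `|` `]rt, +oo[) by exact: measurableU.
rewrite (@ge0_integral_setU _ (measurableTypeR R) R mu _ _ (measurable_itv _) m2
  _ (mp _) (fun x _ => p0 x) dj1).
rewrite (@ge0_integral_setU _ (measurableTypeR R) R mu _ _ (measurable_itv _)
  (measurable_itv _) _ (mp _) (fun x _ => p0 x) dj2).
have H1 : (\int[mu]_(x in `]-oo, l[) (normal_pdf th s x)%:E <=
    (s ^+ 2 / (th - l) * gauss s (th - l))%:E)%E.
  apply: (@le_trans _ _ (\int[mu]_(x in `]-oo, l]) (normal_pdf th s x)%:E)%E).
    apply: ge0_subset_integral => //; first exact: mp.
    by move=> x; rewrite /= !in_itv/=; exact: ltW.
  have := @left_tail th (th - l); rewrite subr_gt0 => /(_ lth).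
  by have -> : th - (th - l) = l by ring.
have H2 : (\int[mu]_(x in `]rt, +oo[) (normal_pdf th s x)%:E <=
    (s ^+ 2 / (rt - th) * gauss s (rt - th))%:E)%E.
  apply: (@le_trans _ _ (\int[mu]_(x in `[rt, +oo[) (normal_pdf th s x)%:E)%E).
    apply: ge0_subset_integral => //; first exact: mp.
    by move=> x; rewrite /= !in_itv/= !andbT; exact: ltW.
  have := @right_tail th (rt - th); rewrite subr_gt0 => /(_ thr).
  by have -> : th + (rt - th) = rt by ring.
apply: (le_trans (leeD H1 (leeD (lexx _) H2))).
by move: (integral _ _ _) => i; rewrite [leLHS]addeC.
Qed.

(** Twice the normal density of width [2 * s], hence of integral at most 2. It dominates, up to
    constants, the Gaussian with a quadratic weight, and also its change under a small shift. *)
Definition envelope (th x : R) := pk * expR (- ((x - th) / s) ^+ 2 / 8).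

Lemma envelopeE th x : envelope th x = 2 * normal_pdf th (2 * s) x.
Proof.
have s2 : 2 * s != 0 by rewrite mulf_neq0.
rewrite normal_pdfE// /normal_fun mulrA; congr (_ * expR _).
  have -> : normal_peak (2 * s) = normal_peak s / 2.
    rewrite /normal_peak.
    have -> : (2 * s) ^+ 2 * pi *+ 2 = 2 ^+ 2 * (s ^+ 2 * pi *+ 2).
      by move: (@pi R) => y; ring.
    by rewrite sqrtrM ?sqr_ge0// sqrtr_sqr ger0_norm// invfM mulrC.
  by rewrite mulrC divfK.
by field.
Qed.

Lemma bcfun_envelope th : bcfun (envelope th).
Proof.
have s2 : 2 * s != 0 by rewrite mulf_neq0.
have -> : envelope th = (fun x => 2 * normal_pdf th (2 * s) x).
  by apply/funext => x; exact: envelopeE.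
apply: bcfunZ; split; first exact: continuous_normal_pdf.
exists (normal_peak (2 * s)) => x; rewrite ger0_norm ?normal_pdf_ge0//.
exact: normal_pdf_ub.
Qed.

Lemma envelope_ge0 th x : 0 <= envelope th x.
Proof. by rewrite mulr_ge0 ?expR_ge0// ltW// peak_gt0. Qed.

Lemma itvint_envelope_le (l rt th : R) : l < rt ->
  Rintegral mu [set` `[l, rt]] (envelope th) <= 2.
Proof.
move=> lrt; have s2 : 2 * s != 0 by rewrite mulf_neq0.
rewrite (itvint_eq (g := fun x => 2 * normal_pdf th (2 * s) x)); last first.
  by move=> x _; exact: envelopeE.
rewrite (itvintZ lrt); last first.
  split; first exact: continuous_normal_pdf.
  exists (normal_peak (2 * s)) => x; rewrite ger0_norm ?normal_pdf_ge0//.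
  exact: normal_pdf_ub.
by rewrite -[leRHS]mulr1 ler_pM2l// itvint_pdf_le1.
Qed.

End GaussianMass.

(** * Numerical estimates for exponentials *)

Section ExponentialBounds.
Context (R : realType).
Implicit Types u v t x y z : R.

Lemma expR_ge_pow x n : 0 <= x -> (1 + x / n.+1%:R) ^+ n.+1 <= expR x.
Proof.
move=> x0; have -> : expR x = expR (x / n.+1%:R) ^+ n.+1.
  by rewrite -expRM_natl mulrC divfK// pnatr_eq0.
by rewrite lerXn2r ?nnegrE ?expR_ge0 ?expR_ge1Dx// addr_ge0// divr_ge0.
Qed.

Lemma expRN_le1 z : 0 <= z -> expR (- z) <= 1.
Proof. by move=> z0; rewrite -[leRHS]expR0 ler_expR oppr_le0. Qed.

Lemma mul_expRN_le1 z : z * expR (- z) <= 1.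
Proof.
rewrite expRN ler_pdivrMr ?expR_gt0// mul1r.
by apply: le_trans (expR_ge1Dx z); rewrite lerDr.
Qed.

Lemma sqr_mul_expRN_le4 z : 0 <= z -> z ^+ 2 * expR (- z) <= 4.
Proof.
move=> z0; rewrite expRN ler_pdivrMr ?expR_gt0// mulrC -ler_pdivrMr//.
exact: expR_sqr_le.
Qed.

Lemma expRN_dist_le (a c m : R) : m <= a -> m <= c ->
  `|expR (- a) - expR (- c)| <= `|a - c| * expR (- m).
Proof.
wlog ac : a c / a <= c => [H ma mc|ma _].
  have [|/ltW ca] := leP a c; first by move=> ?; exact: H.
  by rewrite distrC (distrC a); exact: H.
have h1 : expR (- c) <= expR (- a) by rewrite ler_expR lerN2.
have h2 : expR (- a) <= expR (- m) by rewrite ler_expR lerN2.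
have -> : `|a - c| = c - a by rewrite distrC ger0_norm// subr_ge0.
rewrite ger0_norm ?subr_ge0//.
have -> : expR (- c) = expR (- a) * expR (- (c - a)).
  by rewrite -expRD; congr expR; ring.
apply: (@le_trans _ _ (expR (- a) * (c - a))).
  rewrite -[X in X - _]mulr1 -mulrBr ler_pM2l ?expR_gt0//.
  by have := expR_ge1Dx (- (c - a)); lra.
by rewrite mulrC ler_wpM2l// subr_ge0.
Qed.

(** Both exponents are at least [v^2 / 4 - 1/2]. Of the resulting decay, one factor
    [expR (- v^2 / 8)] is kept as the envelope and the other absorbs [(1 + v^2)^2]. *)
Lemma gauss_shift_le v t : `|t| <= 1 ->
  `|expR (- (v + t) ^+ 2 / 2) - expR (- v ^+ 2 / 2)| * (1 + v ^+ 2)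
    <= 600 * `|t| * expR (- v ^+ 2 / 8).
Proof.
move=> t1.
have /ler_normlP[t1' t1''] := t1.
have tt : t ^+ 2 <= 1 by rewrite -real_normK ?num_real// exprn_ile1.
have v2 : 0 <= v ^+ 2 by exact: sqr_ge0.
rewrite !mulNr.
have := @expRN_dist_le ((v + t) ^+ 2 / 2) (v ^+ 2 / 2) (v ^+ 2 / 4 - 1 / 2).
have h1 : v ^+ 2 / 4 - 1 / 2 <= (v + t) ^+ 2 / 2.
  have := sqr_ge0 (v + 2 * t); nra.
have h2 : v ^+ 2 / 4 - 1 / 2 <= v ^+ 2 / 2 by lra.
move=> /(_ h1 h2) h3.
have h4 : `|(v + t) ^+ 2 / 2 - v ^+ 2 / 2| <= `|t| * (1 + v ^+ 2).
  have -> : (v + t) ^+ 2 / 2 - v ^+ 2 / 2 = t * (v + t / 2) by field.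
  rewrite normrM ler_wpM2l// ler_norml; apply/andP; split.
    have := sqr_ge0 (v + 1); nra.
  have := sqr_ge0 (v - 1); nra.
have h5 : expR (- (v ^+ 2 / 4 - 1 / 2)) <= 2 * expR (- (v ^+ 2 / 8)) * expR (- (v ^+ 2 / 8)).
  have -> : - (v ^+ 2 / 4 - 1 / 2) = 1 / 2 + (- (v ^+ 2 / 8) - v ^+ 2 / 8) by field.
  rewrite expRD expRD -mulrA ler_pM2r; last by rewrite mulr_gt0 ?expR_gt0.
  have half : `|1 / 2 : R| <= 1 / 2 by rewrite ger0_norm.
  have := expR_le_quadratic half; lra.
(* With [z = v^2 / 8] the left side is [(1 + 16 z + 64 z^2) expR (- z)], and
   [1 + 16 + 256 = 273]. *)
have h6 : (1 + v ^+ 2) ^+ 2 * expR (- (v ^+ 2 / 8)) <= 273.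
  have z0 : 0 <= v ^+ 2 / 8 by rewrite divr_ge0.
  have := sqr_mul_expRN_le4 z0; have := mul_expRN_le1 (v ^+ 2 / 8).
  have := expRN_le1 z0; set z := v ^+ 2 / 8; set E := expR _.
  have -> : v ^+ 2 = 8 * z by rewrite /z; field.
  by move=> q1 q2 q3; nra.
set E := expR (- (v ^+ 2 / 8)) in h5 h6 *.
have E0 : 0 < E by exact: expR_gt0.
apply: (@le_trans _ _ (`|t| * (1 + v ^+ 2) * (2 * E * E) * (1 + v ^+ 2))).
  rewrite ler_wpM2r ?addr_ge0//; apply: (le_trans h3).
  by apply: ler_pM => //; exact: expR_ge0.
have -> : `|t| * (1 + v ^+ 2) * (2 * E * E) * (1 + v ^+ 2) =
   `|t| * 2 * E * ((1 + v ^+ 2) ^+ 2 * E) by ring.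
have -> : 600 * `|t| * E = `|t| * 2 * E * 300 by ring.
rewrite ler_wpM2l; [by []| |by lra].
by rewrite !mulr_ge0// ltW.
Qed.

Lemma moment_envelope_le v :
  (1 + v ^+ 2) * expR (- v ^+ 2 / 2) <= 4 * expR (- v ^+ 2 / 8).
Proof.
rewrite !mulNr; pose y := 3 / 8 * v ^+ 2.
have y0 : 0 <= y by rewrite mulr_ge0// sqr_ge0.
have -> : - (v ^+ 2 / 2) = - y + - (v ^+ 2 / 8) by rewrite /y; field.
rewrite expRD mulrA ler_pM2r ?expR_gt0//.
have -> : v ^+ 2 = 8 / 3 * y by rewrite /y; field.
have := mul_expRN_le1 y; have := expRN_le1 y0; lra.
Qed.

Lemma sqr_gauss_le v : v ^+ 2 * expR (- v ^+ 2 / 2) <= 2.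
Proof.
have := mul_expRN_le1 (v ^+ 2 / 2); rewrite mulNr.
set E := expR _; lra.
Qed.

(** [p^2 be^2 / (p^2 + be^2) <= p * be / 2] gains a factor [be] at the price of half of the Gaussian
    exponent, and part of the remaining decay absorbs [v^2]. So a floor of relative height [be^2]
    costs information of order [be]. *)
Lemma damped_moment_le v (be : R) : 0 < be ->
  v ^+ 2 * (expR (- v ^+ 2 / 2) * be ^+ 2 / (expR (- v ^+ 2 / 2) + be ^+ 2))
    <= 4 * be * expR (- v ^+ 2 / 8).
Proof.
move=> be0; rewrite !mulNr.
set w := expR (- (v ^+ 2 / 8)); have w0 : 0 < w by exact: expR_gt0.
have wE : expR (- (v ^+ 2 / 2)) = (w ^+ 2) ^+ 2.
  by rewrite /w -!expRM_natl; congr expR; field.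
rewrite wE; set p := w ^+ 2; have p0 : 0 < p by rewrite exprn_gt0.
have h : p ^+ 2 * be ^+ 2 / (p ^+ 2 + be ^+ 2) <= p * be / 2.
  rewrite ler_pdivrMr ?addr_gt0 ?exprn_gt0//.
  have -> : p * be / 2 * (p ^+ 2 + be ^+ 2) =
    p ^+ 2 * be ^+ 2 + p * be * (p - be) ^+ 2 / 2 by field.
  by rewrite lerDl divr_ge0// mulr_ge0 ?sqr_ge0// mulr_ge0 ?ltW.
apply: (@le_trans _ _ (v ^+ 2 * (p * be / 2))).
  by rewrite ler_wpM2l ?sqr_ge0.
have := mul_expRN_le1 (v ^+ 2 / 8); rewrite -/w => h2.
have -> : v ^+ 2 * (p * be / 2) = 4 * be * w * (v ^+ 2 / 8 * w) by rewrite /p; field.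
by rewrite -[leRHS]mulr1 ler_wpM2l// !mulr_ge0// ltW.
Qed.

(** Replaces the edge factor by a linear function of [y = A^2 / 2]; the next two estimates then
    compare a line with [expR y], bounded below starting from its values at 0.55 and 5. *)
Lemma edge_poly_le (A : R) : 1 <= A -> A + A^-1 <= A ^+ 2 / 2 + 3 / 2.
Proof.
move=> A1; have A0 : 0 < A by lra.
rewrite -(ler_pM2r A0) mulrDl mulVf ?gt_eqF//.
rewrite -subr_ge0.
have -> : (A ^+ 2 / 2 + 3 / 2) * A - (A * A + 1) =
    (A - 1) * (A * (A - 1) + 2) / 2 by field.
by rewrite divr_ge0// mulr_ge0 ?subr_ge0// addr_ge0// mulr_ge0 ?subr_ge0// ltW.
Qed.

Lemma edge_small (A : R) : 21 / 20 <= A ->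
  41 / 100 * ((A + A^-1) * expR (- A ^+ 2 / 2)) <= 1 / 2.
Proof.
move=> A1; rewrite mulNr.
have A2 : 55 / 100 <= A ^+ 2 / 2 by nra.
have A3 : 1 <= A by lra.
have := edge_poly_le A3; set y := A ^+ 2 / 2 in A2 *; set c := A + _ => cy.
rewrite expRN mulrA ler_pdivrMr ?expR_gt0//.
apply: (@le_trans _ _ (41 / 100 * (y + 3 / 2))).
  by rewrite ler_pM2l.
have -> : expR y = expR (55 / 100) * expR (y - 55 / 100).
  by rewrite -expRD; congr expR; ring.
have e1 : 17 / 10 <= expR (55 / 100) :> R.
  have h : 0 <= 55 / 100 :> R by [].
  by apply: le_trans (expR_ge_pow 7 h); rewrite -subr_ge0; lra.
have e2 := expR_ge1Dx (y - 55 / 100).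
have : 17 / 10 * (1 + (y - 55 / 100)) <= expR (55 / 100) * expR (y - 55 / 100).
  by apply: ler_pM => //; lra.
lra.
Qed.

Lemma edge_large (A : R) : 32 / 10 <= A ->
  41 / 100 * ((A + A^-1) * expR (- A ^+ 2 / 2)) <= 35 / 1000.
Proof.
move=> A1; rewrite mulNr.
have A2 : 5 <= A ^+ 2 / 2 by nra.
have A3 : 1 <= A by lra.
have := edge_poly_le A3; set y := A ^+ 2 / 2 in A2 *; set c := A + _ => cy.
rewrite expRN mulrA ler_pdivrMr ?expR_gt0//.
apply: (@le_trans _ _ (41 / 100 * (y + 3 / 2))).
  by rewrite ler_pM2l.
have -> : expR y = expR (5) * expR (y - 5).
  by rewrite -expRD; congr expR; ring.
have e1 : 77 <= expR (5) :> R.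
  have h : 0 <= 5 :> R by lra.
  by apply: le_trans (expR_ge_pow 15 h); rewrite -subr_ge0; lra.
have e2 := expR_ge1Dx (y - 5).
have : 77 * (1 + (y - 5)) <= expR (5) * expR (y - 5).
  apply: ler_pM; [lra|lra|exact: e1|exact: e2].
lra.
Qed.

End ExponentialBounds.

(** * The spike-and-floor likelihood *)

Section Likelihood.
Context (R : realType).
Local Notation mu := (@lebesgue_measure R).
Variables (s l rt b : R).
Hypothesis s0 : 0 < s.
Hypothesis lrt : l < rt.
Hypothesis b0 : 0 < b.
Local Notation I f := (Rintegral mu [set` `[l, rt]] f).

(** The model up to normalization, with the weight of its Gaussian part scaled to 1; [spikeZ] is its
    mass on the interval. [spikeZ1] and [spikeZ2] are the derivatives of [spikeZ], and [score] and
    [dscore] those of [logmodel]. *)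
Definition spike (th x : R) := gauss s (x - th) + b.
Definition spikeZ (th : R) := I (spike th).
Definition spikeZ1 (th : R) := I (gk1 s th).
Definition spikeZ2 (th : R) := I (gk2 s th).
Definition logmodel (th x : R) := ln (spike th x) - ln (spikeZ th).
Definition score (th x : R) :=
  gk1 s th x / spike th x - spikeZ1 th / spikeZ th.
Definition dscore (th x : R) :=
  gk2 s th x / spike th x - gk1 s th x / spike th x * (gk1 s th x / spike th x)
  - (spikeZ2 th / spikeZ th
     - spikeZ1 th / spikeZ th * (spikeZ1 th / spikeZ th)).

Lemma spike_ge th x : b <= spike th x.
Proof. by rewrite /spike lerDr ltW// gauss_gt0. Qed.

Lemma spike_gt0 th x : 0 < spike th x.
Proof. exact: lt_le_trans (spike_ge th x). Qed.

Lemma spike_le th x : spike th x <= normal_peak s + b.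
Proof. by rewrite /spike lerD2r; exact: gauss_le_peak. Qed.

Lemma blip_spike : blip spike.
Proof. by apply: blipD; [exact: blip_gauss|exact: blip_cst]. Qed.

Lemma blip_spikeV : blip (fun th x => (spike th x)^-1).
Proof. exact: (blipV b0 spike_ge blip_spike). Qed.

Lemma spikeZ_ge th : b * (rt - l) <= spikeZ th.
Proof.
rewrite -(itvint_cst lrt); apply: (itvint_le lrt); first exact: bcfun_cst.
- exact: (blip_bcfun th blip_spike).
- by move=> x _; exact: spike_ge.
Qed.

Let bw0 : 0 < b * (rt - l). Proof. by rewrite mulr_gt0// subr_gt0. Qed.

Lemma spikeZ_gt0 th : 0 < spikeZ th.
Proof. exact: lt_le_trans (spikeZ_ge th). Qed.

Lemma blip_spikeZV : blip (fun th (x : R) => (spikeZ th)^-1).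
Proof.
apply: (blipV bw0); first by move=> th _; exact: spikeZ_ge.
exact: (blip_itvint lrt blip_spike).
Qed.

Lemma der_spike (x th : R) : is_derive th 1 (spike^~ x) (gk1 s th x).
Proof.
apply: (is_derive_eq (der_add (der_gauss s0 x th) (is_derive_cst b th 1))).
by rewrite addr0.
Qed.

Lemma der_spikeZ (th : R) : is_derive th 1 spikeZ (spikeZ1 th).
Proof.
exact: (derive_itvint lrt th blip_spike (blip_gk1 s0) der_spike).
Qed.

Lemma der_spikeZ1 (th : R) : is_derive th 1 spikeZ1 (spikeZ2 th).
Proof.
exact: (derive_itvint lrt th (blip_gk1 s0) (blip_gk2 s0) (der_gk1 s0)).
Qed.

Lemma der_logmodel (x th : R) : is_derive th 1 (logmodel^~ x) (score th x).
Proof.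
apply: der_sub; first exact: (@der_ln _ (spike^~ x) th _ (spike_gt0 th x) (der_spike x th)).
exact: (der_ln (spikeZ_gt0 th) (der_spikeZ th)).
Qed.

Lemma der_score (x th : R) : is_derive th 1 (score^~ x) (dscore th x).
Proof.
apply: der_sub; apply: der_div; rewrite ?gt_eqF ?spike_gt0 ?spikeZ_gt0//.
- exact: der_gk1.
- exact: der_spike.
- exact: der_spikeZ1.
- exact: der_spikeZ.
Qed.

Lemma blip_score : blip score.
Proof.
apply: blipB; first exact: (blipM (blip_gk1 s0) blip_spikeV).
exact: (blipM (blip_itvint lrt (blip_gk1 s0)) blip_spikeZV).
Qed.

Lemma blip_dscore : blip dscore.
Proof.
have B1 : blip (fun th x => gk1 s th x / spike th x).
  exact: (blipM (blip_gk1 s0) blip_spikeV).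
have B2 : blip (fun th x => gk2 s th x / spike th x).
  exact: (blipM (blip_gk2 s0) blip_spikeV).
have B3 : blip (fun th (x : R) => spikeZ1 th / spikeZ th).
  exact: (blipM (blip_itvint lrt (blip_gk1 s0)) blip_spikeZV).
have B4 : blip (fun th (x : R) => spikeZ2 th / spikeZ th).
  exact: (blipM (blip_itvint lrt (blip_gk2 s0)) blip_spikeZV).
by apply: blipB; [apply: blipB => //; exact: blipM|
  apply: blipB => //; exact: blipM].
Qed.

Lemma bcfun_logmodel th : bcfun (logmodel th).
Proof.
apply: bcfunB; last exact: bcfun_cst.
have [cf _] := blip_bcfun th blip_spike.
split.
  move=> x; apply: continuous_comp; first exact: cf.
  by apply: continuous_ln; exact: spike_gt0.
exists (`|ln b| + `|ln (normal_peak s + b)|) => x.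
have h1 : ln b <= ln (spike th x).
  by rewrite ler_ln ?posrE ?spike_ge// spike_gt0.
have h2 : ln (spike th x) <= ln (normal_peak s + b).
  rewrite ler_ln ?posrE ?spike_le ?spike_gt0//.
  by rewrite addr_gt0 ?peak_gt0.
have := ler_norm (ln (normal_peak s + b)); have := ler_norm (- ln b).
have := normr_ge0 (ln b); have := normr_ge0 (ln (normal_peak s + b)).
rewrite normrN => q1 q2 q3 q4.
by rewrite ler_norml; apply/andP; split; lra.
Qed.

End Likelihood.

Section EdgeTerms.
Context (R : realType) (s : R).
Hypothesis s0 : 0 < s.
Local Notation pk := (normal_peak s).

(* Gaussian tail bound plus boundary term of the second moment, for an edge at
   distance a: the information lost there. *)
Definition edge (a : R) := (s ^+ 2 / a + a) * gauss s a.

Let edgeE a : 0 < a -> edge a = pk * s * ((a / s + (a / s)^-1) * expR (- (a / s) ^+ 2 / 2)).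
Proof.
move=> a0; rewrite /edge gaussE//; set E := expR _.
by rewrite invf_div; field; rewrite !gt_eqF.
Qed.

Let edge_le (a c : R) : 0 < a ->
  41 / 100 * ((a / s + (a / s)^-1) * expR (- (a / s) ^+ 2 / 2)) <= c -> edge a <= c.
Proof.
move=> a0; rewrite edgeE// => /(le_trans _); apply; rewrite ler_wpM2r ?peak_le//.
by rewrite mulr_ge0 ?expR_ge0// addr_ge0 ?invr_ge0// divr_ge0// ltW.
Qed.

Lemma edge_le_half a : 21 / 20 * s <= a -> edge a <= 1 / 2.
Proof.
move=> ha; have a0 : 0 < a by apply: lt_le_trans ha; rewrite mulr_gt0.
by apply: edge_le => //; apply: edge_small; rewrite ler_pdivlMr.
Qed.

Lemma edge_le_tiny a : 32 / 10 * s <= a -> edge a <= 35 / 1000.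
Proof.
move=> ha; have a0 : 0 < a by apply: lt_le_trans ha; rewrite mulr_gt0.
by apply: edge_le => //; apply: edge_large; rewrite ler_pdivlMr.
Qed.

Lemma gauss_le_edge a : 0 < a -> s * gauss s a <= edge a / 2.
Proof.
move=> a0; rewrite ler_pdivlMr// /edge mulrAC ler_pM2r ?gauss_gt0//.
have -> : s ^+ 2 / a + a = s * 2 + (a - s) ^+ 2 / a by field; rewrite gt_eqF.
by rewrite lerDl divr_ge0 ?sqr_ge0// ltW.
Qed.

Lemma tail_le_edge a : s <= a -> s ^+ 2 / a * gauss s a <= edge a / 2.
Proof.
move=> sa; have a0 := lt_le_trans s0 sa.
rewrite ler_pdivlMr// /edge mulrAC ler_pM2r ?gauss_gt0//.
rewrite mulr_natr mulr2n lerD2l ler_pdivrMr// expr2.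
by apply: ler_pM => //; exact: ltW.
Qed.

Lemma edgeD a : edge a = s ^+ 2 / a * gauss s a + a * gauss s a.
Proof. by rewrite /edge mulrDl. Qed.

End EdgeTerms.

(** * Pointwise bounds for the curvature and the squared score *)

Section Pointwise.
Context (R : realType) (s b : R).
Hypothesis s0 : 0 < s.
Hypothesis b0 : 0 < b.
Local Notation pk := (normal_peak s).
Local Notation G th x := (gauss s (x - th)).
Variables (th ph x : R).
Let v := (x - th) / s.
(** The conditional probability that a sample at [x] comes from the spike and not from the floor.
    [curv] and [sqscore] are polynomials in [q] and the standardized offset [v]. *)
Let q := G th x / spike s b th x.
Let be := Num.sqrt (b / pk).

Let sn : s != 0. Proof. by rewrite gt_eqF. Qed.

Let GE : G th x = pk * expR (- v ^+ 2 / 2). Proof. exact: gaussE. Qed.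

Let f0 : 0 < spike s b th x. Proof. exact: spike_gt0. Qed.

Let q0 : 0 < q. Proof. by rewrite divr_gt0// gauss_gt0. Qed.

Let q1 : q <= 1.
Proof. by rewrite ler_pdivrMr// mul1r /spike lerDl ltW. Qed.

Let qf : q * spike s b th x = G th x. Proof. by rewrite /q divfK// gt_eqF. Qed.

Let g1E : s * (gk1 s th x / spike s b th x) = v * q.
Proof. by rewrite /gk1 /q /v; field; rewrite sn gt_eqF. Qed.

Let g2E : s ^+ 2 * (gk2 s th x / spike s b th x) = (v ^+ 2 - 1) * q.
Proof. by rewrite /gk2 /q /v; field; rewrite sn gt_eqF. Qed.

Let gk2E : s ^+ 2 * gk2 s th x = (v ^+ 2 - 1) * G th x.
Proof. by rewrite /gk2 /v; field. Qed.

(** [s^2] times minus the second derivative in [th] of [ln (spike s b th x)]. The part of [dscore]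
    due to the normalization is constant in [x] and enters only after integration. *)
Definition curv := - s ^+ 2 * (gk2 s th x / spike s b th x
  - gk1 s th x / spike s b th x * (gk1 s th x / spike s b th x)).

Definition sqscore := s ^+ 2 * (gk1 s th x / spike s b th x) ^+ 2.

Let curvE : curv = q - v ^+ 2 * q * (1 - q).
Proof.
have -> : curv = (s * (gk1 s th x / spike s b th x)) ^+ 2 -
   s ^+ 2 * (gk2 s th x / spike s b th x) by rewrite /curv; ring.
by rewrite g1E g2E; ring.
Qed.

Let sqscoreE : sqscore = v ^+ 2 * q ^+ 2.
Proof. by rewrite /sqscore -exprMn g1E exprMn. Qed.

Let v2 : 0 <= v ^+ 2. Proof. exact: sqr_ge0. Qed.

Let v2q0 : 0 <= v ^+ 2 * q. Proof. by rewrite mulr_ge0// ltW. Qed.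

Let v2q1 : v ^+ 2 * q <= v ^+ 2. Proof. by rewrite ler_piMr. Qed.

Let v2q2 : v ^+ 2 * q ^+ 2 <= v ^+ 2 * q.
Proof. by rewrite expr2 mulrA ler_piMr. Qed.

Let v2q20 : 0 <= v ^+ 2 * q ^+ 2. Proof. by rewrite mulr_ge0 ?sqr_ge0. Qed.

Let curvE2 : curv = q - v ^+ 2 * q + v ^+ 2 * q ^+ 2.
Proof. by rewrite curvE; ring. Qed.

Lemma normr_curv_le : `|curv| <= 1 + v ^+ 2.
Proof.
have := (q0, q1, v2q0, v2q1, v2q2, v2q20) => -[[[[[? ?] ?] ?] ?] ?].
by rewrite curvE2 ler_norml; apply/andP; split; lra.
Qed.

Lemma sqscore_le : sqscore <= 1 + v ^+ 2.
Proof.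
rewrite sqscoreE; have := (v2q1, v2q2) => -[? ?]; lra.
Qed.

Lemma sqscore_ge0 : 0 <= sqscore.
Proof. by rewrite sqscoreE mulr_ge0 ?sqr_ge0. Qed.

Let v2q : v ^+ 2 * q <= 2 * pk / b.
Proof.
have p0 := peak_gt0 s0.
apply: (@le_trans _ _ (v ^+ 2 * (G th x / b))).
  rewrite ler_wpM2l// ler_pM2l ?gauss_gt0// lef_pV2 ?posrE// ?spike_gt0//.
  exact: spike_ge.
rewrite mulrA ler_pM2r ?invr_gt0// GE mulrCA mulrC ler_pM2r//.
exact: sqr_gauss_le.
Qed.

(** Uniform in [x], for use against the tails [r], of which only the total mass is controlled; the
    large factor [pk / b] is paid for by the smallness of that mass. *)
Lemma curv_ge : - (2 * pk / b) <= curv.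
Proof.
rewrite curvE2; have := (v2q, q0, v2q20) => -[[? ?] ?]; lra.
Qed.

Lemma sqscore_le_inv : sqscore <= 2 * pk / b.
Proof. by rewrite sqscoreE; exact: le_trans v2q2 v2q. Qed.

(** Density times curvature is [G - v^2 G (1 - q)], and [G (1 - q)] is the product of Gaussian and
    floor over their sum, to which the damped moment bound applies. *)
Lemma spike_curv_ge : G th x - 4 * be * envelope s th x <= spike s b th x * curv.
Proof.
have p0 := peak_gt0 s0.
have be2 : be ^+ 2 = b / pk by rewrite sqr_sqrtr// divr_ge0// ltW.
have be0 : 0 < be by rewrite sqrtr_gt0 divr_gt0.
have -> : spike s b th x * curv = G th x - v ^+ 2 * (G th x * (1 - q)).
  by rewrite curvE -qf; ring.
rewrite lerD2l lerN2.
have h := damped_moment_le v be0.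
have -> : G th x * (1 - q) =
    pk * (expR (- v ^+ 2 / 2) * be ^+ 2 / (expR (- v ^+ 2 / 2) + be ^+ 2)).
  rewrite be2 /q /spike GE; set E := expR _.
  have E0 : 0 < E by exact: expR_gt0.
  field.
  by rewrite !gt_eqF ?addr_gt0 ?mulr_gt0.
rewrite mulrCA /envelope -/v.
have -> : 4 * be * (pk * expR (- v ^+ 2 / 8)) = pk * (4 * be * expR (- v ^+ 2 / 8)).
  by ring.
by rewrite ler_pM2l.
Qed.

(** By [q <= 1]. The right side has an explicit integral: the Gaussian mass plus a boundary term
    that is not positive. *)
Lemma spike_sqscore_le : spike s b th x * sqscore <= s ^+ 2 * gk2 s th x + G th x.
Proof.
rewrite gk2E sqscoreE.
have -> : spike s b th x * (v ^+ 2 * q ^+ 2) = v ^+ 2 * q * G th x.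
  by rewrite -qf; ring.
have -> : (v ^+ 2 - 1) * G th x + G th x = v ^+ 2 * G th x by ring.
by rewrite ler_pM2r ?gauss_gt0.
Qed.

Lemma gauss_shift_envelope : `|th - ph| <= s ->
  `|G ph x - G th x| * (1 + v ^+ 2) <= 600 * (`|th - ph| / s) * envelope s th x.
Proof.
move=> tps; pose t := (th - ph) / s.
have tE : `|th - ph| / s = `|t| by rewrite /t normrM normfV (gtr0_norm s0).
have t1 : `|t| <= 1 by rewrite -tE ler_pdivrMr// mul1r.
have p0 := peak_gt0 s0.
have uE : (x - ph) / s = v + t by rewrite /v /t; field.
rewrite GE gaussE// uE -mulrBr normrM (gtr0_norm p0) tE /envelope -/v.
rewrite -[leLHS]mulrA [leRHS]mulrCA ler_pM2l//.
exact: gauss_shift_le.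
Qed.

Lemma moment_gauss_le : (1 + v ^+ 2) * G th x <= 4 * envelope s th x.
Proof.
rewrite GE /envelope -/v mulrCA [leRHS]mulrCA ler_pM2l ?peak_gt0//.
exact: moment_envelope_le.
Qed.

Lemma normr_gk2_le : `|s ^+ 2 * gk2 s th x| <= 4 * envelope s th x.
Proof.
apply: le_trans moment_gauss_le; rewrite gk2E normrM.
rewrite (gtr0_norm (gauss_gt0 s0 _)) ler_pM2r ?gauss_gt0//.
have := v2 => ?.
by rewrite ler_norml; apply/andP; split; lra.
Qed.

End Pointwise.

(** * Information near the true phase *)

Section NearTheTruth.
Context (R : realType).
Local Notation mu := (@lebesgue_measure R).
Variables (s l rt b ph : R) (r : R -> R).
Hypothesis s0 : 0 < s.
Hypothesis b0 : 0 < b.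
Hypothesis hl : 107 / 100 * s <= ph - l.
Hypothesis hr : 107 / 100 * s <= rt - ph.
Hypothesis hbig : 325 / 100 * s <= ph - l \/ 325 / 100 * s <= rt - ph.
Local Notation pk := (normal_peak s).
Local Notation be := (Num.sqrt (b / pk)).
Hypothesis hb : be <= 1 / 1000.
Hypothesis br : bcfun r.
Hypothesis r0 : forall x, 0 <= r x.
Local Notation I f := (Rintegral mu [set` `[l, rt]] f).
Hypothesis hrho : I r * (2 * pk / b) <= 1 / 1000.
Variable th : R.
Hypothesis hth : `|th - ph| <= s / 1000 / 1000.
Local Notation G th x := (gauss s (x - th)).
Local Notation Z := (spikeZ s l rt b).
Local Notation Z1 := (spikeZ1 s l rt).
Local Notation Z2 := (spikeZ2 s l rt).

Let thl : 105 / 100 * s <= th - l.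
Proof. by have := (hl, hth, s0) => -[[? /ler_normlP[? ?]] ?]; lra. Qed.

Let thr : 105 / 100 * s <= rt - th.
Proof. by have := (hr, hth, s0) => -[[? /ler_normlP[? ?]] ?]; lra. Qed.

Let thbig : 32 / 10 * s <= th - l \/ 32 / 10 * s <= rt - th.
Proof.
have := (hth, s0) => -[/ler_normlP[? ?] ?].
by have := hbig => -[?|?]; [left|right]; lra.
Qed.

Let lth : l < th. Proof. by have := (thl, s0) => -[? ?]; lra. Qed.
Let thrt : th < rt. Proof. by have := (thr, s0) => -[? ?]; lra. Qed.
Let lrt : l < rt. Proof. exact: lt_trans lth thrt. Qed.

(** Only one edge can be near: it may take half of the information, the other one at most 0.035. *)
Let edges : edge s (th - l) + edge s (rt - th) <= 535 / 1000.
Proof.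
have e1 : edge s (th - l) <= 1 / 2 by apply: edge_le_half => //; have := (thl, s0) => -[? ?]; lra.
have e2 : edge s (rt - th) <= 1 / 2 by apply: edge_le_half => //; have := (thr, s0) => -[? ?]; lra.
by have := thbig => -[/(edge_le_tiny s0)|/(edge_le_tiny s0)] => ?; lra.
Qed.

Let mass := I (fun x => G th x).

Let bG (t : R) : bcfun (fun x => G t x).
Proof. exact: (blip_bcfun t (blip_gauss s0)). Qed.
Let bk1 : bcfun (gk1 s th). Proof. exact: (blip_bcfun th (blip_gk1 s0)). Qed.
Let bk2 : bcfun (gk2 s th). Proof. exact: (blip_bcfun th (blip_gk2 s0)). Qed.
Let bsp (t : R) : bcfun (spike s b t).
Proof. exact: (blip_bcfun t (blip_spike b s0)). Qed.
Let bspV (t : R) : bcfun (fun x => (spike s b t x)^-1).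
Proof. exact: (blip_bcfun t (blip_spikeV s0 b0)). Qed.
Let benv : bcfun (envelope s th). Proof. exact: bcfun_envelope. Qed.

Let mass_le1 : mass <= 1.
Proof.
rewrite /mass (itvint_eq (g := normal_pdf th s)); last by move=> x _; exact: gauss_pdf.
by apply: itvint_pdf_le1 => //; rewrite gt_eqF.
Qed.

Let mass_ge : 1 - edge s (th - l) / 2 - edge s (rt - th) / 2 <= mass.
Proof.
apply: le_trans (gauss_mass_ge s0 lth thrt).
have t1 := @tail_le_edge _ s s0 (th - l); have t2 := @tail_le_edge _ s s0 (rt - th).
by have := (s0, thl, thr) => -[[? ?] ?]; have := t1 ltac:(lra); have := t2 ltac:(lra); lra.
Qed.

(** Since only [x - th] enters, [gk2] is also the [x]-derivative of [- gk1], and the integral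
    reduces to boundary values. *)
Let Z2E : s ^+ 2 * Z2 th = - ((th - l) * gauss s (th - l) + (rt - th) * gauss s (rt - th)).
Proof.
have dk (x : R) : is_derive x 1 (fun x => - gk1 s th x) (gk2 s th x).
  have -> : (fun x => - gk1 s th x) = (gk1 s)^~ th.
    by apply/funext => y; rewrite /gk1 -(gaussN s0 (th - y)) opprB -mulNr -mulNr opprB.
  apply: (is_derive_eq (der_gk1 s0 th x)).
  by rewrite /gk2 -(gaussN s0 (th - x)) opprB -sqrrN opprB.
rewrite /spikeZ2 (itvint_ftc lrt dk); last by case: bk2.
rewrite /gk1 -(gaussN s0 (th - l)) opprB.
by field; rewrite gt_eqF.
Qed.

Let Z1E : Z1 th = gauss s (th - l) - gauss s (rt - th).
Proof.
have dk (x : R) : is_derive x 1 (fun x => - G th x) (gk1 s th x).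
  have -> : (fun x => - G th x) = (fun x => (fun=> 0) x - G th x).
    by apply/funext => y; rewrite sub0r.
  apply: (is_derive_eq (der_sub (is_derive_cst 0 x 1) (der_gauss_x s0 th x))).
  by rewrite sub0r opprK.
rewrite /spikeZ1 (itvint_ftc lrt dk); last by case: bk1.
by rewrite -(gaussN s0 (th - l)) opprB opprK addrC.
Qed.

Let Z1_le : (s * Z1 th) ^+ 2 <= 1 / 16.
Proof.
have g1 := gauss_le_edge s0 (_ : 0 < th - l).
have g2 := gauss_le_edge s0 (_ : 0 < rt - th).
have e1 : edge s (th - l) <= 1 / 2 by apply: edge_le_half => //; have := (thl, s0) => -[? ?]; lra.
have e2 : edge s (rt - th) <= 1 / 2 by apply: edge_le_half => //; have := (thr, s0) => -[? ?]; lra.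
have p1 := mulr_gt0 s0 (gauss_gt0 s0 (th - l)).
have p2 := mulr_gt0 s0 (gauss_gt0 s0 (rt - th)).
rewrite Z1E mulrBr.
have := g1 ltac:(by rewrite subr_gt0); have := g2 ltac:(by rewrite subr_gt0).
move: p1 p2; set u := s * gauss _ _; set v := s * gauss _ _ => p1 p2 q1 q2.
have -> : 1 / 16 = (1 / 4) ^+ 2 :> R by field.
rewrite -[leLHS]real_normK ?num_real// lerXn2r ?nnegrE//.
by rewrite ler_norml; apply/andP; split; lra.
Qed.

Let Zge : 73 / 100 <= Z th.
Proof.
have -> : Z th = mass + b * (rt - l).
  by rewrite /spikeZ /spike (itvintD lrt)//; [rewrite itvint_cst|exact: bcfun_cst].
have w : 0 <= b * (rt - l) by rewrite mulr_ge0 ?subr_ge0 ?(ltW lrt)// ltW.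
by have := (mass_ge, edges) => -[? ?]; lra.
Qed.

Let env_ge0 x : 0 <= envelope s th x. Proof. exact: envelope_ge0. Qed.
Let env_le2 : I (envelope s th) <= 2. Proof. exact: itvint_envelope_le. Qed.

Let shift := `|th - ph| / s.
Let shift_le : shift <= 1 / 1000 / 1000.
Proof. by rewrite /shift ler_pdivrMr// mul1r mulrC; have := hth; lra. Qed.
Let shift_ge0 : 0 <= shift. Proof. by rewrite divr_ge0// ltW. Qed.
Let K := 600 * shift.
Let K_ge0 : 0 <= K. Proof. by have := shift_ge0 => ?; rewrite /K; lra. Qed.
Let K_le : K <= 6 / 10000.
Proof. by have := shift_le => ?; rewrite /K; lra. Qed.
Let hths : `|th - ph| <= s.
Proof. by apply: le_trans hth _; have := s0; lra. Qed.

Let bcurv : bcfun (curv s b th).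
Proof.
apply: bcfunZ; apply: bcfunB; first exact: bcfunM.
by apply: bcfunM; exact: bcfunM.
Qed.

Let bsq : bcfun (sqscore s b th).
Proof. by apply: bcfunZ; apply: bcfunX; exact: bcfunM. Qed.

Let shift_curv x : `|(G ph x - G th x) * curv s b th x| <= K * envelope s th x.
Proof.
rewrite normrM; apply: le_trans (gauss_shift_envelope s0 x hths).
by rewrite ler_wpM2l// normr_curv_le.
Qed.

Let shift_sq x : `|(G ph x - G th x) * sqscore s b th x| <= K * envelope s th x.
Proof.
rewrite normrM; apply: le_trans (gauss_shift_envelope s0 x hths).
rewrite ler_wpM2l// ger0_norm ?sqscore_ge0//; exact: sqscore_le.
Qed.

(** The density at [ph] is replaced by the spike at [th]. The floor costs [8 * be], the shift
    [2 * K] and the tails 0.001, together at most 0.0102. *)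
Let num_curv : mass - 11 / 1000 <= I (fun x => (spike s b ph x + r x) * curv s b th x).
Proof.
pose c := 4 * be + K.
have be0 : 0 <= be by exact: sqrtr_ge0.
have c0 : 0 <= c by rewrite addr_ge0// mulr_ge0.
apply: (@le_trans _ _ (I (fun x => G th x - (c * envelope s th x + (2 * pk / b) * r x)))).
  rewrite (itvintB lrt)//; last by apply: bcfunD; exact: bcfunZ.
  rewrite (itvintD lrt (bcfunZ c benv) (bcfunZ (2 * pk / b) br)).
  rewrite (itvintZ lrt c benv) (itvintZ lrt _ br) -/mass.
  have : c * I (envelope s th) <= c * 2 by rewrite ler_wpM2l.
  rewrite [_ * I r]mulrC.
  have := (hrho, hb, K_le) => -[[? ?] ?]; rewrite /c; lra.
apply: (itvint_le lrt).
- by apply: bcfunB => //; apply: bcfunD; exact: bcfunZ.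
- by apply: bcfunM => //; exact: bcfunD.
move=> x _; have -> : (spike s b ph x + r x) * curv s b th x =
    spike s b th x * curv s b th x + (G ph x - G th x) * curv s b th x
    + r x * curv s b th x by rewrite /spike; ring.
have h1 := @spike_curv_ge _ s b s0 b0 th x.
have /ler_normlP[h2 _] := shift_curv x.
have h3 : - (2 * pk / b * r x) <= r x * curv s b th x.
  by rewrite mulrC -mulrN ler_wpM2l// curv_ge.
rewrite /c; move: h1 h2 h3.
set e := envelope _ _ _; set g := G th x; set k := curv _ _ _ _.
lra.
Qed.

Lemma num_sqscore_le : I (fun x => (spike s b ph x + r x) * sqscore s b th x) <= 101 / 100.
Proof.
apply: (@le_trans _ _ (I (fun x => (s ^+ 2 * gk2 s th x + G th x) +
    (K * envelope s th x + (2 * pk / b) * r x)))).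
  apply: (itvint_le lrt).
  - by apply: bcfunM => //; exact: bcfunD.
  - by apply: bcfunD; apply: bcfunD => //; exact: bcfunZ.
  move=> x _; have -> : (spike s b ph x + r x) * sqscore s b th x =
    spike s b th x * sqscore s b th x + ((G ph x - G th x) * sqscore s b th x
    + r x * sqscore s b th x) by rewrite /spike; ring.
  apply: lerD; first exact: spike_sqscore_le.
  apply: lerD; first exact: le_trans (ler_norm _) (shift_sq x).
  by rewrite mulrC ler_wpM2r// sqscore_le_inv.
rewrite (itvintD lrt); do ?[by apply: bcfunD => //; exact: bcfunZ].
rewrite (itvintD lrt)//; last exact: bcfunZ.
rewrite (itvintD lrt (bcfunZ (K) benv) (bcfunZ (2 * pk / b) br)).
rewrite (itvintZ lrt _ bk2) (itvintZ lrt (K) benv) (itvintZ lrt _ br) -/mass.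
have e1 : K * I (envelope s th) <= K * 2.
  by rewrite ler_wpM2l.
have Zn : s ^+ 2 * Z2 th <= 0.
  rewrite Z2E oppr_le0 addr_ge0// mulr_ge0 ?subr_ge0 ?(ltW lth) ?(ltW thrt)//;
    exact/ltW/gauss_gt0.
rewrite -/(Z2 th) [_ * I r]mulrC; move: e1 Zn.
have := (hrho, mass_le1, K_le) => -[[? ?] ?]; lra.
Qed.

Let N0 := I (fun x => spike s b ph x + r x).

Let N0_dist : `|N0 - Z th| <= 25 / 10000.
Proof.
have rho0 : 0 <= I r by apply: itvint_ge0.
have rho1 : I r <= 1 / 1000.
  apply: le_trans hrho; rewrite ler_peMr// ler_pdivlMr// mul1r.
  have p0 := peak_gt0 s0.
  have : b / pk <= 1.
    have -> : b / pk = be ^+ 2 by rewrite sqr_sqrtr// divr_ge0// ltW.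
    by rewrite exprn_ile1 ?sqrtr_ge0//; have := hb; lra.
  by rewrite ler_pdivrMr// mul1r; lra.
have -> : N0 - Z th = I (fun x => G ph x - G th x) + I r.
  have bb : bcfun (fun _ : R => b) by exact: bcfun_cst.
  rewrite /N0 (itvintD lrt (bsp ph) br) /spikeZ (itvintD lrt (bG ph) bb) (itvintD lrt (bG th) bb).
  have aux (u v w t : R) : u + w + t - (v + w) = u - v + t by ring.
  rewrite (itvintB lrt (bG ph) (bG th)); exact: aux.
apply: (le_trans (ler_normD _ _)).
have : `|I (fun x => G ph x - G th x)| <= K * 2.
  apply: (@le_trans _ _ (K * I (envelope s th))); last first.
    by rewrite ler_wpM2l.
  rewrite -(itvintZ lrt (K) benv).
  apply: (itvint_le_norm lrt); [exact: bcfunB|exact: bcfunZ|].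
  move=> x _; apply: le_trans (gauss_shift_envelope s0 x hths).
  by rewrite ler_peMr// lerDl sqr_ge0.
by rewrite (ger0_norm rho0); have := K_le => ?; lra.
Qed.

(** If the data had mass [Z th], the normalization would add [s^2 Z2 - (s Z1)^2 / Z] to the integral
    of [curv]. The Gaussian mass plus [s^2 Z2] is at least one minus the two edge terms, hence
    0.465; subtracting 0.011 for the perturbed curvature, 0.086 for the squared mean score and 0.03
    for the mismatch of masses leaves 0.338. *)
Lemma information_ge :
  32 / 100 <= s ^+ 2 * - I (fun x => (spike s b ph x + r x) * dscore s l rt b th x).
Proof.
pose c2 := Z2 th / Z th - Z1 th / Z th * (Z1 th / Z th).
have Z0 : 0 < Z th by have := Zge => ?; lra.
have bn : bcfun (fun x => spike s b ph x + r x) by exact: bcfunD.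
have -> : s ^+ 2 * - I (fun x => (spike s b ph x + r x) * dscore s l rt b th x) =
    I (fun x => (spike s b ph x + r x) * curv s b th x) + s ^+ 2 * c2 * N0.
  have bd : bcfun (fun x => (spike s b ph x + r x) * dscore s l rt b th x).
    by apply: bcfunM => //; exact: (blip_bcfun th (blip_dscore s0 lrt b0)).
  rewrite mulrN -mulNr -(itvintZ lrt (- s ^+ 2) bd) /N0 -(itvintZ lrt (s ^+ 2 * c2) bn).
  rewrite -(itvintD lrt (bcfunM bn bcurv) (bcfunZ (s ^+ 2 * c2) bn)).
  by apply: itvint_eq => x _; rewrite /dscore /curv -/c2; ring.
have E : s ^+ 2 * c2 * N0 = s ^+ 2 * Z2 th - (s * Z1 th) ^+ 2 / Z th
    + s ^+ 2 * c2 * (N0 - Z th).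
  by rewrite /c2; field; rewrite gt_eqF.
have h1 : (s * Z1 th) ^+ 2 / Z th <= 86 / 1000.
  rewrite ler_pdivrMr//; apply: (le_trans Z1_le).
  have := Zge => ?; lra.
have Z2b : `|s ^+ 2 * Z2 th| <= 8.
  rewrite -(itvintZ lrt _ bk2); apply: (@le_trans _ _ (4 * I (envelope s th))).
    rewrite -(itvintZ lrt 4 benv); apply: (itvint_le_norm lrt); [exact: bcfunZ|exact: bcfunZ|].
    by move=> x _; exact: normr_gk2_le.
  have := env_le2 => ?; lra.
have h2 : `|s ^+ 2 * c2| <= 12.
  have -> : s ^+ 2 * c2 = s ^+ 2 * Z2 th / Z th - (s * Z1 th) ^+ 2 / Z th / Z th.
    by rewrite /c2; field; rewrite gt_eqF.
  apply: (le_trans (ler_normB _ _)).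
  have a1 : `|s ^+ 2 * Z2 th / Z th| <= 11.
    rewrite normrM normfV (gtr0_norm Z0) ler_pdivrMr//; apply: (le_trans Z2b).
    have := Zge => ?; lra.
  have a2 : `|(s * Z1 th) ^+ 2 / Z th / Z th| <= 1.
    rewrite normrM normfV (gtr0_norm Z0) ler_pdivrMr//.
    rewrite ger0_norm ?divr_ge0 ?sqr_ge0 ?(ltW Z0)//; apply: (le_trans h1).
    have := Zge => ?; lra.
  lra.
have h3 : - (3 / 100) <= s ^+ 2 * c2 * (N0 - Z th).
  have : `|s ^+ 2 * c2 * (N0 - Z th)| <= 12 * (25 / 10000).
    by rewrite normrM; apply: ler_pM.
  by move=> /ler_normlP[? _]; lra.
have h4 : 465 / 1000 <= s ^+ 2 * Z2 th + mass.
  apply: (@le_trans _ _ (1 - edge s (th - l) - edge s (rt - th))).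
    by have := edges => ?; lra.
  rewrite !edgeD Z2E; have := gauss_mass_ge s0 lth thrt; rewrite -/mass.
  set a1 := _ / _ * _; set a2 := _ / _ * _; lra.
rewrite E; have := num_curv; set n := I _; move: h1 h3 h4 => *; lra.
Qed.

End NearTheTruth.

(** * Size of the score at the true phase *)

Section ScoreAtTheTruth.
Context (R : realType).
Local Notation mu := (@lebesgue_measure R).
Variables (s l rt b ph : R) (r : R -> R).
Hypothesis s0 : 0 < s.
Hypothesis b0 : 0 < b.
Hypothesis lph : l <= ph.
Hypothesis phr : ph <= rt.
Hypothesis lrt : l < rt.
Hypothesis br : bcfun r.
Hypothesis r0 : forall x, 0 <= r x.
Local Notation I f := (Rintegral mu [set` `[l, rt]] f).

Let bsp (t : R) : bcfun (spike s b t).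
Proof. exact: (blip_bcfun t (blip_spike b s0)). Qed.
Let bk1 : bcfun (gk1 s ph). Proof. exact: (blip_bcfun ph (blip_gk1 s0)). Qed.

Let s2 : 0 < (s ^+ 2)^-1. Proof. by rewrite invr_gt0 exprn_gt0. Qed.

Let gk1_range x : l <= x <= rt ->
  (l - ph) / s ^+ 2 * spike s b ph x <= gk1 s ph x <= (rt - ph) / s ^+ 2 * spike s b ph x.
Proof.
move=> /andP[lx xr].
have G0 := gauss_gt0 s0 (x - ph).
have Gf : gauss s (x - ph) <= spike s b ph x by rewrite /spike lerDl ltW.
have f0 := spike_gt0 s0 b0 ph x.
have -> : gk1 s ph x = (x - ph) * gauss s (x - ph) / s ^+ 2 by rewrite /gk1 mulrAC.
rewrite ![_ / s ^+ 2 * _]mulrAC !ler_pM2r//; apply/andP; split.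
  apply: (@le_trans _ _ ((l - ph) * gauss s (x - ph))).
    by rewrite ler_wnM2l// subr_le0.
  by rewrite ler_pM2r// lerD2r.
apply: (@le_trans _ _ ((rt - ph) * gauss s (x - ph))).
  by rewrite ler_pM2r// lerD2r.
by rewrite ler_wpM2l// subr_ge0.
Qed.

(** [gk1 / spike] and its mean [spikeZ1 / spikeZ] under the model both lie between [(l - ph) / s^2]
    and [(rt - ph) / s^2]. *)
Lemma normr_score_le x : l <= x <= rt -> `|score s l rt b ph x| <= (rt - l) / s ^+ 2.
Proof.
move=> xD; have f0 := spike_gt0 s0 b0 ph x.
have Z0 := spikeZ_gt0 s0 lrt b0 ph.
have /andP[h1 h2] := gk1_range xD.
have h3 : (l - ph) / s ^+ 2 * spikeZ s l rt b ph <= spikeZ1 s l rt ph.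
  rewrite /spikeZ -(itvintZ lrt _ (bsp ph)); apply: (itvint_le lrt) => //; first exact: bcfunZ.
  by move=> y /gk1_range/andP[].
have h4 : spikeZ1 s l rt ph <= (rt - ph) / s ^+ 2 * spikeZ s l rt b ph.
  rewrite /spikeZ -(itvintZ lrt _ (bsp ph)); apply: (itvint_le lrt) => //; first exact: bcfunZ.
  by move=> y /gk1_range/andP[].
have E : (rt - l) / s ^+ 2 = (rt - ph) / s ^+ 2 - (l - ph) / s ^+ 2 by ring.
have {}h1 : (l - ph) / s ^+ 2 <= gk1 s ph x / spike s b ph x by rewrite ler_pdivlMr.
have {}h2 : gk1 s ph x / spike s b ph x <= (rt - ph) / s ^+ 2 by rewrite ler_pdivrMr.
have {}h3 : (l - ph) / s ^+ 2 <= spikeZ1 s l rt ph / spikeZ s l rt b ph by rewrite ler_pdivlMr.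
have {}h4 : spikeZ1 s l rt ph / spikeZ s l rt b ph <= (rt - ph) / s ^+ 2 by rewrite ler_pdivrMr.
rewrite E /score ler_norml; apply/andP; split; lra.
Qed.

Lemma itvint_score_le :
  `|I (fun x => (spike s b ph x + r x) * score s l rt b ph x)|
    <= I r * ((rt - l) / s ^+ 2).
Proof.
have bs : bcfun (score s l rt b ph) by exact: (blip_bcfun ph (blip_score s0 lrt b0)).
have Z0 := spikeZ_gt0 s0 lrt b0 ph.
pose k := spikeZ1 s l rt ph / spikeZ s l rt b ph.
have -> : I (fun x => (spike s b ph x + r x) * score s l rt b ph x) =
    I (fun x => r x * score s l rt b ph x).
  transitivity (I (fun x => (gk1 s ph x - k * spike s b ph x) + r x * score s l rt b ph x)).
    apply: itvint_eq => x _; have f0 := spike_gt0 s0 b0 ph x.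
    by rewrite mulrDl; congr (_ + _); rewrite /score -/k; field; rewrite gt_eqF.
  rewrite (itvintD lrt (bcfunB bk1 (bcfunZ k (bsp ph))) (bcfunM br bs)).
  rewrite (itvintB lrt bk1 (bcfunZ k (bsp ph))) (itvintZ lrt k (bsp ph)).
  by rewrite -/(spikeZ1 s l rt ph) -/(spikeZ s l rt b ph) /k divfK ?gt_eqF// subrr add0r.
rewrite mulrC -(itvintZ lrt _ br); apply: (itvint_le_norm lrt).
- exact: bcfunM.
- exact: bcfunZ.
move=> x xD; rewrite normrM (ger0_norm (r0 x)) mulrC ler_wpM2r//.
exact: normr_score_le.
Qed.

End ScoreAtTheTruth.

Lemma sqr_sqrt_diff_ge (R : realType) (f g D F : R) :
  0 <= g -> 0 <= D -> g + D <= f -> 0 < F -> f <= F ->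
  D ^+ 2 / (4 * F) <= (Num.sqrt f - Num.sqrt g) ^+ 2.
Proof.
move=> g0 D0 gf F0 fF.
have f0 : 0 <= f by apply: le_trans gf; rewrite addr_ge0.
have gf' : g <= f by apply: le_trans gf; rewrite lerDl.
have sgf : Num.sqrt g <= Num.sqrt f by rewrite ler_wsqrtr.
have sg0 := sqrtr_ge0 g; have sf0 := sqrtr_ge0 f.
have h : D <= (Num.sqrt f - Num.sqrt g) * (2 * Num.sqrt f).
  apply: (@le_trans _ _ (f - g)); first by rewrite lerBrDr addrC.
  rewrite -{1}(sqr_sqrtr f0) -{1}(sqr_sqrtr g0) subr_sqr ler_wpM2l ?subr_ge0//.
  by rewrite mulr_natl mulr2n lerD2l.
have h2 : D ^+ 2 <= (Num.sqrt f - Num.sqrt g) ^+ 2 * (4 * f).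
  have -> : (Num.sqrt f - Num.sqrt g) ^+ 2 * (4 * f) =
     ((Num.sqrt f - Num.sqrt g) * (2 * Num.sqrt f)) ^+ 2.
    by rewrite !exprMn sqr_sqrtr//; ring.
  by rewrite lerXn2r// nnegrE (le_trans D0).
rewrite ler_pdivrMr ?mulr_gt0//; apply: (le_trans h2).
by rewrite ler_wpM2l ?sqr_ge0// ler_wpM2l.
Qed.

(* ln x <= 2 (sqrt x - 1), so that integrating produces minus a squared
   Hellinger distance. *)
Lemma mul_ln_ratio_le (R : realType) (f g r : R) : 0 < f -> 0 < g -> 0 <= r ->
  (f + r) * (ln g - ln f) <=
  - (Num.sqrt f - Num.sqrt g) ^+ 2 + (g - f) + r * (g / f).
Proof.
move=> f0 g0 r0.
have sf0 : 0 < Num.sqrt f by rewrite sqrtr_gt0.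
have sg0 : 0 < Num.sqrt g by rewrite sqrtr_gt0.
have ln_le (y : R) : 0 < y -> ln y <= y - 1.
  by move=> y0; have := @le_ln1Dx R (y - 1); rewrite addrCA subrr addr0; apply; lra.
rewrite mulrDl; apply: lerD.
  have -> : ln g - ln f = 2 * ln (Num.sqrt g / Num.sqrt f).
    rewrite lnM ?posrE ?invr_gt0// lnV ?posrE//.
    rewrite -{1}(sqr_sqrtr (ltW f0)) -{1}(sqr_sqrtr (ltW g0)) !lnXn//.
    by rewrite mulrBr !mulr_natl.
  apply: (@le_trans _ _ (f * (2 * (Num.sqrt g / Num.sqrt f - 1)))).
    by rewrite ler_pM2l// ler_pM2l// ln_le// divr_gt0.
  have fE := sqr_sqrtr (ltW f0); have gE := sqr_sqrtr (ltW g0).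
  move: fE gE sf0 sg0; set x := Num.sqrt f; set y := Num.sqrt g => fE gE x0 y0.
  have -> : f * (2 * (y / x - 1)) = - (x - y) ^+ 2 + (y ^+ 2 - x ^+ 2).
    by rewrite -fE; field; rewrite gt_eqF.
  by rewrite fE gE.
rewrite ler_wpM2l// -ln_div ?posrE//.
apply: (le_trans (ln_le _ _)); first by rewrite divr_gt0.
by rewrite lerBlDr lerDl.
Qed.

(** * Hellinger gap away from the true phase *)

Section FarFromTheTruth.
Context (R : realType).
Local Notation mu := (@lebesgue_measure R).
Variables (s l rt b ph c : R) (r : R -> R).
Hypothesis s0 : 0 < s.
Hypothesis b0 : 0 < b.
Hypothesis c0 : 0 < c.
Hypothesis c1 : c <= 1.
Hypothesis hl : 107 / 100 * s <= ph - l.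
Hypothesis hr : 107 / 100 * s <= rt - ph.
Local Notation pk := (normal_peak s).
Hypothesis bpk : b <= pk.
Hypothesis br : bcfun r.
Hypothesis r0 : forall x, 0 <= r x.
Local Notation I f := (Rintegral mu [set` `[l, rt]] f).
Local Notation Z := (spikeZ s l rt b).
Local Notation De := (expR (- (c / 4) ^+ 2 / 2) - expR (- (3 * c / 4) ^+ 2 / 2)).
Hypothesis hrho : I r * (12 * Z ph * pk / b) < De ^+ 2 * c / 100.
Variable th : R.
Hypothesis lth : l <= th.
Hypothesis thr : th <= rt.
Hypothesis far : c * s <= `|th - ph|.
Local Notation G th x := (gauss s (x - th)).

Let lrt : l < rt. Proof. by have := (hl, hr, s0) => -[[? ?] ?]; lra. Qed.

Let p0 : 0 < pk. Proof. exact: peak_gt0. Qed.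

Let bsp (t : R) : bcfun (spike s b t).
Proof. exact: (blip_bcfun t (blip_spike b s0)). Qed.

Let gauss_ge (k y : R) : `|y| <= k * s -> pk * expR (- k ^+ 2 / 2) <= gauss s y.
Proof.
move=> h; rewrite gaussE// ler_pM2l// ler_expR ler_pM2r// lerN2.
rewrite -[leLHS]real_normK ?num_real// lerXn2r ?nnegrE//.
  by have := normr_ge0 y => h2; have := le_trans h2 h; rewrite pmulr_lge0.
by rewrite normrM normfV (gtr0_norm s0) ler_pdivrMr.
Qed.

Let gauss_le (k y : R) : 0 <= k -> k * s <= `|y| -> gauss s y <= pk * expR (- k ^+ 2 / 2).
Proof.
move=> k0 h; rewrite gaussE// ler_pM2l// ler_expR ler_pM2r// lerN2.
rewrite -[leRHS]real_normK ?num_real// lerXn2r ?nnegrE//.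
by rewrite normrM normfV (gtr0_norm s0) ler_pdivlMr.
Qed.

Let De0 : 0 <= De.
Proof.
rewrite subr_ge0 ler_expR ler_pM2r// lerN2 lerXn2r ?nnegrE ?divr_ge0 ?mulr_ge0 ?(ltW c0)//.
by have := c0 => ?; lra.
Qed.

(** Even for [th] at an end, some subinterval of length [s] with endpoint [th] lies in the interval;
    the density there is at least [pk / 2], and [pk * s >= 1/3]. *)
Let Zth : 1 / 6 <= Z th.
Proof.
have key (a : R) : l <= a -> a + s <= rt ->
    (forall x, a <= x <= a + s -> `|x - th| <= 1 * s) -> 1 / 6 <= Z th.
  move=> la ar near.
  apply: (@le_trans _ _ (pk / 2 * (a + s - a))).
    have -> : pk / 2 * (a + s - a) = pk * s / 2 by ring.
    by have := peak_ge s0; lra.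
  apply: (itvint_ge_sub lrt (bsp th) _ la _ ar) => [x _||x /near xs].
  - exact: ltW (spike_gt0 s0 b0 th x).
  - by rewrite ltrDl.
  - have := gauss_ge xs; rewrite expr1n => h.
    have e : 1 / 2 <= expR (- 1 / 2) :> R.
      by have := expR_ge1Dx (- 1 / 2 : R); lra.
    apply: (@le_trans _ _ (pk * expR (- 1 / 2))).
      by rewrite ler_pM2l//; lra.
    by apply: (le_trans h); rewrite /spike lerDl ltW.
have [h|h] := leP (th + s) rt.
  apply: (key th) => // x /andP[h1 h2].
  by rewrite mul1r ler_norml; apply/andP; split; have := s0 => ?; lra.
apply: (key (th - s)).
- by have := (hl, hr, s0) => -[[? ?] ?]; lra.
- by rewrite subrK.
- move=> x /andP[h1 h2].
  by rewrite mul1r ler_norml; apply/andP; split; have := s0 => ?; lra.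
Qed.

(* With this factor, la * spike th and spike ph have the same integral. *)
Let la := Z ph / Z th.

Let Zph0 : 0 < Z ph. Proof. exact: spikeZ_gt0. Qed.

Let Zth0 : 0 < Z th. Proof. exact: spikeZ_gt0. Qed.

Let la0 : 0 < la. Proof. exact: divr_gt0 Zph0 Zth0. Qed.

Let ln_la : ln la = ln (Z ph) - ln (Z th).
Proof.
by rewrite /la; move: (Z ph) (Z th) Zph0 Zth0 => u v u0 v0; rewrite ln_div ?posrE.
Qed.

Let laZ : la * Z th - Z ph = 0.
Proof.
rewrite /la; move: (Z ph) (Z th) Zth0 => u v v0.
by rewrite divfK ?subrr// gt_eqF.
Qed.

Let la_le : la <= 6 * Z ph.
Proof.
rewrite /la; move: (Z ph) (Z th) Zph0 Zth0 Zth => u v u0 v0 v6.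
rewrite ler_pdivrMr// mulrAC -[leLHS]mul1r ler_pM2r//; lra.
Qed.

Let hel x := (Num.sqrt (spike s b ph x) - Num.sqrt (la * spike s b th x)) ^+ 2.

Let bhel : bcfun hel.
Proof.
apply: bcfunX; apply: bcfunB; first exact: bcfun_sqrt.
by apply: bcfun_sqrt; exact: bcfunZ.
Qed.

Let spike2 (t x : R) : spike s b t x <= 2 * pk.
Proof. by apply: (le_trans (spike_le b s0 t x)); have := bpk => ?; lra. Qed.

(** Within [c * s / 4] of one centre, hence at least [3 * c * s / 4] from the other, the Gaussians
    differ by at least [pk * De]. If [la <= 1] this is used near [ph], where scaling the smaller
    density by [la] only lowers it; otherwise near [th], with the roles exchanged. *)
Let hel_ge : De ^+ 2 * c / 100 <= I hel.
Proof.
have pks := peak_ge s0.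
have D2 : 0 <= De ^+ 2 * c by rewrite mulr_ge0 ?sqr_ge0// ltW.
have key (a e : R) : l <= a -> a + e <= rt -> c * s / 4 <= e ->
    (forall x, a <= x <= a + e -> pk * De ^+ 2 / 8 <= hel x) ->
    De ^+ 2 * c / 100 <= I hel.
  move=> la' ar ce hx.
  have e0 : 0 < e by apply: lt_le_trans ce; rewrite divr_gt0// mulr_gt0.
  apply: (@le_trans _ _ (pk * De ^+ 2 / 8 * (a + e - a))); last first.
    apply: (itvint_ge_sub lrt bhel _ la' _ ar) => [x _||//]; first exact: sqr_ge0.
    by rewrite ltrDl.
  apply: (@le_trans _ _ (pk * De ^+ 2 / 8 * (c * s / 4))); last first.
    by rewrite ler_wpM2l ?addrK// ?divr_ge0 ?mulr_ge0 ?sqr_ge0 ?(ltW p0)//; lra.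
  have -> : pk * De ^+ 2 / 8 * (c * s / 4) = De ^+ 2 * c * (pk * s) / 32.
    by move: De (normal_peak s) => D p; field.
  have := ler_wpM2l D2 pks; lra.
have dist (x y z : R) : `|x - y| <= c / 4 * s -> c * s <= `|y - z| ->
    pk * De <= G y x - G z x.
  move=> xy yz.
  have xz : 3 * c / 4 * s <= `|x - z|.
    have : `|y - z| <= `|x - y| + `|x - z|.
      by rewrite (distrC x y); exact: ler_distD.
    by lra.
  have k0 : 0 <= 3 * c / 4 by rewrite divr_ge0 ?mulr_ge0 ?(ltW c0).
  by have := gauss_ge xy; have := gauss_le k0 xz; lra.
have cs1 : c * s <= s by rewrite ger_pMl.
have cs0 : 0 < c * s by rewrite mulr_gt0.
have [la1|la1] := leP la 1.
  apply: (key (ph - c * s / 4) (c * s / 2)).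
  - by have := hl => ?; lra.
  - by have := hr => ?; lra.
  - lra.
  move=> x /andP[x1 x2].
  have xph : `|x - ph| <= c / 4 * s.
    by rewrite ler_norml; apply/andP; split; lra.
  have h : pk * De <= G ph x - G th x by apply: dist => //; rewrite distrC.
  have g0 := spike_gt0 s0 b0 th x.
  have -> : pk * De ^+ 2 / 8 = (pk * De) ^+ 2 / (4 * (2 * pk)).
    by move: De => D; field; rewrite gt_eqF.
  have pD : 0 <= pk * De by rewrite mulr_ge0 ?De0 ?(ltW p0).
  apply: sqr_sqrt_diff_ge => //; first exact: ltW (mulr_gt0 la0 g0).
  - apply: (@le_trans _ _ (spike s b th x + pk * De)).
      by rewrite lerD2r ger_pMl.
    by rewrite /spike; move: h; set k := pk * De; lra.
  - by rewrite mulr_gt0.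
have mid (x : R) : `|x - th| <= c / 4 * s -> pk * De ^+ 2 / 8 <= hel x.
  move=> xth.
  have h : pk * De <= G th x - G ph x by apply: dist.
  have f0 := spike_gt0 s0 b0 ph x; have g0 := spike_gt0 s0 b0 th x.
  rewrite /hel -[leRHS]sqrrN [X in _ <= X ^+ 2]opprB.
  apply: (@le_trans _ _ ((la * (pk * De)) ^+ 2 / (4 * (la * (2 * pk))))).
    have -> : (la * (pk * De)) ^+ 2 / (4 * (la * (2 * pk))) = la * (pk * De ^+ 2 / 8).
      by move: De => D; field; rewrite !gt_eqF.
    by rewrite ler_peMl ?(ltW la1)// divr_ge0// mulr_ge0 ?sqr_ge0 ?(ltW p0).
  have pD : 0 <= pk * De by rewrite mulr_ge0 ?De0 ?(ltW p0).
  apply: sqr_sqrt_diff_ge; [exact: ltW|exact: mulr_ge0 (ltW la0) pD| | |].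
  - apply: (@le_trans _ _ (la * (spike s b ph x + pk * De))).
      by rewrite (mulrDr la) lerD2r ler_peMl ?(ltW la1) ?(ltW f0).
    by rewrite ler_pM2l// /spike; move: h; set k := pk * De; lra.
  - by apply: mulr_gt0 => //; exact: mulr_gt0.
  - by rewrite ler_pM2l.
(* [th] may be an endpoint, so the window of length [c * s / 4] is taken on a side that has room. *)
have [h|h] := leP (th + c * s / 4) rt.
  apply: (key th (c * s / 4)) => // x /andP[h1 h2].
  by apply: mid; rewrite ler_norml; apply/andP; split; lra.
apply: (key (th - c * s / 4) (c * s / 4)).
- by have := (hl, hr, s0) => -[[? ?] ?]; lra.
- by rewrite subrK.
- by [].
- move=> x /andP[h1 h2].
  by apply: mid; rewrite ler_norml; apply/andP; split; lra.
Qed.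

(** By the choice of [la] the term [la * spike th - spike ph] integrates to 0, leaving minus the
    Hellinger integral plus [K] times the mass of [r]. *)
Lemma logmodel_gap :
  I (fun x => (spike s b ph x + r x) * logmodel s l rt b th x) <
  I (fun x => (spike s b ph x + r x) * logmodel s l rt b ph x).
Proof.
have bn : bcfun (fun x => spike s b ph x + r x) by exact: bcfunD.
have bl (t : R) : bcfun (logmodel s l rt b t) by exact: bcfun_logmodel.
rewrite -subr_lt0 -(itvintB lrt (bcfunM bn (bl th)) (bcfunM bn (bl ph))).
(* Bounds the ratio of [la * spike th] to [spike ph]: [la <= 6 * Z ph], the numerator's spike is at
   most [2 * pk], and the denominator is at least [b]. *)
pose K := 12 * Z ph * pk / b.
have bg : bcfun (fun x => la * spike s b th x) by exact: bcfunZ.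
apply: (@le_lt_trans _ _ (I (fun x =>
    (- hel x + (la * spike s b th x - spike s b ph x)) + K * r x))).
  apply: (itvint_le lrt).
  - by apply: bcfunB; exact: bcfunM.
  - by apply: bcfunD; [apply: bcfunD; [exact: bcfunN|exact: bcfunB]|exact: bcfunZ].
  move=> x _; have f0 := spike_gt0 s0 b0 ph x; have g0 := spike_gt0 s0 b0 th x.
  rewrite -mulrBr.
  have -> : logmodel s l rt b th x - logmodel s l rt b ph x =
      ln (la * spike s b th x) - ln (spike s b ph x).
    have aux (u v y z : R) : y - v - (z - u) = u - v + y - z by ring.
    have -> : ln (la * spike s b th x) = ln la + ln (spike s b th x).
      by move: (la) (spike s b th x) la0 g0 => u v u0 v0; rewrite lnM ?posrE.
    by rewrite ln_la; exact: aux.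
  have lg0 : 0 < la * spike s b th x by rewrite mulr_gt0.
  apply: (le_trans (mul_ln_ratio_le f0 lg0 (r0 x))).
  rewrite -/(hel x) lerD2l mulrC ler_wpM2r//.
  rewrite ler_pdivrMr//; apply: (@le_trans _ _ (6 * Z ph * (2 * pk))).
    by apply: ler_pM; rewrite ?(ltW la0) ?(ltW g0).
  have -> : 6 * Z ph * (2 * pk) = K * b by rewrite /K; field; rewrite gt_eqF.
  by rewrite ler_wpM2l ?spike_ge// divr_ge0 ?mulr_ge0 ?(ltW b0) ?(ltW p0) ?(ltW Zph0).
rewrite (itvintD lrt (bcfunD (bcfunN bhel) (bcfunB bg (bsp ph))) (bcfunZ K br)).
rewrite (itvintD lrt (bcfunN bhel) (bcfunB bg (bsp ph))) (itvintB lrt bg (bsp ph)).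
rewrite (itvintZ lrt la (bsp th)) (itvintZ lrt K br).
have -> : I (fun x => - hel x) = - I hel.
  rewrite -mulN1r -(itvintZ lrt (-1) bhel); apply: itvint_eq => x _; by rewrite mulN1r.
have -> : la * I (spike s b th) - I (spike s b ph) = 0.
  exact: laZ.
rewrite addr0 [K * _]mulrC addrC subr_lt0; exact: lt_le_trans hrho hel_ge.
Qed.

End FarFromTheTruth.

Lemma between_dist (R : realType) (x y z u e : R) :
  `|z - x| <= `|y - x| -> `|z - y| <= `|y - x| ->
  `|x - u| <= e -> `|y - u| <= e -> `|z - u| <= e.
Proof.
wlog xy : x y / x <= y => [h|].
  have [xy|/ltW yx] := leP x y; first exact: h.
  by rewrite (distrC y x) => h1 h2 h3 h4; apply: (h y x).
rewrite [`|y - x|]ger0_norm ?subr_ge0//.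
move=> /ler_normlP[? ?] /ler_normlP[? ?] /ler_normlP[? ?] /ler_normlP[? ?].
by rewrite ler_norml; apply/andP; split; lra.
Qed.

Lemma blip_bcfun_cst (R : realType) (f : R -> R) : bcfun f -> blip (fun _ => f).
Proof.
move=> [cf [C fC]]; split=> //; exists `|C|; split=> [_ x|th th' x].
  by apply: (le_trans (fC x)); exact: ler_norm.
by rewrite subrr normr0 mulr_ge0.
Qed.

(** * The unique maximizer of the expected log-likelihood *)

Section PopulationLikelihood.
Context (R : realType).
Local Notation mu := (@lebesgue_measure R).
Variables (s l rt b ph : R) (r : R -> R).
Hypothesis s0 : 0 < s.
Hypothesis b0 : 0 < b.
Hypothesis hl : 107 / 100 * s <= ph - l.
Hypothesis hr : 107 / 100 * s <= rt - ph.
Hypothesis hbig : 325 / 100 * s <= ph - l \/ 325 / 100 * s <= rt - ph.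
Local Notation pk := (normal_peak s).
Hypothesis hb : Num.sqrt (b / pk) <= 1 / 1000.
Hypothesis br : bcfun r.
Hypothesis r0 : forall x, 0 <= r x.
Local Notation I f := (Rintegral mu [set` `[l, rt]] f).
Hypothesis hrho : I r * (2 * pk / b) <= 1 / 1000.
(** In units of [s], the radius at which the Hellinger gap hands over to the curvature bound. *)
Let c : R := 1 / 1000 / 1000.
Hypothesis hgap : I r * (12 * spikeZ s l rt b ph * pk / b) <
  (expR (- (c / 4) ^+ 2 / 2) - expR (- (3 * c / 4) ^+ 2 / 2)) ^+ 2 * c / 100.

Let n x := spike s b ph x + r x.
Let L th := I (fun x => n x * logmodel s l rt b th x).
Let dL th := I (fun x => n x * score s l rt b th x).
Let ddL th := I (fun x => n x * dscore s l rt b th x).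

Let lrt : l < rt. Proof. by have := (hl, hr, s0) => -[[? ?] ?]; lra. Qed.
Let lph : l <= ph. Proof. by have := (hl, s0) => -[? ?]; lra. Qed.
Let phr : ph <= rt. Proof. by have := (hr, s0) => -[? ?]; lra. Qed.
Let p0 : 0 < pk. Proof. exact: peak_gt0. Qed.
Let c0 : 0 < c. Proof. by rewrite /c; lra. Qed.
Let c1 : c <= 1. Proof. by rewrite /c; lra. Qed.

Let bpk : b <= pk.
Proof.
have q0 : 0 <= b / pk by rewrite divr_ge0// ltW.
have : b / pk <= 1.
  by rewrite -(sqr_sqrtr q0) exprn_ile1 ?sqrtr_ge0//; have := hb => ?; lra.
by rewrite ler_pdivrMr// mul1r.
Qed.

Let bn : bcfun n.
Proof. by apply: bcfunD => //; exact: (blip_bcfun ph (blip_spike b s0)). Qed.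

Let n0 x : 0 < n x.
Proof. by rewrite ltr_wpDr// spike_gt0. Qed.

Lemma blip_logmodel : blip (logmodel s l rt b).
Proof.
have [_ [C1 [sC _]]] := blip_score s0 lrt b0.
have w0 : 0 < rt - l by rewrite subr_gt0.
have ln_bound (u a A : R) : 0 < a -> a <= u -> u <= A -> `|ln u| <= `|ln a| + `|ln A|.
  move=> a0 au uA; have u0 := lt_le_trans a0 au.
  have : ln a <= ln u by rewrite ler_ln.
  have : ln u <= ln A by rewrite ler_ln// posrE (lt_le_trans u0).
  have := ler_norm (ln A); have := ler_norm (- ln a).
  have := normr_ge0 (ln a); have := normr_ge0 (ln A).
  rewrite normrN => q1 q2 q3 q4 q5 q6.
  by rewrite ler_norml; apply/andP; split; lra.
have fC th x := ln_bound _ _ _ b0 (spike_ge b s0 th x) (spike_le b s0 th x).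
have Zle th : spikeZ s l rt b th <= (pk + b) * (rt - l).
  rewrite -(itvint_cst lrt); apply: (itvint_le lrt) => [||x _].
  - exact: (blip_bcfun th (blip_spike b s0)).
  - exact: bcfun_cst.
  - exact: spike_le.
have ZC th := ln_bound _ _ _ (mulr_gt0 b0 w0) (spikeZ_ge b s0 lrt th) (Zle th).
apply: (blip_derive (der_logmodel s0 lrt b0) _ _ sC).
  by move=> th; have [] : bcfun (logmodel s l rt b th) by exact: bcfun_logmodel.
move=> th x; apply: (le_trans (ler_normB _ _)); apply: lerD; [exact: fC|exact: ZC].
Qed.

Let blip_n k : blip k -> blip (fun th x => n x * k th x).
Proof. by move=> bk; apply: blipM => //; exact: blip_bcfun_cst. Qed.

Let der_n f a (x th : R) : is_derive th 1 f a ->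
  is_derive th 1 (fun th => n x * f th) (n x * a).
Proof.
move=> fa; apply: (is_derive_eq (der_mul (is_derive_cst (n x) th 1) fa)).
by rewrite mul0r add0r.
Qed.

Let der_L (th : R) : is_derive th 1 L (dL th).
Proof.
apply: (derive_itvint lrt th (blip_n blip_logmodel) (blip_n (blip_score s0 lrt b0))).
move=> x t; apply: (@der_n (fun t => logmodel s l rt b t x)).
exact: der_logmodel.
Qed.

Let der_dL (th : R) : is_derive th 1 dL (ddL th).
Proof.
apply: (derive_itvint lrt th (blip_n (blip_score s0 lrt b0)) (blip_n (blip_dscore s0 lrt b0))).
move=> x t; apply: (@der_n (fun t => score s l rt b t x)).
exact: der_score.
Qed.

Let ddL_lt0 th : `|th - ph| <= c * s -> 32 / 100 <= s ^+ 2 * - ddL th.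
Proof.
move=> h; apply: (information_ge s0 b0 hl hr hbig hb br r0 hrho).
by apply: (le_trans h); rewrite /c; lra.
Qed.

Let argmax_near th : l <= th <= rt -> L ph <= L th -> `|th - ph| < c * s.
Proof.
move=> /andP[h1 h2]; apply: contraTT; rewrite -leNgt -ltNge => far.
exact: (logmodel_gap s0 b0 c0 c1 hl hr bpk br r0 hgap h1 h2 far).
Qed.

Let critical th : l <= th <= rt -> (forall t, l <= t <= rt -> L t <= L th) ->
  `|th - ph| < c * s /\ dL th = 0.
Proof.
move=> thD thmax.
have near : `|th - ph| < c * s.
  have phD : l <= ph <= rt by have := (hl, hr, s0) => -[[? ?] ?]; lra.
  exact: (argmax_near thD (thmax _ phD)).
split; first exact: near.
have thI : th \in `]l, rt[.
  rewrite in_itv/=; move: near; rewrite /c => /ltr_normlP[? ?].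
  by have := (hl, hr, s0) => -[[? ?] ?]; lra.
have h : is_derive th 1 L 0.
  apply: (derive1_at_max (ltW lrt) _ thI) => [t _|t].
    by have [] := der_L t.
  by rewrite in_itv/= => /andP[? ?]; apply: thmax; lra.
by have [_ <-] := der_L th; have [_ ->] := h.
Qed.

(** Existence by compactness. Every maximizer is near [ph], hence interior and critical; two of them
    would force the derivative of the slope [dL] to vanish in between, where it is negative. The
    bias is the slope at [ph] over the curvature, whence the factor 100/32. *)
Lemma ex_maximizer : exists phis : R,
  [/\ l < phis < rt /\ `|phis - ph| <= s / 1000 / 1000,
      I (fun x => n x * score s l rt b phis x) = 0,
      forall th, l <= th <= rt -> th != phis ->
        I (fun x => n x * logmodel s l rt b th x) <
        I (fun x => n x * logmodel s l rt b phis x)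
    & `|ph - phis| <= I r * (rt - l) * (100 / 32)].
Proof.
have cL : {within `[l, rt], continuous L}.
  by apply: continuous_subspaceT; exact: (is_derive_continuous der_L).
have [phis + phismax'] := EVT_max (ltW lrt) cL.
rewrite in_itv/= => phisD.
have phismax t : l <= t <= rt -> L t <= L phis.
  by move=> tD; apply: phismax'; rewrite in_itv.
have [near dL0] := critical phisD phismax.
have E : c * s = s / 1000 / 1000 by rewrite /c; lra.
have strict th : l <= th <= rt -> th != phis -> L th < L phis.
  move=> thD; apply: contraNT; rewrite -leNgt => h.
  have thmax t : l <= t <= rt -> L t <= L th.
    by move=> tD; exact: (le_trans (phismax _ tD) h).
  have [near' dL0'] := critical thD thmax.
  have [xi [h1 h2]] := mean_value phis th der_dL.
  have xin : `|xi - ph| <= c * s by apply: (between_dist h1 h2); exact: ltW.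
  rewrite dL0 dL0' subrr => /esym/eqP; rewrite mulf_eq0 => /orP[/eqP d0|].
    by have := ddL_lt0 xin; rewrite d0 oppr0 mulr0 leNgt divr_gt0.
  by rewrite subr_eq0.
exists phis; split; [|exact: dL0|exact: strict|].
- rewrite -E ltW//; split=> //; move: near; rewrite /c => /ltr_normlP[? ?].
  by have := (hl, hr, s0) => -[[? ?] ?]; lra.
- have [xi [h1 h2]] := mean_value phis ph der_dL.
  have xin : `|xi - ph| <= c * s.
    by apply: (between_dist h1 h2); [exact: ltW|rewrite subrr normr0 mulr_ge0// ltW].
  rewrite dL0 subr0 => h3.
  have h4 : `|dL ph| <= I r * ((rt - l) / s ^+ 2) by exact: itvint_score_le.
  rewrite h3 normrM in h4.
  have s2 : 0 < s ^+ 2 by rewrite exprn_gt0.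
  have h5 : 32 / 100 * `|ph - phis| <= s ^+ 2 * `|ddL xi| * `|ph - phis|.
    rewrite ler_wpM2r//; apply: (le_trans (ddL_lt0 xin)).
    by rewrite ler_pM2l// -normrN ler_norm.
  have h6 : s ^+ 2 * `|ddL xi| * `|ph - phis| <= I r * (rt - l).
    rewrite -mulrA; apply: (le_trans (ler_wpM2l (ltW s2) h4)).
    by rewrite !(mulrCA (s ^+ 2)) divff ?gt_eqF// mulr1.
  have := le_trans h5 h6; rewrite mulrC -ler_pdivlMr ?divr_gt0//.
  by rewrite invf_div.
Qed.

(** The score is [gk1 / spike] minus a constant. As its mean is zero at [th], its second moment is
    at most that of the uncentred ratio, which is the integral of [sqscore]. *)
Lemma score_sqr_le th : `|th - ph| <= s / 1000 / 1000 ->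
  I (fun x => n x * score s l rt b th x) = 0 ->
  s ^+ 2 * I (fun x => n x * score s l rt b th x ^+ 2) <= 101 / 100.
Proof.
move=> hth h0; apply: le_trans (num_sqscore_le s0 b0 hl hr br r0 hrho hth).
have bs := blip_bcfun th (blip_score s0 lrt b0).
have bns : bcfun (fun x => n x * score s l rt b th x) by exact: bcfunM.
have bq : bcfun (sqscore s b th).
  apply: bcfunZ; apply: bcfunX; apply: bcfunM.
    exact: (blip_bcfun th (blip_gk1 s0)).
  exact: (blip_bcfun th (blip_spikeV s0 b0)).
pose k := spikeZ1 s l rt th / spikeZ s l rt b th.
rewrite -(itvintZ lrt); last by apply: bcfunM => //; exact: bcfunX.
have -> : I (fun x => (spike s b ph x + r x) * sqscore s b th x) =
    I (fun x => (spike s b ph x + r x) * sqscore s b th x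
       - 2 * k * s ^+ 2 * (n x * score s l rt b th x)).
  by rewrite (itvintB lrt (bcfunM bn bq) (bcfunZ _ bns)) (itvintZ lrt _ bns) h0 mulr0 subr0.
apply: (itvint_le lrt).
- by apply: bcfunZ; apply: bcfunM => //; exact: bcfunX.
- by apply: bcfunB; [exact: bcfunM|exact: bcfunZ].
move=> x _; rewrite -/(n x) /sqscore /score -/k.
set A := gk1 s th x / _.
rewrite -subr_ge0.
have -> : n x * (s ^+ 2 * A ^+ 2) - 2 * k * s ^+ 2 * (n x * (A - k)) -
    s ^+ 2 * (n x * (A - k) ^+ 2) = n x * (s * k) ^+ 2 by ring.
by rewrite mulr_ge0 ?sqr_ge0// ltW.
Qed.

End PopulationLikelihood.

Lemma bcfun_sum (R : realType) (J : Type) (q : seq J) (P : pred J) (f : J -> R -> R) :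
  (forall j, bcfun (f j)) -> bcfun (fun x => \sum_(j <- q | P j) f j x).
Proof.
move=> bf; elim: q => [|j q ih].
  under eq_fun do rewrite big_nil; exact: bcfun_cst.
under eq_fun do rewrite big_cons; case: (P j) => //; exact: bcfunD.
Qed.

Lemma itvint_sum (R : realType) (l rt : R) (J : Type) (q : seq J) (P : pred J)
    (f : J -> R -> R) : l < rt -> (forall j, bcfun (f j)) ->
  Rintegral (@lebesgue_measure R) [set` `[l, rt]] (fun x => \sum_(j <- q | P j) f j x) =
  \sum_(j <- q | P j) Rintegral (@lebesgue_measure R) [set` `[l, rt]] (f j).
Proof.
move=> lrt bf; elim: q => [|j q ih].
  rewrite big_nil (itvint_eq (g := fun=> 0)); last by move=> x _; rewrite big_nil.
  by rewrite itvint_cst// mul0r.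
rewrite big_cons -ih; case: ifPn => Pj.
  rewrite -(itvintD lrt (bf j) (bcfun_sum q P bf)); apply: itvint_eq => x _.
  by rewrite big_cons Pj.
by apply: itvint_eq => x _; rewrite big_cons (negbTE Pj).
Qed.

(** * Far Gaussians and the mass of the kernel *)

Section GaussianBounds.
Context (R : realType).
Local Notation mu := (@lebesgue_measure R).
Variable s : R.
Hypothesis s0 : 0 < s.
Local Notation pk := (normal_peak s).

Lemma gauss_anti (y z : R) : 0 <= y -> y <= z -> gauss s z <= gauss s y.
Proof.
move=> y0 yz; rewrite !gaussE// ler_pM2l ?peak_gt0// ler_expR ler_pM2r//.
rewrite lerN2 lerXn2r ?nnegrE ?divr_ge0 ?(ltW s0) ?(le_trans y0 yz)//.
by rewrite ler_pM2r ?invr_gt0.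
Qed.

(** The primitive of the tail bound again, on a bounded interval at distance at least [d] from the
    centre. *)
Lemma itvint_gauss_far (l rt d u : R) : l < rt -> 0 < d ->
  (u <= l - d \/ rt + d <= u) ->
  Rintegral mu [set` `[l, rt]] (fun x => gauss s (x - u)) <= s ^+ 2 / d * gauss s d.
Proof.
move=> lrt d0 hu.
have bG : bcfun (fun x => gauss s (x - u)) := blip_bcfun u (blip_gauss s0).
have bk : bcfun (gk1 s u) := blip_bcfun u (blip_gk1 s0).
have sd0 : 0 < s ^+ 2 / d by rewrite divr_gt0// exprn_gt0.
have E : Rintegral mu [set` `[l, rt]] (gk1 s u) = gauss s (l - u) - gauss s (rt - u).
  have dk (x : R) : is_derive x 1 (fun x => 0 - gauss s (x - u)) (gk1 s u x).
    apply: (is_derive_eq (der_sub (is_derive_cst 0 x 1) (der_gauss_x s0 u x))).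
    by rewrite sub0r opprK.
  by rewrite (itvint_ftc lrt dk bk.1) !sub0r opprK addrC.
have gkE x : s ^+ 2 / d * gk1 s u x = (x - u) / d * gauss s (x - u).
  by rewrite /gk1; field; rewrite !gt_eqF.
have g1 := gauss_gt0 s0 (l - u); have g2 := gauss_gt0 s0 (rt - u).
case: hu => hu.
- apply: (@le_trans _ _ (Rintegral mu [set` `[l, rt]] (fun x => s ^+ 2 / d * gk1 s u x))).
    apply: (itvint_le lrt bG (bcfunZ _ bk)) => x /andP[lx _].
    rewrite gkE ler_peMl ?(ltW (gauss_gt0 s0 _))// ler_pdivlMr// mul1r; lra.
  rewrite (itvintZ lrt _ bk) E ler_pM2l//.
  by apply: (@le_trans _ _ (gauss s (l - u))); [lra|apply: gauss_anti; lra].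
- apply: (@le_trans _ _ (Rintegral mu [set` `[l, rt]] (fun x => - (s ^+ 2 / d) * gk1 s u x))).
    apply: (itvint_le lrt bG (bcfunZ _ bk)) => x /andP[_ xr].
    rewrite mulNr gkE -mulNr ler_peMl ?(ltW (gauss_gt0 s0 _))//.
    by rewrite -mulNr ler_pdivlMr// mul1r; lra.
  rewrite (itvintZ lrt _ bk) E mulNr -mulrN ler_pM2l// opprB.
  apply: (@le_trans _ _ (gauss s (rt - u))); first by lra.
  by rewrite -(gaussN s0); apply: gauss_anti; lra.
Qed.

Let mE : gauss_mass s = Rintegral mu [set` `[- pi, pi]] (fun x => gauss s (x - 0)).
Proof.
rewrite /gauss_mass; under [RHS]eq_Rintegral do rewrite subr0.
have p0 := pi_gt0 R.
have lp : - pi < pi :> R by lra.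
have itg : mu.-integrable [set` `[- pi, pi]] (EFin \o gauss s).
  apply: itv_integrable => //.
  have := blip_bcfun 0 (blip_gauss s0); by under eq_fun do rewrite subr0.
have sub (b1 b2 : bool) : measurable_fun
    [set` Interval (BSide b1 (- pi)) (BSide b2 pi)] (EFin \o gauss s).
  apply: (measurable_funS _ _ (measurable_int _ itg)) => // x /=.
  rewrite !itv_boundlr => /andP[h1 h2]; apply/andP; split.
  - by apply: le_trans h1; rewrite bnd_simp.
  - by apply: (le_trans h2); rewrite bnd_simp; case: (b2).
rewrite /Rintegral; congr fine; rewrite -integral_itv_obnd_cbnd ?integral_itv_bndo_bndc//.
Qed.

Lemma gauss_mass_le1 : gauss_mass s <= 1.
Proof.
have p0 := pi_gt0 R; rewrite mE.
rewrite (itvint_eq (g := normal_pdf 0 s)); last by move=> x _; exact: gauss_pdf.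
by apply: itvint_pdf_le1; rewrite ?gt_eqF// gtrN.
Qed.

Lemma gauss_mass_ge_half : s <= pi / 3 -> 1 / 2 <= gauss_mass s.
Proof.
move=> sp; have p0 := pi_gt0 R; rewrite mE.
have h := @gauss_mass_ge _ s s0 (- pi) pi 0 ltac:(lra) ltac:(lra).
apply: le_trans h; rewrite sub0r opprK subr0.
have h2 : s ^+ 2 / pi * gauss s pi <= 1 / 3 * (41 / 100).
  have -> : s ^+ 2 / pi * gauss s pi = s / pi * (gauss s pi * s).
    by move: (@pi R) p0 => y y0; field; rewrite gt_eqF.
  apply: ler_pM.
  - exact: divr_ge0 (ltW s0) (ltW p0).
  - by rewrite mulr_ge0 ?(ltW (gauss_gt0 s0 _))// ltW.
  - by rewrite ler_pdivrMr// mulrC mul1r.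
  - by apply: le_trans (peak_le s0); rewrite ler_pM2r// gauss_le_peak.
lra.
Qed.

End GaussianBounds.

Lemma pi_le4 (R : realType) : pi <= 4 :> R.
Proof. by have /andP[_] := @pihalf_02 R; lra. Qed.

(** A Gaussian value can be small because [s] is small, because [s] is large or because [d] is
    large; the bounds 4/3 and 4 leave only the first. If [s > d] the value is at least 1/8, and if
    [s > delta] the exponent is bounded. *)
Lemma small_gauss (R : realType) (delta : R) : 0 < delta ->
  exists eps : R, 0 < eps /\ forall s d : R, 0 < s -> s <= 4 / 3 -> 0 < d -> d <= 4 ->
    gauss s d < eps -> s <= d /\ s <= delta.
Proof.
move=> de0; pose e1 : R := 1 / 8; pose e2 : R := 1 / 4 * expR (- (4 / delta) ^+ 2 / 2).
exists (Num.min e1 e2); split.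
  by rewrite lt_min !divr_gt0//= mulr_gt0 ?expR_gt0.
move=> s d s0 s43 d0 d4; rewrite lt_min => /andP[h1 h2].
have p0 := peak_gt0 s0.
have pk4 : 1 / 4 <= normal_peak s.
  have := peak_ge s0; have : normal_peak s * s <= normal_peak s * (4 / 3) by rewrite ler_pM2l.
  lra.
split; rewrite leNgt; apply/negP => h.
- move: h1; apply/negP; rewrite -leNgt gaussE// /e1.
  apply: (@le_trans _ _ (1 / 4 * (1 / 2))); first by lra.
  apply: ler_pM => //; rewrite ?divr_ge0//.
  have ds : d / s <= 1 by rewrite ler_pdivrMr// mul1r ltW.
  have ds2 : (d / s) ^+ 2 <= 1 by rewrite exprn_ile1// divr_ge0// ltW.
  apply: le_trans (expR_ge1Dx _); lra.
- move: h2; apply/negP; rewrite -leNgt gaussE// /e2.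
  apply: ler_pM => //; rewrite ?expR_ge0//.
  have ds0 : 0 <= d / s by rewrite divr_ge0// ltW.
  have de4 : 0 <= 4 / delta by rewrite divr_ge0// ltW.
  rewrite ler_expR ler_pM2r// lerN2 lerXn2r ?nnegrE//.
  apply: ler_pM => //; rewrite ?invr_ge0 ?(ltW d0) ?(ltW s0)//.
  by rewrite lef_pV2 ?posrE// ltW.
Qed.

(** The flat part of the model over the weight [F * a0 / gauss_mass s] of its Gaussian. *)
Definition noise_floor (R : realType) (F a0 s : R) : R :=
  gauss_mass s / (2 * pi) * ((1 - F) / (F * a0)).

Definition excited (R : realType) (n : nat) (phi a : 'I_n.+1 -> R) (s x : R) : R :=
  \sum_(j < n.+1 | j != ord0) a j / a ord0 * gauss s (x - phi j).

(** * The estimator *)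

Section Identification.
Context (R : realType).
Local Notation mu := (@lebesgue_measure R).
Variables (F : R) (n : nat) (phi a : 'I_n.+1 -> R) (guess w s : R).
Hypothesis F0 : 0 < F.
Hypothesis F1 : F < 1.
Hypothesis a0 : 0 < a ord0.
Hypothesis s0 : 0 < s.
Hypothesis w0 : 0 < w.
Hypothesis m0 : 0 < gauss_mass s.
Local Notation l := (guess - w / 2).
Local Notation rt := (guess + w / 2).
Local Notation I f := (Rintegral mu [set` `[l, rt]] f).
Local Notation b := (noise_floor F (a ord0) s).
Local Notation r := (excited phi a s).

Let lrt : l < rt. Proof. by have := w0; lra. Qed.
Let wE : rt - l = w. Proof. lra. Qed.
Let bG (u : R) : bcfun (fun x => gauss s (x - u)) := blip_bcfun u (blip_gauss s0).

Lemma noise_floor_gt0 : 0 < b.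
Proof.
by rewrite mulr_gt0// divr_gt0 ?mulr_gt0 ?pi_gt0// subr_gt0.
Qed.

Lemma bcfun_excited : bcfun r.
Proof. by apply: bcfun_sum => j; exact: bcfunZ. Qed.

Lemma excited_ge0 (a_ge0 : forall j, 0 <= a j) x : 0 <= r x.
Proof.
apply: sumr_ge0 => j _.
by rewrite mulr_ge0 ?divr_ge0 ?(ltW a0)// ltW// gauss_gt0.
Qed.

Let floorE : F * a ord0 / gauss_mass s * b = (1 - F) * (1 / (2 * pi)).
Proof.
rewrite /noise_floor; move: (@pi R) (pi_gt0 R) => y y0.
move: (gauss_mass s) m0 => m m0'; field.
by rewrite !gt_eqF.
Qed.

Let ZE th : spikeZ s l rt b th = I (fun x => gauss s (x - th)) + b * w.
Proof. by rewrite /spikeZ (itvintD lrt)//; [rewrite itvint_cst ?wE|exact: bcfun_cst]. Qed.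

Lemma model_spike th x :
  model F (a ord0) guess w s th x = spike s b th x / spikeZ s l rt b th.
Proof.
have c0 : F * a ord0 / gauss_mass s != 0 by rewrite mulf_neq0 ?invr_eq0 ?mulf_neq0 ?gt_eqF.
rewrite /model /data_interval /gauss_kernel.
have -> : I (fun y => gauss s (y - th) / gauss_mass s) =
    (gauss_mass s)^-1 * I (fun x => gauss s (x - th)).
  by rewrite -(itvintZ lrt _ (bG th)); apply: itvint_eq => y _; rewrite mulrC.
rewrite ZE /spike.
have -> : (1 - F) * (w / (2 * pi)) = F * a ord0 / gauss_mass s * (b * w).
  by rewrite mulrA floorE; ring.
rewrite -floorE.
have -> : F * a ord0 * (gauss s (x - th) / gauss_mass s) +
    F * a ord0 / gauss_mass s * b =
    F * a ord0 / gauss_mass s * (gauss s (x - th) + b) by ring.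
have -> : F * a ord0 * ((gauss_mass s)^-1 * I (fun x => gauss s (x - th))) +
    F * a ord0 / gauss_mass s * (b * w) =
    F * a ord0 / gauss_mass s * (I (fun x => gauss s (x - th)) + b * w) by ring.
by rewrite invfM mulrACA mulfV// mul1r.
Qed.

Lemma ln_model th x : ln (model F (a ord0) guess w s th x) = logmodel s l rt b th x.
Proof.
rewrite model_spike /logmodel ln_div// posrE.
  by rewrite spike_gt0// noise_floor_gt0.
by rewrite spikeZ_gt0// noise_floor_gt0.
Qed.

Lemma itvint_excited : I r = \sum_(j < n.+1 | j != ord0) a j / a ord0 * I (fun x => gauss s (x - phi j)).
Proof.
rewrite /excited (itvint_sum _ _ lrt); last by move=> j; exact: bcfunZ.
by apply: eq_bigr => j _; rewrite (itvintZ lrt).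
Qed.

Lemma itvint_spike_excited : I (fun x => spike s b (phi ord0) x + r x) =
  spikeZ s l rt b (phi ord0) + I r.
Proof.
rewrite (itvintD lrt) //; last exact: bcfun_excited.
exact: (blip_bcfun _ (blip_spike b s0)).
Qed.

(** Data and model share the same floor, because the noise term of the density carries the factor
    [gauss_mass s] that the kernel of the model has in its denominator. The model error is therefore
    due to [excited] alone. *)
Lemma sample_density_spike x : sample_density F phi a guess w s x =
  (spike s b (phi ord0) x + r x) / I (fun x => spike s b (phi ord0) x + r x).
Proof.
have c0 : F * a ord0 != 0 by rewrite mulf_neq0 ?gt_eqF.
rewrite itvint_spike_excited ZE itvint_excited /sample_density /data_interval /spike /excited.
have split_sum (g : 'I_n.+1 -> R) : F * (\sum_j a j * g j) =
    F * a ord0 * (g ord0 + \sum_(j < n.+1 | j != ord0) a j / a ord0 * g j).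
  rewrite (bigD1 ord0)//= [in RHS]mulrDr mulrDr mulrA; congr (_ + _).
  rewrite !mulr_sumr; apply: eq_bigr => j _.
  by field; rewrite gt_eqF.
rewrite !split_sum.
have e : (1 - F) * (1 / (2 * pi)) * gauss_mass s = F * a ord0 * b.
  by rewrite -floorE; field; rewrite gt_eqF.
have -> : (1 - F) * (w / (2 * pi)) * gauss_mass s = F * a ord0 * (b * w).
  by rewrite mulrA -e; ring.
rewrite e -!mulrDr invfM mulrACA mulfV// mul1r.
by congr (_ / _); rewrite addrAC.
Qed.

End Identification.

Section Asymptotics.
Context (R : realType).
Local Notation mu := (@lebesgue_measure R).
Variables (F : R) (n : nat) (phi a : 'I_n.+1 -> R) (guess w s : R).
Hypothesis F0 : 0 < F.
Hypothesis F1 : F < 1.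
Hypothesis a0 : 0 < a ord0.
Hypothesis a_ge0 : forall j, 0 <= a j.
Hypothesis s0 : 0 < s.
Hypothesis m0 : 0 < gauss_mass s.
Local Notation ph := (phi ord0).
Local Notation l := (guess - w / 2).
Local Notation rt := (guess + w / 2).
Local Notation I f := (Rintegral mu [set` `[l, rt]] f).
Local Notation b := (noise_floor F (a ord0) s).
Local Notation r := (excited phi a s).
Local Notation pk := (normal_peak s).
Hypothesis hl : 107 / 100 * s <= ph - l.
Hypothesis hr : 107 / 100 * s <= rt - ph.
Hypothesis hbig : 325 / 100 * s <= ph - l \/ 325 / 100 * s <= rt - ph.
Hypothesis hb : Num.sqrt (b / pk) <= 1 / 1000.
Hypothesis hrho : I r * (2 * pk / b) <= 1 / 1000.
Let c : R := 1 / 1000 / 1000.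
Hypothesis hgap : I r * (12 * spikeZ s l rt b ph * pk / b) <
  (expR (- (c / 4) ^+ 2 / 2) - expR (- (3 * c / 4) ^+ 2 / 2)) ^+ 2 * c / 100.

Let lrt : l < rt. Proof. by have := (hl, hr, s0) => -[[? ?] ?]; lra. Qed.
Let w0 : 0 < w. Proof. by have := lrt; lra. Qed.
Let b0 : 0 < b. Proof. exact: noise_floor_gt0. Qed.
Let br : bcfun r. Proof. exact: bcfun_excited. Qed.
Let r0 x : 0 <= r x. Proof. exact: excited_ge0. Qed.

Let nn x := spike s b ph x + r x.
Let N := I nn.
Let bn : bcfun nn.
Proof. by apply: bcfunD => //; exact: (blip_bcfun ph (blip_spike b s0)). Qed.

Let NE : N = spikeZ s l rt b ph + I r. Proof. exact: itvint_spike_excited. Qed.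

Let N0 : 0 < N.
Proof.
rewrite NE; apply: ltr_wpDr; last exact: spikeZ_gt0.
by apply: (itvint_ge0 (l := l) (rt := rt)) => x _; exact: r0.
Qed.

Let p := sample_density F phi a guess w s.

Let pE x : p x = N^-1 * nn x.
Proof. by rewrite /p sample_density_spike// mulrC. Qed.

Let bp : bcfun p.
Proof. by rewrite (_ : p = fun x => N^-1 * nn x); [exact: bcfunZ|exact/funext]. Qed.

Let p_ge0 x : 0 <= p x.
Proof. by rewrite pE mulr_ge0 ?invr_ge0 ?(ltW N0)// addr_ge0// ltW// spike_gt0. Qed.

Let I_p f : bcfun f -> I (fun x => p x * f x) = N^-1 * I (fun x => nn x * f x).
Proof.
move=> bf; rewrite -(itvintZ lrt _ (bcfunM bn bf)); apply: itvint_eq => x _.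
by rewrite pE mulrA.
Qed.

Let I_p_lt f g : bcfun f -> bcfun g ->
  I (fun x => nn x * f x) < I (fun x => nn x * g x) ->
  I (fun x => p x * f x) < I (fun x => p x * g x).
Proof. by move=> bf bg h; rewrite !I_p// ltr_pM2l ?invr_gt0. Qed.

Let blm (th : R) : bcfun (logmodel s l rt b th). Proof. exact: bcfun_logmodel. Qed.
Let bsc : blip (score s l rt b). Proof. exact: blip_score. Qed.
Let bds : blip (dscore s l rt b). Proof. exact: blip_dscore. Qed.

Let ell_E th : expected_log_likelihood F phi a guess w s th =
  N^-1 * I (fun x => nn x * logmodel s l rt b th x).
Proof.
rewrite -I_p//; apply: itvint_eq => x _; congr (_ * _); exact: ln_model.
Qed.

Let ell_lt th th' :
  I (fun x => nn x * logmodel s l rt b th x) < I (fun x => nn x * logmodel s l rt b th' x) ->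
  expected_log_likelihood F phi a guess w s th <
  expected_log_likelihood F phi a guess w s th'.
Proof.
by move=> h; rewrite !ell_E ltr_pM2l; [exact: h|rewrite invr_gt0; exact: N0].
Qed.

Let inD (th : R) : data_interval guess w th <-> l <= th <= rt.
Proof. by rewrite /data_interval /= in_itv. Qed.

Lemma estimator_asymptotics : exists phi_star : R,
  [/\ argmax (data_interval guess w)
        (expected_log_likelihood F phi a guess w s) = [set phi_star],
      `|ph - phi_star| <= I r * w * (100 / 32)
    & forall (dT : measure_display) (T : measurableType dT)
             (Pr : probability T R) (X tphi : nat -> {RV Pr >-> R}),
        iid_with_density X (data_interval guess w) p ->
        is_estimator F (a ord0) guess w s X tphi ->
        ('E_Pr[tphi M] @[M --> \oo] --> phi_star%:E)%E /\
        exists V : R, (M%:R%:E * 'V_Pr[tphi M] @[M --> \oo] --> V%:E)%E /\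
          V <= 10 * s ^+ 2 * N].
Proof.
have [phis [[phisI near] sc strict bias]] :=
  ex_maximizer s0 b0 hl hr hbig hb br r0 hrho hgap.
have /andP[lphis phisr] := phisI.
have phisD : l <= phis <= rt by rewrite !ltW.
have wE : rt - l = w by lra.
rewrite wE in bias; exists phis; split; [|exact: bias|].
  apply/seteqP; split => [th [/= thD thmax]|th /= ->]; last first.
    split; first exact/inD.
    move=> y /inD yD; have [->|ne] := eqVneq y phis; first exact: lexx.
    exact: ltW (ell_lt (strict y yD ne)).
  apply/eqP; apply: contraT => ne; move/inD in thD.
  have h := thmax _ (proj2 (inD phis) phisD).
  by have := lt_le_trans (ell_lt (strict th thD ne)) h; rewrite ltxx.
move=> dT T Pr X tphi iid est.
have [_ [C1 [scC _]]] := bsc.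
have [_ [C2 [_ dsC]]] := bds.
have C1_ge0 : 0 <= C1 by exact: le_trans (scC 0 0).
have C2_ge0 : 0 <= C2.
  by have := dsC 1 0 0; rewrite subr0 normr1 mulr1 => /(le_trans (normr_ge0 _)).
pose B := C1 + C2 + 1.
have B0 : 0 < B by rewrite ltr_wpDl ?addr_ge0.
have scB th x : `|score s l rt b th x| <= B.
  by apply: (le_trans (scC th x)); rewrite /B; lra.
have dsB th th' x : `|dscore s l rt b th x - dscore s l rt b th' x| <= B * `|th - th'|.
  by apply: (le_trans (dsC th th' x)); rewrite ler_wpM2r// /B; lra.
have tphiP (M : nat) (t : T) : (forall i, (i < M)%N -> [set` `[l, rt]] (X i t)) ->
    argmax [set` `[l, rt]] (fun th => smean X (logmodel s l rt b th) M t) (tphi M t).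
  have E : log_likelihood F (a ord0) guess w s M (X^~ t) =
      fun th => smean X (logmodel s l rt b th) M t.
    apply/funext => th; rewrite /log_likelihood /smean; congr (_ * _).
    by apply: eq_bigr => i _; rewrite ln_model.
  by rewrite -E; exact: est.
have strict' th : [set` `[l, rt]] th -> th != phis ->
    I (fun x => p x * logmodel s l rt b th x) < I (fun x => p x * logmodel s l rt b phis x).
  rewrite /= in_itv/= => thD ne.
  exact: (I_p_lt (blm th) (blm phis) (strict th thD ne)).
have bscp := blip_bcfun phis bsc; have bdsp := blip_bcfun phis bds.
have sc' : I (fun x => p x * score s l rt b phis x) = 0 by rewrite (I_p bscp) sc mulr0.
have s2 : 0 < s ^+ 2 by rewrite exprn_gt0.
set S1 := I (fun x => nn x * score s l rt b phis x ^+ 2).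
set S2 := I (fun x => nn x * dscore s l rt b phis x).
have S1_le : s ^+ 2 * S1 <= 101 / 100.
  exact: (score_sqr_le s0 b0 hl hr br r0 hrho near sc).
have S2_ge : 32 / 100 <= s ^+ 2 * - S2.
  exact: (information_ge s0 b0 hl hr hbig hb br r0 hrho near).
have H_E : - I (fun x => p x * dscore s l rt b phis x) = N^-1 * - S2.
  by rewrite (I_p bdsp) mulrN.
have S2_gt0 : 0 < - S2.
  by rewrite -(pmulr_rgt0 _ s2); apply: lt_le_trans S2_ge; rewrite divr_gt0.
have H0 : 0 < - I (fun x => p x * dscore s l rt b phis x).
  by rewrite H_E mulr_gt0 ?invr_gt0.
have D1 x (th : R) := der_logmodel s0 lrt b0 x th.
have D2 x (th : R) := der_score s0 lrt b0 x th.
have bmsc (th : R) := bcfun_bmfun (blip_bcfun th bsc).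
have bmds (th : R) := bcfun_bmfun (blip_bcfun th bds).
have bml (th : R) := bcfun_bmfun (blm th).
split.
  exact: (cvg_expectation lrt (bcfun_bmfun bp) p_ge0 iid B0 bml bmsc bmds scB dsB D1 D2
    tphiP lphis phisr strict' sc' H0).
have := cvg_variance lrt (bcfun_bmfun bp) p_ge0 iid B0 bml bmsc bmds scB dsB D1 D2
  tphiP lphis phisr strict' sc' H0.
rewrite H_E (I_p (bcfunX 2 bscp)).
rewrite -/S1 => cv; eexists; split; first exact: cv.
(* [J] and [H] each carry a factor [N^-1], so [J / H^2] is [N] times a ratio of order [s^2]. *)
have -> : N^-1 * S1 / (N^-1 * - S2) ^+ 2 =
    s ^+ 2 * N * ((s ^+ 2 * S1) / (s ^+ 2 * - S2) ^+ 2).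
  move: S1 S2 N N0 S2_gt0 {cv S1_le S2_ge H_E} => u v k k0 v0.
  have vn : v != 0 by rewrite -oppr_eq0 gt_eqF.
  by field; rewrite vn !gt_eqF.
have B0' : 0 < s ^+ 2 * - S2 by exact: mulr_gt0.
(* [1.01 / 0.32^2] is about 9.86. *)
have q : s ^+ 2 * S1 / (s ^+ 2 * - S2) ^+ 2 <= 10.
  rewrite ler_pdivrMr ?exprn_gt0//; apply: (le_trans S1_le).
  apply: (@le_trans _ _ (10 * (32 / 100) ^+ 2)); first by lra.
  by rewrite ler_pM2l// lerXn2r// nnegrE ?(ltW B0')// divr_ge0.
by rewrite -[leRHS]mulrA [leRHS]mulrC ler_pM2l// mulr_gt0.
Qed.

End Asymptotics.

(** * From the promise to the smallness conditions *)

(** A nonempty interval inside [[d, 2 pi - d)] forces [d <= pi]. The inner buffer keeps both edges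
    at distance [w / 6], and the edge across [guess] is at least half the length away. *)
Lemma promise_bounds (R : realType) (n : nat) (phi : 'I_n.+1 -> R) (guess w d : R) :
  0 < d -> promise_interval phi guess w (w / 6) d ->
  [/\ 0 < w, w <= 2 * pi /\ d <= pi,
      w / 6 <= phi ord0 - (guess - w / 2) /\ w / 6 <= guess + w / 2 - phi ord0,
      w / 2 <= phi ord0 - (guess - w / 2) \/ w / 2 <= guess + w / 2 - phi ord0
    & forall j, j != ord0 ->
        phi j <= guess - w / 2 - d \/ guess + w / 2 + d <= phi j].
Proof.
move=> d0 [w0 sub phg out].
have hin (x : R) : guess - w / 2 <= x <= guess + w / 2 -> d <= x < 2 * pi - d.
  by move=> xD; have := sub x; rewrite /data_interval /= !in_itv/=; exact.
have /andP[l1 l2] := hin (guess - w / 2) ltac:(lra).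
have /andP[r1 r2] := hin (guess + w / 2) ltac:(lra).
move/ler_normlP: phg => [p1 p2].
split; [by []|by split; lra|by split; lra| |].
  by have [h|h] := leP guess (phi ord0); [left|right]; lra.
move=> j /out; rewrite in_itv/= negb_and -!ltNge => /orP[h|h]; [left|right]; lra.
Qed.

(** From [1.09^2 <= 1.2], the logarithm being nonnegative. *)
Lemma width_bound (R : realType) (w s y : R) : 0 < w -> 0 <= y -> 0 < s ->
  s <= w / 6 * Num.min 1 (Num.sqrt (12 / 10 + ln (1 + y)))^-1 ->
  109 / 100 * s <= w / 6.
Proof.
move=> w0 y0 s0 hs.
have ln0 : 0 <= ln (1 + y) by rewrite ln_ge0// lerDl.
have h : 109 / 100 <= Num.sqrt (12 / 10 + ln (1 + y)).
  have q0 : 0 <= 109 / 100 :> R by lra.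
  rewrite -(ger0_norm q0) -sqrtr_sqr; apply: ler_wsqrtr; lra.
have q0 : 0 < Num.sqrt (12 / 10 + ln (1 + y)) by apply: lt_le_trans h; lra.
have : s <= w / 6 / Num.sqrt (12 / 10 + ln (1 + y)).
  apply: (le_trans hs); rewrite ler_pM2l ?divr_gt0//.
  by rewrite ge_min lexx orbT.
rewrite ler_pdivlMr// mulrC; apply: le_trans.
by rewrite ler_wpM2r// ltW.
Qed.

Lemma itvint_excited_le (R : realType) (n : nat) (phi a : 'I_n.+1 -> R) (l rt s d : R) :
  0 < s -> l < rt -> 0 < d -> spectral_data phi a ->
  (forall j, j != ord0 -> phi j <= l - d \/ rt + d <= phi j) ->
  Rintegral (@lebesgue_measure R) [set` `[l, rt]] (excited phi a s) <=
  (1 - a ord0) / a ord0 * (s ^+ 2 / d * gauss s d).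
Proof.
move=> s0 lrt d0 [_ a_ge0 a1 a0] out.
rewrite /excited (itvint_sum _ _ lrt); last first.
  by move=> j; apply: bcfunZ; exact: (blip_bcfun (phi j) (blip_gauss s0)).
have -> : (1 - a ord0) / a ord0 * (s ^+ 2 / d * gauss s d) =
    \sum_(j < n.+1 | j != ord0) a j / a ord0 * (s ^+ 2 / d * gauss s d).
  rewrite -mulr_suml; congr (_ * _); rewrite -mulr_suml; congr (_ / _).
  by apply/eqP; rewrite subr_eq -a1 (bigD1 ord0)//= addrC.
apply: ler_sum => j j0.
rewrite (itvintZ lrt); last exact: (blip_bcfun (phi j) (blip_gauss s0)).
apply: ler_wpM2l; first by rewrite divr_ge0// ltW.
exact: itvint_gauss_far (out j j0).
Qed.

Section NoiseFloor.
Context (R : realType).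
Variables (F a0 s : R).
Hypothesis F0 : 0 < F.
Hypothesis F1 : F < 1.
Hypothesis ha0 : 0 < a0.
Hypothesis s0 : 0 < s.
Local Notation kap := ((1 - F) / (F * a0)).
Local Notation b := (noise_floor F a0 s).

Let kap0 : 0 < kap. Proof. by rewrite divr_gt0 ?mulr_gt0// subr_gt0. Qed.

Lemma noise_floor_le : b <= kap / (2 * pi).
Proof.
rewrite /noise_floor mulrC ler_pM2l// ler_pdivrMr ?mulr_gt0 ?pi_gt0//.
by rewrite mulVf ?gt_eqF ?mulr_gt0 ?pi_gt0// gauss_mass_le1.
Qed.

(** The 16 comes from [gauss_mass s >= 1/2] and [2 * pi <= 8]. *)
Lemma noise_floor_ge : s <= pi / 3 -> kap / 16 <= b.
Proof.
move=> sp; have p0 := pi_gt0 R; have p4 := pi_le4 R.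
rewrite /noise_floor [leRHS]mulrC ler_pM2l//.
rewrite ler_pdivlMr ?mulr_gt0//; apply: le_trans (gauss_mass_ge_half s0 sp).
by rewrite mulrC ler_pdivrMr//; lra.
Qed.

Lemma noise_floor_width_le (w : R) : 0 < w -> w <= 2 * pi -> b * w <= kap.
Proof.
move=> w0 wp; have p0 := pi_gt0 R.
apply: (@le_trans _ _ (kap / (2 * pi) * (2 * pi))).
  by apply: ler_pM => //; rewrite ?(ltW w0) ?noise_floor_le// /noise_floor
    mulr_ge0 ?(ltW kap0)// divr_ge0 ?mulr_ge0 ?(ltW p0)// Rintegral_ge0// => x _;
    exact/ltW/gauss_gt0.
by rewrite divfK// gt_eqF// mulr_gt0.
Qed.

End NoiseFloor.

(** Here [p] is the peak, [Z] the normalization, [G] the gap and [rho] the tail mass. As [p * s] is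
    of order 1, [b / p] is at most of order [kap * s]; and by [s^2 / d <= s], [rho * p / b] is at
    most of order [g / (a0 * kap)]. This dictates the bounds required of [s] and [g]. *)
Lemma perturbation_bounds (R : realType) (kap a0 s d g b p rho Z G q : R) :
  0 < kap -> 0 < a0 -> a0 <= 1 -> 0 < s -> 0 < d -> s <= d -> 0 <= g -> 0 < p ->
  1 / 3 <= p * s -> p * s <= 41 / 100 -> kap / 16 <= b -> b <= kap ->
  0 <= q -> q <= (1 / 1000) ^+ 2 / 3 -> s <= q / (1 + kap) ->
  0 <= rho -> rho <= (1 - a0) / a0 * (s ^+ 2 / d * g) ->
  0 < G -> G <= 1 / 1000 -> g <= G * (a0 * kap) / (200 * (1 + kap)) ->
  Z <= 1 + kap ->
  [/\ Num.sqrt (b / p) <= 1 / 1000, rho * (2 * p / b) <= 1 / 1000,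
      rho * (12 * Z * p / b) < G & rho <= 1 / 1000].
Proof.
move=> kap0 a00 a01 s0 d0 sd g0 p0 ps1 ps2 b1 b2 q0 q1 hs rho0 hrho G0 G1 hg hZ.
have b0 : 0 < b by apply: lt_le_trans b1; rewrite divr_gt0.
have k1 : 0 < 1 + kap by rewrite addr_gt0.
have ak : 0 < a0 * kap by rewrite mulr_gt0.
have hbp : b / p <= (1 / 1000) ^+ 2.
  rewrite ler_pdivrMr// -(ler_pM2r s0) -mulrA.
  apply: (@le_trans _ _ (kap * (q / (1 + kap)))).
    by apply: ler_pM; rewrite ?(ltW b0) ?(ltW s0).
  apply: (@le_trans _ _ q).
    rewrite mulrCA ler_piMr//.
    by rewrite ler_pdivrMr// mul1r lerDr.
  lra.
have hb : Num.sqrt (b / p) <= 1 / 1000.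
  have z0 : 0 <= 1 / 1000 :> R by clear; lra.
  by rewrite -[leRHS](ger0_norm z0) -sqrtr_sqr; exact: ler_wsqrtr.
have bp : b <= p.
  by have : b / p <= 1 by [apply: (le_trans hbp); clear; lra]; rewrite ler_pdivrMr// mul1r.
pose X := rho * (p / b).
have X0 : 0 <= X by rewrite mulr_ge0// divr_ge0 ?ltW.
(* [0.41 * 16 / 200 = 0.0328], and twelve times 0.033 stays below 1. *)
have hX : X * (1 + kap) <= 33 / 1000 * G.
  have rho1 : rho <= s * g / a0.
    apply: (le_trans hrho).
    apply: (@le_trans _ _ (1 / a0 * (s * g))); last by rewrite mul1r mulrC.
    apply: ler_pM.
    - by rewrite divr_ge0 ?subr_ge0// ltW.
    - by rewrite mulr_ge0// divr_ge0 ?sqr_ge0// ltW.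
    - by rewrite ler_pM2r ?invr_gt0// gerBl ltW.
    - by rewrite ler_wpM2r// ler_pdivrMr// expr2 ler_pM2l.
  have pb : p / b <= p * (16 / kap).
    rewrite ler_pM2l// -[16 / kap]invf_div lef_pV2 ?posrE// divr_gt0//.
  have h1 : X <= s * g / a0 * (p * (16 / kap)).
    by apply: ler_pM => //; rewrite divr_ge0// ltW.
  have h2 : s * g / a0 * (p * (16 / kap)) = p * s * (16 * g / (a0 * kap)).
    by field; rewrite !gt_eqF.
  have g1 : 0 <= 16 * g / (a0 * kap) by rewrite divr_ge0 ?mulr_ge0// ltW.
  have h3 : X <= 41 / 100 * (16 * g / (a0 * kap)).
    by apply: (le_trans h1); rewrite h2 ler_wpM2r.
  have h4 : 16 * g / (a0 * kap) * (1 + kap) <= 16 / 200 * G.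
    have -> : 16 / 200 * G = 16 * (G * (a0 * kap) / (200 * (1 + kap))) / (a0 * kap) * (1 + kap).
      by field; rewrite !gt_eqF.
    by rewrite ler_pM2r// ler_pM2r ?invr_gt0// ler_pM2l.
  have h5 : X * (1 + kap) <= 41 / 100 * (16 * g / (a0 * kap)) * (1 + kap) by rewrite ler_pM2r.
  rewrite -mulrA in h5; move: h4 h5 G0; clear; lra.
have X1 : X <= 33 / 1000 * G.
  by apply: le_trans hX; rewrite ler_peMr// lerDl ltW.
split.
- exact: hb.
- by rewrite (_ : _ * _ = 2 * X); [move: X1 G1; clear; lra|rewrite /X; ring].
- rewrite (_ : _ * _ = 12 * (X * Z)); last by rewrite /X; ring.
  have := ler_wpM2l X0 hZ; move: hX G0; clear; lra.
- apply: (@le_trans _ _ X); last by move: X1 G1; clear; lra.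
  by rewrite ler_peMr// ler_pdivlMr// mul1r.
Qed.


Lemma gap_constant_gt0 (R : realType) (c : R) : 0 < c ->
  0 < (expR (- (c / 4) ^+ 2 / 2) - expR (- (3 * c / 4) ^+ 2 / 2)) ^+ 2 * c / 100.
Proof.
move=> c0; rewrite divr_gt0// mulr_gt0// exprn_gt0// subr_gt0 ltr_expR.
by rewrite ltr_pM2r// ltrN2 ltrXn2r//= ?nnegrE; lra.
Qed.

Theorem lemma29 (R : realType) (F a0 : R) (hF : 0 < F < 1) (ha0 : 0 < a0) :
  exists C eps : R, 0 < eps /\
  forall (n : nat) (phi a : 'I_n.+1 -> R) (guess w d sigma : R),
    spectral_data phi a -> a ord0 = a0 ->
    0 < d -> promise_interval phi guess w (w / 6) d ->
    0 < sigma ->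
    sigma <= w / 6 * Num.min 1
      (Num.sqrt (12 / 10
         + ln (1 + 7 / 10 * (w / (2 * pi)) * ((1 - F) / (F * a0)))))^-1 ->
    gauss sigma d < eps ->
    exists phi_star : R,
      [/\ argmax (data_interval guess w)
            (expected_log_likelihood F phi a guess w sigma) = [set phi_star],
          `|phi ord0 - phi_star| <=
            22 * sigma ^+ 2 * gauss sigma d * ((1 - a0) / a0)
              * (1 + (1 - F) / (F * a0)) * (w / d)
            + C * gauss sigma d ^+ 2
        & forall (dT : measure_display) (T : measurableType dT)
                 (Pr : probability T R) (X tphi : nat -> {RV Pr >-> R}),
            iid_with_density X (data_interval guess w)
              (sample_density F phi a guess w sigma) ->
            is_estimator F a0 guess w sigma X tphi ->
            ('E_Pr[tphi M] @[M --> \oo] --> phi_star%:E)%E /\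
            exists V : R,
              (M%:R%:E * 'V_Pr[tphi M] @[M --> \oo] --> V%:E)%E /\
              V <= 11 * sigma ^+ 2 * (1 + (1 - F) / (F * a0))
                     * (1 + 1 / (2 * pi) * ((1 - F) / (F * a0)))
                   + C * gauss sigma d].
Proof.
have /andP[F0 F1] := hF.
have [kap kap0 kapE] : exists2 kap : R, 0 < kap & kap = (1 - F) / (F * a0).
  by eexists; last reflexivity; rewrite divr_gt0 ?mulr_gt0// subr_gt0.
have k1 : 0 < 1 + kap by rewrite addr_gt0.
have [Ga Ga0 GaE] : exists2 Ga : R, 0 < Ga & Ga =
    let c := 1 / 1000 / 1000 in
    (expR (- (c / 4) ^+ 2 / 2) - expR (- (3 * c / 4) ^+ 2 / 2)) ^+ 2 * c / 100.
  by eexists; last reflexivity; apply: gap_constant_gt0; lra.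
pose G := Num.min Ga (1 / 1000).
have G0 : 0 < G by rewrite lt_min Ga0/=; lra.
have [G1 GGa] : G <= 1 / 1000 /\ G <= Ga by rewrite /G !ge_min !lexx orbT.
move: G G0 G1 GGa => G G0 G1 GGa.
have [q q0 q1] : exists2 q : R, 0 < q & q <= (1 / 1000) ^+ 2 / 3.
  by exists ((1 / 1000) ^+ 2 / 3); clear; lra.
have [eps [eps0 heps]] := small_gauss (divr_gt0 q0 k1).
(* The first threshold makes the width at most [d] and at most [q / (1 + kap)]; the second makes the
   tails small against the floor and the Hellinger gap. Both depend on [F] and [a0] only. *)
exists 0, (Num.min eps (G * (a0 * kap) / (200 * (1 + kap)))); split.
  by rewrite lt_min eps0 divr_gt0 ?mulr_gt0 ?ltr0n.
move=> n phi a guess w d s spec aE d0 prom s0; rewrite -kapE => hs.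
rewrite lt_min => /andP[g1 g2].
have [w0 [w2pi dpi] [hl hr] hbig out] := promise_bounds d0 prom.
have [_ a_ge0 asum _] := spec.
have p0 := pi_gt0 R; have p4 := pi_le4 R.
have wpi : 0 <= w / (2 * pi) by rewrite divr_ge0 ?mulr_ge0 ?(ltW w0) ?(ltW p0).
have y0 : 0 <= 7 / 10 * (w / (2 * pi)) * kap.
  by apply: mulr_ge0 (ltW kap0); apply: mulr_ge0 wpi; rewrite divr_ge0.
have ws := width_bound w0 y0 s0 hs.
have s3 : s <= pi / 3 by move: ws w2pi s0; clear; lra.
have s43 : s <= 4 / 3 by move: s3 p4; clear; lra.
have [sd sde] := heps s d s0 s43 d0 (le_trans dpi p4) g1.
have pk0 := peak_gt0 s0.
have a01 : a ord0 <= 1.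
  by rewrite -asum (bigD1 ord0)//= lerDl sumr_ge0.
have m0 : 0 < gauss_mass s.
  by apply: lt_le_trans (gauss_mass_ge_half s0 s3); rewrite divr_gt0.
have lrt : guess - w / 2 < guess + w / 2 by move: w0; clear; lra.
have hI0 : 0 <= Rintegral lebesgue_measure [set` `[guess - w / 2, guess + w / 2]]
    (excited phi a s).
  apply: (itvint_ge0 (l := guess - w / 2) (rt := guess + w / 2)) => x _.
  by apply: excited_ge0; rewrite ?aE.
have hI := itvint_excited_le s0 lrt d0 spec out.
have hb0 : 0 < noise_floor F a0 s by exact: noise_floor_gt0.
have hb1 : kap / 16 <= noise_floor F a0 s by rewrite kapE; exact: noise_floor_ge.
have hb2 : noise_floor F a0 s <= kap.
  apply: (le_trans (noise_floor_le F0 F1 ha0 s0)); rewrite -kapE.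
  by rewrite ler_pdivrMr ?mulr_gt0// ler_peMr ?(ltW kap0)//; move: (pi_ge3 R); clear; lra.
have hbw : noise_floor F a0 s * w <= kap by rewrite kapE; exact: noise_floor_width_le.
have hZ : spikeZ s (guess - w / 2) (guess + w / 2) (noise_floor F a0 s) (phi ord0) <= 1 + kap.
  rewrite /spikeZ (itvintD lrt (blip_bcfun _ (blip_gauss s0)) (bcfun_cst _)) itvint_cst//.
  apply: lerD.
    rewrite (itvint_eq (g := normal_pdf (phi ord0) s)); last by move=> x _; exact: gauss_pdf.
    by apply: itvint_pdf_le1; rewrite ?gt_eqF.
  by rewrite (_ : _ - _ = w)//; clear; lra.
rewrite aE in a01 hI.
have [hyp1 hyp2 hyp3 hyp4] := perturbation_bounds kap0 ha0 a01 s0 d0 sd (ltW (gauss_gt0 s0 d))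
  pk0 (peak_ge s0) (peak_le s0) hb1 hb2 (ltW q0) q1 sde hI0 hI G0
  G1 (ltW g2) hZ.
have hl' : 107 / 100 * s <= phi ord0 - (guess - w / 2).
  by apply: le_trans hl; move: ws s0; clear; lra.
have hr' : 107 / 100 * s <= guess + w / 2 - phi ord0.
  by apply: le_trans hr; move: ws s0; clear; lra.
have hbig' : 325 / 100 * s <= phi ord0 - (guess - w / 2) \/
    325 / 100 * s <= guess + w / 2 - phi ord0.
  have ws' : 325 / 100 * s <= w / 2 by move: ws s0; clear; lra.
  by case: hbig => h; [left|right]; exact: le_trans h.
have hyp3' := lt_le_trans hyp3 GGa.
rewrite GaE in hyp3'; have ha : 0 < a ord0 by rewrite aE.
rewrite -aE in hyp1 hyp2 hyp3'.
have [phis [argE bias var]] := estimator_asymptotics F0 F1 ha a_ge0 s0 m0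
  hl' hr' hbig' hyp1 hyp2 hyp3'.
exists phis; split.
- by [].
- rewrite mul0r addr0; apply: (le_trans bias).
  set A := (1 - a0) / a0; set g := gauss s d.
  have A0 : 0 <= A by rewrite divr_ge0 ?subr_ge0// ltW.
  have U0 : 0 <= A * (s ^+ 2 / d * g) * w.
    apply: mulr_ge0 (ltW w0); apply: (mulr_ge0 A0); apply: mulr_ge0.
      by rewrite divr_ge0 ?sqr_ge0// ltW.
    exact: ltW (gauss_gt0 s0 d).
  apply: (@le_trans _ _ (A * (s ^+ 2 / d * g) * w * (100 / 32))).
    by rewrite ler_pM2r// ler_pM2r.
  have -> : 22 * s ^+ 2 * g * A * (1 + kap) * (w / d) =
      A * (s ^+ 2 / d * g) * w * (22 * (1 + kap)) by ring.
  rewrite ler_wpM2l//; move: kap0; clear; lra.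
- move=> dT T Pr X tphi iid est.
  rewrite -aE in est.
  have [cE [V [cV hV]]] := var dT T Pr X tphi iid est.
  split; first exact: cE.
  exists V; split; first exact: cV.
  rewrite mul0r addr0; apply: (le_trans hV).
  rewrite (itvint_spike_excited F phi a guess s0 w0) aE.
  set N := _ + _.
  (* [N] is the normalization, at most [1 + kap], plus the tail mass, at most 0.001. *)
  have hN : 10 * N <= 11 * (1 + kap).
    by have := lerD hZ hyp4; rewrite -/N; move: kap0; clear; lra.
  have t0 : 0 <= 1 / (2 * pi) * kap by rewrite mulr_ge0 ?(ltW kap0)// divr_ge0// mulr_ge0// ltW.
  apply: (@le_trans _ _ (s ^+ 2 * (11 * (1 + kap)))).
    by rewrite [leLHS](_ : _ = s ^+ 2 * (10 * N)); [rewrite ler_wpM2l ?sqr_ge0|ring].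
  rewrite (_ : 11 * s ^+ 2 * (1 + kap) = s ^+ 2 * (11 * (1 + kap))); last by ring.
  by rewrite ler_peMr ?lerDl// mulr_ge0 ?sqr_ge0// mulr_ge0// ltW.
Qed.
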